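(* Let $P=\mathbb{CP}^n$ or $\mathbb{HP}^n$ with the Hopf normalization. If $F:\Sigma\to P$ is a closed connected immersed hypersurface, then $$r_f(F,P)\le\frac{\pi}{4}.$$ For a one-sided immersion, $r_f$ is understood on the two-sided normal cover.
   Context: Hopf normalization: the metric on $\mathbb{CP}^n$ (resp. $\mathbb{HP}^n$) is the quotient metric making the Hopf fibration $S^{2n+1}(1)\to\mathbb{CP}^n$ (resp. $S^{4n+3}(1)\to\mathbb{HP}^n$), with fibre $S^1$ (resp. $S^3$), from the unit round sphere a Riemannian submersion. Focal radius: for a two-sided immersion $F:\Sigma\to P$ with unit normal field $\nu$, put $\Phi_t(x)=\exp_{F(x)}(t\nu_x)$. Then $r_f(F,P)=\sup\{r>0:\Phi_t\text{ is nonsingular (an immersion) for every }|t|<r\}$. For a one-sided immersion, the two-sided normal cover is the double cover $\{(x,n):x\in\Sigma,\ n\text{ a unit normal of }F\text{ at }x\}$ of $\Sigma$, on which $F$ lifts to a two-sided immersion. ''Closed'' means compact without boundary. *)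

(* Defs.v *)
From HB Require Import structures.
From mathcomp Require Import all_boot all_order all_algebra.
From mathcomp Require Import all_classical all_reals all_analysis.

Set Implicit Arguments.
Unset Strict Implicit.
Unset Printing Implicit Defensive.

Import Order.TTheory GRing.Theory Num.Theory.
Import numFieldNormedType.Exports.

Local Open Scope classical_set_scope.
Local Open Scope ring_scope.

Section Smooth.
Context {R : realType} {E E' : normedModType R}.

Fixpoint ndifferentiable_on (k : nat) (U : set E) (f : E -> E') : Prop :=
  if k is k'.+1 then
    (forall x, U x -> differentiable f x) /\
    (forall v, ndifferentiable_on k' U (fun x => 'd f x v))
  else True.

(* Differentiability of all iterated directional derivatives on an open set
   amounts to f being of class C^oo there, E being finite-dimensional below. *)
Definition smooth_at (f : E -> E') (x : E) : Prop :=
  exists U : set E, open_nbhs x U /\ forall k, ndifferentiable_on k U f.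

End Smooth.

Record chart (M : Type) (R : realType) (E : normedModType R) := Chart {
  dom : set M ;
  coord : M -> E }.

HB.instance Definition _ M R E := gen_eqMixin (@chart M R E).
HB.instance Definition _ M R E := gen_choiceMixin (@chart M R E).

Section Atlas.
Context {R : realType} {E : normedModType R} {M : choiceType}.
Variable A : set (chart M E).

(* The inverse of a chart; the junk value p0 is taken outside the image. *)
Definition cinv (c : chart M E) (p0 : M) (y : E) : M :=
  xget p0 [set p | dom c p /\ coord c p = y].

(* A preferred chart around each point. A tangent vector at p is represented
   by its coordinates, an element of E, in the chart chart_at p. *)
Definition chart_at (p : M) : chart M E :=
  xget (Chart set0 (fun=> 0)) [set c | A c /\ dom c p].

Definition coord_at (p : M) : M -> E := coord (chart_at p).
Definition cinv_at (p : M) : E -> M := cinv (chart_at p) p.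

(* tangent_from p q turns the coordinates, in the chart around p, of a tangent
   vector at q into its representative at q; tangent_to p q is its inverse. *)
Definition tangent_from (p q : M) (v : E) : E :=
  'd (coord_at q \o cinv_at p) (coord_at p q) v.
Definition tangent_to (p q : M) (v : E) : E :=
  'd (coord_at p \o cinv_at q) (coord_at q q) v.

Definition smooth_curve (gam : R -> M) : Prop := forall t : R,
  (\forall s \near t, dom (chart_at (gam t)) (gam s)) /\
  smooth_at (E := R) (coord_at (gam t) \o gam) t.

Definition velocity (gam : R -> M) (t : R) : E :=
  derive1 (coord_at (gam t) \o gam) t.

End Atlas.

Section Manifold.
Context {R : realType} {E : normedModType R}.

Definition is_chart (M : topologicalType) (c : chart M E) : Prop :=
  [/\ open (dom c), {in dom c &, injective (coord c)},
      open (coord c @` dom c) &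
      forall U : set M, U `<=` dom c -> (open U <-> open (coord c @` U))].

Definition smooth_atlas (M : topologicalType) (A : set (chart M E)) : Prop :=
  [/\ forall p, exists2 c, A c & dom c p,
      forall c, A c -> is_chart c &
      forall c c' p, A c -> A c' -> dom c p -> dom c' p ->
        smooth_at (coord c' \o cinv c p) (coord c p)].

Definition smooth_manifold (M : topologicalType) (A : set (chart M E)) : Prop :=
  [/\ hausdorff_space M, @second_countable M & smooth_atlas A].

Definition closed_connected_manifold (M : topologicalType)
    (A : set (chart M E)) : Prop :=
  [/\ smooth_manifold A, [set: M] !=set0,
      compact [set: M] & connected [set: M]].

End Manifold.

Section Maps.
Context {R : realType} {E E' : normedModType R} {M N : choiceType}.
Variables (A : set (chart M E)) (B : set (chart N E')).

Definition local_map (F : M -> N) (x : M) : E -> E' :=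
  coord_at B (F x) \o F \o cinv_at A x.

Definition smooth_map (F : M -> N) : Prop := forall x,
  (\forall y \near coord_at A x x, dom (chart_at B (F x)) (F (cinv_at A x y))) /\
  smooth_at (local_map F x) (coord_at A x x).

Definition mdiff (F : M -> N) (x : M) (u : E) : E' :=
  'd (local_map F x) (coord_at A x x) u.

Definition immersion (F : M -> N) : Prop :=
  smooth_map F /\ forall x, injective (mdiff F x).

End Maps.

Section Riemannian.
Context {R : realType} {E : normedModType R} {N : choiceType}.
Variables (B : set (chart N E)) (g : N -> E -> E -> R).

Definition local_metric (p : N) (u v : E) (y : E) : R :=
  let q := cinv_at B p y in g q (tangent_from B p q u) (tangent_from B p q v).

Definition riemannian_metric : Prop :=
  [/\ forall p a u v w, g p (a *: u + v) w = a * g p u w + g p v w,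
      forall p u v, g p u v = g p v u,
      forall p u, u != 0 -> 0 < g p u u &
      forall p u v, smooth_at (local_metric p u v) (coord_at B p p)].

(* The Christoffel symbol of the first kind at p, evaluated on u, w and v *)
Definition christoffel (p : N) (u w v : E) : R :=
  2^-1 * ('D_u (local_metric p w v) (coord_at B p p)
        + 'D_w (local_metric p u v) (coord_at B p p)
        - 'D_v (local_metric p u w) (coord_at B p p)).

(* The covariant derivative of the velocity vanishes; in the chart around
   gam t, this equation is written with its index lowered by g. *)
Definition geodesic (gam : R -> N) : Prop :=
  smooth_curve B gam /\
  forall t v,
    let x := coord_at B (gam t) \o gam in
    g (gam t) (derive1 (derive1 x) t) v + christoffel (gam t) (derive1 x t) (derive1 x t) v = 0.

(* Geodesics are defined on the whole line, so this is the exponential map of a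
   complete metric only; the value p is junk, taken if no geodesic exists. *)
Definition rexp (p : N) (v : E) : N :=
  xget p [set q | exists gam : R -> N,
    [/\ geodesic gam, gam 0 = p, velocity B gam 0 = v & gam 1 = q]].

End Riemannian.

Section Hypersurface.
Context {R : realType} {E E' : normedModType R} {M N : choiceType}.
Variables (A : set (chart M E)) (B : set (chart N E')).
Variables (g : N -> E' -> E' -> R) (F : M -> N).

Definition unit_normal (x : M) (v : E') : Prop :=
  (forall u, g (F x) (mdiff A B F x u) v = 0) /\ g (F x) v v = 1.

Definition unit_normal_field (W : set M) (nu : M -> E') : Prop :=
  forall x, W x -> unit_normal x (nu x) /\
    smooth_at (fun y => let x' := cinv_at A x y in
                        tangent_to B (F x) (F x') (nu x')) (coord_at A x x).

Definition two_sided : Prop := exists nu, unit_normal_field [set: M] nu.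

Definition normal_flow (nu : M -> E') (t : R) (x : M) : N :=
  rexp B g (F x) (t *: nu x).

Definition focal_radius (nu : M -> E') : \bar R :=
  ereal_sup [set r%:E | r in [set r : R | 0 < r /\
    forall t, `|t| < r -> immersion A B (normal_flow nu t)]].

Definition normal_cover := {q : M * E' | `[< unit_normal q.1 q.2 >]}.

(* A chart c of M and a smooth unit normal field nu on an open subset W of its
   domain give a chart of the sheet of the cover over W defined by nu. The
   openness of W is expressed in coordinates, as M carries no topology here. *)
Definition normal_cover_atlas : set (chart normal_cover E) :=
  [set d | exists c W nu,
    [/\ A c, W `<=` dom c, open (coord c @` W), unit_normal_field W nu &
        d = Chart [set q : normal_cover | W (val q).1 /\ (val q).2 = nu (val q).1]
                  (fun q => coord c (val q).1)]].

Definition cover_map (q : normal_cover) : N := F (val q).1.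
Definition cover_normal (q : normal_cover) : E' := (val q).2.

End Hypersurface.

Arguments normal_cover {R E E' M N} A B g F.
Arguments normal_cover_atlas {R E E' M N} A B g F.
Arguments cover_map {R E E' M N} A B g F.
Arguments cover_normal {R E E' M N} A B g F.

Section Hopf.
Variable R : realType.

Inductive scalars := Complex | Quaternion.

Variable K : scalars.

Definition kdim : nat := (match K with Complex => 1 | Quaternion => 3 end).+1.

Variable n : nat.

(* A scalar is its row of real components; a vector of K^(n+1) is the matrix
   whose rows are its n+1 entries. *)
Local Notation scal := 'rV[R]_kdim.
Local Notation vect := 'M[R]_(n.+1, kdim).
Local Notation model := 'M[R]_(n, kdim).

Definition kmul (p q : scal) : scal :=
  let a i := p 0 (inord i) in let b i := q 0 (inord i) in
  \row_k nth 0 (match K with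
    | Complex =>
      [:: a 0%N * b 0%N - a 1%N * b 1%N;
          a 0%N * b 1%N + a 1%N * b 0%N]
    | Quaternion =>
      [:: a 0%N * b 0%N - a 1%N * b 1%N - a 2%N * b 2%N - a 3%N * b 3%N;
          a 0%N * b 1%N + a 1%N * b 0%N + a 2%N * b 3%N - a 3%N * b 2%N;
          a 0%N * b 2%N - a 1%N * b 3%N + a 2%N * b 0%N + a 3%N * b 1%N;
          a 0%N * b 3%N + a 1%N * b 2%N - a 2%N * b 1%N + a 3%N * b 0%N]
    end) k.

Definition dot (a b : nat) (x y : 'M[R]_(a, b)) : R :=
  \sum_i \sum_j x i j * y i j.

Definition kinv (q : scal) : scal :=
  (dot q q)^-1 *: \row_k (if k == 0 then q 0 k else - q 0 k).

Definition kact (z : vect) (q : scal) : vect :=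
  \matrix_(i, k) kmul (row i z) q 0 k.

Definition sphere := {z : vect | dot z z == 1}.

Definition hopf_fibre (z : vect) : set vect :=
  [set kact z q | q in [set q : scal | dot q q = 1]].

(* The points of CP^n or HP^n are the fibres of the Hopf fibration. *)
Definition proj_space :=
  {L : set vect | `[< exists z : sphere, L = hopf_fibre (val z) >]}.

Definition hopf (z : sphere) : proj_space :=
  exist _ (hopf_fibre (val z))
    (asboolT (ex_intro _ z (erefl (hopf_fibre (val z))))).

(* Affine coordinates (z_j z_i^-1), for j <> i *)
Definition affine_coord (i : 'I_n.+1) (z : vect) : model :=
  \matrix_(j, k) kmul (row (lift i j) z) (kinv (row i z)) 0 k.

Definition affine_chart (i : 'I_n.+1) : chart proj_space model :=
  Chart [set p : proj_space | exists2 z, val p z & row i z != 0]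
        (fun p => affine_coord i (xget 0 (val p))).

Definition proj_atlas : set (chart proj_space model) := range affine_chart.

Definition speed0 (c : R -> sphere) : vect := derive1 (fun t => val (c t) : vect) 0.

Definition sphere_curve (c : R -> sphere) : Prop :=
  derivable (fun t => val (c t) : vect) 0 1.

(* a is orthogonal to the velocities at z of the curves in the fibre of z. *)
Definition horizontal (z : sphere) (a : vect) : Prop :=
  forall c, sphere_curve c -> c 0 = z -> (forall t, hopf (c t) = hopf z) ->
    dot a (speed0 c) = 0.

(* The differential of the Hopf map is isometric on horizontal tangent vectors,
   given as velocities of curves in the sphere; this determines g. *)
Definition hopf_riemannian_submersion
    (g : proj_space -> model -> model -> R) : Prop :=
  forall c c' : R -> sphere, sphere_curve c -> sphere_curve c' -> c 0 = c' 0 ->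
    horizontal (c 0) (speed0 c) -> horizontal (c 0) (speed0 c') ->
    g (hopf (c 0)) (velocity proj_atlas (hopf \o c) 0)
                   (velocity proj_atlas (hopf \o c') 0)
    = dot (speed0 c) (speed0 c').

End Hopf.

Arguments proj_atlas : clear implicits.

(* Main.v *)
(* A point zK of the projective space is represented by the matrix of the real
   orthogonal projector Q onto the line zK, which turns the metric into a multiple
   of the trace form. A curve is then a geodesic iff q'' is trace-orthogonal to the
   tangent space, so that the momentum [q', q] is constant; hence the geodesic with
   initial data Q, X, where X is a unit tangent vector, is
     q(t) = (cos^2 t - sin^2 t) Q + sin t cos t X + sin^2 t X^2.
   For a local lift of the hypersurface, with unit normal X, the differential of
   the normal flow at time t is obtained by differentiating this formula. With
   k = cot t, it is singular as soon as the symmetric pencil k A - P / k + B is,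
   where A is the first fundamental form, B comes from the second one, and P
   measures the directions X.i, i imaginary. If there is no focal point for
   |t| <= pi/4, the pencil is nonsingular for |k| >= 1; this makes A - P + B and
   A - P - B positive definite, contradicting A - P = 0 on the direction X.i. *)

From HB Require Import structures.
Require Import Defs.
From mathcomp Require Import all_boot all_order all_algebra.
From mathcomp Require Import all_classical all_reals all_analysis.
From mathcomp Require Import ring lra.

Set Implicit Arguments.
Unset Strict Implicit.
Unset Printing Implicit Defensive.

Import Order.TTheory GRing.Theory Num.Theory.
Import numFieldNormedType.Exports.

Local Open Scope classical_set_scope.
Local Open Scope ring_scope.

(** * Differential calculus *)

(** In the Hopf normalization the normal X spans planes of curvature 4 with the directions X.i, and
    of curvature 1 with those orthogonal to all of them. On the unit vectors X.i the terms in A and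
    P of the pencil add up to k - 1/k = 2 cot 2t, which vanishes at t = pi/4: this is the origin of
    the constant. The X.i need not be principal directions, so the Jacobi equation does not split
    along the eigenspaces of the second fundamental form; positivity of whole forms replaces an
    argument on eigenvectors. Reversing t changes the sign of k, which has the same effect as
    changing that of B.

    The metric is given only by the submersion property, and the exponential map only as a choice
    among geodesics. Projectors remove the charts from both: the differential of an inverse chart
    identifies coordinates with matrices, and the geodesic equation becomes a statement on second
    derivatives of matrix curves. Constancy of the momentum also yields uniqueness of geodesics,
    with no appeal to a general theorem on differential equations. Scalars enter as real matrices of
    right multiplication, so both kinds of space share one proof. *)

Section Differentials.
Context {R : realType}.
Implicit Types V W : normedModType R.

Lemma near_is_diff V W (f g : V -> W) (x : V) :
  (\forall y \near x, f y = g y) -> differentiable f x ->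
  differentiable g x /\ 'd g x = 'd f x :> (V -> W).
Proof.
move=> fg df; have fgx : f x = g x := nbhs_singleton fg.
have dfc : continuous ('d f x) by exact: diff_continuous.
have gE : g \o shift x = cst (g x) + 'd f x +o_ (0 : V) id.
  apply/eqaddoP => _ /posnumP[e].
  have /diff_locallyP[_ /eqaddoP/(_ _ (gt0 e))] := df.
  have : \forall h \near (0 : V), f (h + x) = g (h + x).
    by move: fg; rewrite (near_shift 0) subr0.
  apply: filterS2 => h fgh; rewrite /= !fctE /=.
  by rewrite -fgx -fgh.
split; last exact: diff_unique.
by apply/diff_locallyP; rewrite (diff_unique dfc gE).
Qed.

Lemma is_diff_sum V W n (f df : 'I_n -> V -> W) x :
  (forall i, is_diff x (f i) (df i)) -> is_diff x (\sum_i f i) (\sum_i df i).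
Proof.
move=> fd; elim/big_ind2 : _ => //; first exact: is_diff_cst.
by move=> a a' b b' ? ?; exact: is_diffD.
Qed.

Lemma linear_mx_continuous V m n (L : {linear 'M[R]_(m, n) -> V}) : continuous L.
Proof.
have -> : (L : _ -> _) =
    \sum_i \sum_j (fun M : 'M[R]_(m, n) => M i j *: L (delta_mx i j)).
  apply/funext => M; rewrite {1}(matrix_sum_delta M) linear_sum fct_sumE.
  apply: eq_bigr => i _; rewrite linear_sum fct_sumE.
  by apply: eq_bigr => j _; rewrite linearZ.
move=> M; apply: differentiable_continuous.
apply: differentiable_sum => i; apply: differentiable_sum => j.
exact/differentiableZl/differentiable_coord.
Qed.

Lemma is_diff_linear_comp V W W' (L : {linear W -> W'}) (f df : V -> W) x :
  continuous L -> is_diff x f df -> is_diff x (L \o f) (L \o df).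
Proof.
move=> Lc fd; have Ld : is_diff (f x) L L.
  by apply: DiffDef; [exact: linear_differentiable|exact: diff_lin].
exact: is_diff_comp.
Qed.

Lemma is_diff_linear V W (L : {linear V -> W}) x : continuous L -> is_diff x L L.
Proof.
by move=> Lc; apply: DiffDef; [exact: linear_differentiable|exact: diff_lin].
Qed.

Definition mxcoord m n i j (M : 'M[R]_(m, n)) : R := M i j.
Lemma mxcoord_is_linear m n i j : linear (@mxcoord m n i j).
Proof. by move=> a u v; rewrite /mxcoord !mxE. Qed.
HB.instance Definition _ m n i j :=
  GRing.isLinear.Build _ _ _ _ _ (@mxcoord_is_linear m n i j).

(** Entries are continuous linear functions, and a matrix is the sum of its entries times basis
    matrices. The product rules for matrices are thereby reduced to the scalar one. *)
Lemma is_diff_mxP V m n (f df : V -> 'M[R]_(m, n)) x :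
  is_diff x f df <->
  (forall i j, is_diff x (fun y => f y i j) (fun v => df v i j)).
Proof.
split=> [fd i j|fd].
  exact: (is_diff_linear_comp (@linear_mx_continuous _ _ _ (@mxcoord m n i j)) fd).
have E (g : V -> 'M[R]_(m, n)) :
    g = \sum_i \sum_j (fun y => g y i j *: delta_mx i j).
  apply/funext => y; rewrite {1}(matrix_sum_delta (g y)) fct_sumE.
  by apply: eq_bigr => i _; rewrite fct_sumE.
rewrite (E f) (E df); apply: is_diff_sum => i; apply: is_diff_sum => j.
have [fij dfij] := fd i j.
by apply: DiffDef; [exact: differentiableZl|rewrite diffZl // dfij].
Qed.

Lemma is_diff_ext V W (f df df' : V -> W) x :
  is_diff x f df -> (forall v, df v = df' v) -> is_diff x f df'.
Proof. by move=> fd /funext <-. Qed.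

Lemma is_diff_add V W (f df g dg : V -> W) x :
  is_diff x f df -> is_diff x g dg ->
  is_diff x (fun y => f y + g y) (fun v => df v + dg v).
Proof. exact: is_diffD. Qed.

Lemma is_diff_sub V W (f df g dg : V -> W) x :
  is_diff x f df -> is_diff x g dg ->
  is_diff x (fun y => f y - g y) (fun v => df v - dg v).
Proof. exact: is_diffB. Qed.

Lemma is_diff_mul V (f g df dg : V -> R) x :
  is_diff x f df -> is_diff x g dg ->
  is_diff x (fun y => f y * g y) (fun v => df v * g x + f x * dg v).
Proof.
move=> fd gd; apply: is_diff_eq (is_diffM fd gd) _.
by apply/funext => v; rewrite !fctE addrC; congr (_ + _); exact: mulrC.
Qed.

Lemma is_diff_mulmx V m n p (f df : V -> 'M[R]_(m, n)) (g dg : V -> 'M[R]_(n, p)) x :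
  is_diff x f df -> is_diff x g dg ->
  is_diff x (fun y => f y *m g y) (fun v => df v *m g x + f x *m dg v).
Proof.
move=> /is_diff_mxP fd /is_diff_mxP gd; apply/is_diff_mxP => i j.
have -> : (fun y => (f y *m g y) i j) = \sum_k (fun y => f y i k * g y k j).
  by apply/funext => y; rewrite mxE fct_sumE.
have -> : (fun v => (df v *m g x + f x *m dg v) i j) =
          \sum_k (fun v => df v i k * g x k j + f x i k * dg v k j).
  by apply/funext => y; rewrite !mxE fct_sumE big_split.
by apply: is_diff_sum => k; exact: is_diff_mul.
Qed.

Lemma is_diff_scale V m n (f df : V -> R) (g dg : V -> 'M[R]_(m, n)) x :
  is_diff x f df -> is_diff x g dg ->
  is_diff x (fun y => f y *: g y) (fun v => df v *: g x + f x *: dg v).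
Proof.
move=> fd /is_diff_mxP gd; apply/is_diff_mxP => i j.
have -> : (fun y => (f y *: g y) i j) = (fun y => f y * g y i j).
  by apply/funext => y; rewrite mxE.
have -> : (fun v => (df v *: g x + f x *: dg v) i j) =
  (fun v => df v * g x i j + f x * dg v i j) by apply/funext => v; rewrite !mxE.
exact: is_diff_mul.
Qed.

End Differentials.

(** * Second differentials and their chain rule *)

Section SecondDifferential.
Context {R : realType}.
Implicit Types V W : normedModType R.

(** The differential is only asked to be differentiable in each fixed direction, which is what two
    levels of [ndifferentiable_on] provide. *)
Definition twice_differentiable V W (f : V -> W) (x : V) : Prop :=
  (\forall y \near x, differentiable f y) /\
  forall v, differentiable (fun y => 'd f y v) x.

Definition diff2 V W (f : V -> W) (x u v : V) : W := 'd (fun y => 'd f y v) x u.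

Lemma smooth_at_twice V W (f : V -> W) x : smooth_at f x -> twice_differentiable f x.
Proof.
move=> [U [Ux /(_ 2)[df d2f]]]; split; last first.
  by move=> v; have [d _] := d2f v; apply: d; case: Ux.
by apply: filterS (open_nbhs_nbhs Ux) => y; exact: df.
Qed.

Lemma smooth_at_differentiable V W (f : V -> W) x :
  smooth_at f x -> differentiable f x.
Proof. by move=> [U [[Uo Ux] /(_ 1)[df _]]]; exact: df. Qed.

Lemma diff_compE V (V' : normedModType R) W (f : V -> V') (g : V' -> W) x v :
  differentiable f x -> differentiable g (f x) ->
  'd (g \o f) x v = 'd g (f x) ('d f x v).
Proof. by move=> fx gx; rewrite (diff_comp fx gx). Qed.

Lemma is_diff_near V W (f g df : V -> W) x :
  (\forall y \near x, f y = g y) -> is_diff x f df -> is_diff x g df.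
Proof.
move=> fg [fd fdE]; have [gd gdE] := near_is_diff fg fd.
by apply: DiffDef => //; rewrite gdE.
Qed.

Lemma is_diff_near_eq V W (f df g dg : V -> W) x v :
  is_diff x f df -> is_diff x g dg -> (\forall y \near x, f y = g y) -> df v = dg v.
Proof.
move=> fd [_ e1] fg; have [_ e2] := is_diff_near fg fd.
exact: (congr1 (@^~ v) (etrans (esym e2) e1)).
Qed.

(** Used to pass symmetry, and commutation with the scalars, from a matrix-valued map to its
    differential. *)
Lemma is_diff_linear_eq V W m n (L1 L2 : {linear 'M[R]_(m, n) -> W})
    (f df : V -> 'M[R]_(m, n)) x v :
  is_diff x f df -> (\forall y \near x, L1 (f y) = L2 (f y)) -> L1 (df v) = L2 (df v).
Proof.
move=> fd; have Lf (L : {linear 'M[R]_(m, n) -> W}) : is_diff x (L \o f) (L \o df).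
  by apply: is_diff_linear_comp fd; exact: linear_mx_continuous.
exact: (is_diff_near_eq v (Lf L1) (Lf L2)).
Qed.

Lemma twice_differentiable_near V W (f g : V -> W) x :
  (\forall y \near x, f y = g y) -> twice_differentiable f x ->
  twice_differentiable g x /\ forall u v, diff2 g x u v = diff2 f x u v.
Proof.
move=> /near_join fg [fd fd2].
have dfg v : \forall y \near x, 'd f y v = 'd g y v.
  by near=> y; have [||_ ->] // := @near_is_diff _ _ _ f g y; near: y.
split; last first.
  by move=> u v; have [_] := near_is_diff (dfg v) (fd2 v) => /(congr1 (@^~ u)).
split; last by move=> v; have [] := near_is_diff (dfg v) (fd2 v).
by near=> y; have [||] // := @near_is_diff _ _ _ f g y; near: y.
Unshelve. all: by end_near. Qed.

Section Apply.
Context {V : normedModType R} {a b c d : nat}.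
Local Notation M := 'M[R]_(a, b).
Local Notation N := 'M[R]_(c, d).

Lemma linear_mxE (L : {linear M -> N}) (m : M) :
  L m = \sum_i \sum_j m i j *: L (delta_mx i j).
Proof.
rewrite {1}(matrix_sum_delta m) linear_sum; apply: eq_bigr => i _.
by rewrite linear_sum; apply: eq_bigr => j _; rewrite linearZ.
Qed.

Lemma diff2_mxE (g : M -> N) z u m : twice_differentiable g z ->
  diff2 g z u m = \sum_i \sum_j m i j *: diff2 g z u (delta_mx i j).
Proof.
move=> [_ g2]; rewrite /diff2.
under [in LHS]eq_fun do rewrite linear_mxE.
have : is_diff z (fun y => \sum_i \sum_j m i j *: 'd g y (delta_mx i j))
         (fun u => \sum_i \sum_j m i j *: 'd (fun y => 'd g y (delta_mx i j)) z u).
  pose f i j y := m i j *: 'd g y (delta_mx i j).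
  have -> : (fun y => \sum_i \sum_j m i j *: 'd g y (delta_mx i j)) =
            \sum_i \sum_j f i j.
    by apply/funext => y; rewrite fct_sumE; apply: eq_bigr => i _; rewrite fct_sumE.
  pose f' i j y := m i j *: 'd (fun y => 'd g y (delta_mx i j)) z y.
  have -> : (fun u => \sum_i \sum_j m i j *: 'd (fun y => 'd g y (delta_mx i j)) z u)
            = \sum_i \sum_j f' i j.
    by apply/funext => y; rewrite fct_sumE; apply: eq_bigr => i _; rewrite fct_sumE.
  apply: is_diff_sum => i; apply: is_diff_sum => j; apply: is_diffZ.
  exact/differentiableP/g2.
by case=> _ E; exact: (congr1 (@^~ u) E).
Qed.

(** Both the base point and the vector move, whereas [twice_differentiable] speaks of fixed vectors.
    Expanding the vector in the basis of the matrix space leaves finitely many fixed directions with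
    moving coefficients. *)
Lemma is_diff_apply (g : M -> N) (f df h dh : V -> M) x :
  twice_differentiable g (f x) -> is_diff x f df -> is_diff x h dh ->
  is_diff x (fun y => 'd g (f y) (h y))
    (fun u => diff2 g (f x) (df u) (h x) + 'd g (f x) (dh u)).
Proof.
move=> g2 fd hd.
pose F i j y := h y i j *: 'd g (f y) (delta_mx i j).
pose F' i j u := dh u i j *: 'd g (f x) (delta_mx i j) +
                 h x i j *: diff2 g (f x) (df u) (delta_mx i j).
have -> : (fun y => 'd g (f y) (h y)) = \sum_i \sum_j F i j.
  apply/funext => y; rewrite linear_mxE fct_sumE.
  by apply: eq_bigr => i _; rewrite fct_sumE.
have -> : (fun u => diff2 g (f x) (df u) (h x) + 'd g (f x) (dh u)) =
          \sum_i \sum_j F' i j.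
  apply/funext => u; rewrite linear_mxE diff2_mxE // fct_sumE addrC -big_split.
  by apply: eq_bigr => i _; rewrite -big_split fct_sumE.
apply: is_diff_sum => i; apply: is_diff_sum => j.
apply: is_diff_scale; first by move/is_diff_mxP : hd.
have [_ /(_ (delta_mx i j))/differentiableP g2ij] := g2.
exact: (is_diff_comp fd g2ij).
Qed.

Lemma twice_differentiable_comp (g : M -> N) (f : V -> M) x :
  twice_differentiable g (f x) -> twice_differentiable f x ->
  twice_differentiable (g \o f) x /\ forall u v,
  diff2 (g \o f) x u v =
  diff2 g (f x) ('d f x u) ('d f x v) + 'd g (f x) (diff2 f x u v).
Proof.
move=> g2 f2; have [gd _] := g2; have [fd fd2] := f2.
have fdx : differentiable f x := nbhs_singleton fd.
have gfd : \forall y \near x, differentiable g (f y).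
  have fc : f @ x --> f x by exact: differentiable_continuous.
  exact: (fc _ gd).
have gfE v : \forall y \near x, 'd g (f y) ('d f y v) = 'd (g \o f) y v.
  by move: fd gfd; apply: filterS2 => y fy gy; rewrite (diff_compE v fy gy).
have gf2 v := is_diff_near (gfE v)
  (is_diff_apply g2 (differentiableP fdx) (differentiableP (fd2 v))).
split; last by move=> u v; have [_] := gf2 v => /(congr1 (@^~ u)).
split; last by move=> v; have [] := gf2 v.
by move: fd gfd; apply: filterS2 => y fy gy; exact: differentiable_comp.
Qed.

End Apply.
End SecondDifferential.

(** * Symmetry of the second differential *)

Section Schwarz.
Context {R : realType} {V : normedModType R}.

Lemma is_diff_is_derive (f df : R -> R) s : is_diff s f df -> is_derive s 1 f (df 1).
Proof.
move=> [fd fdE]; apply: DeriveDef; first exact: diff_derivable.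
by rewrite deriveE // fdE.
Qed.

Lemma is_diff_line (x v : V) (s : R) : is_diff s (fun t => x + t *: v) (fun t => t *: v).
Proof.
have -> : (fun t => x + t *: v) = cst x + *:%R^~ v by [].
apply: is_diff_eq (is_diffD (is_diff_cst x s) (is_diff_scalel s v)) _.
by rewrite add0r.
Qed.

(** The mean value theorem along [v] turns the second difference into a difference of two first
    differentials. Each is compared with the expansion of ['d f _ v] at [x], the only point where
    that map is known to be differentiable. *)
Lemma second_difference (f : V -> R) (x u v : V) (e : R) :
  twice_differentiable f x -> 0 < e ->
  \forall h \near 0^'+,
    `|f (x + h *: u + h *: v) - f (x + h *: u) - f (x + h *: v) + f x
      - h ^+ 2 * diff2 f x u v| <= h ^+ 2 * (e * (`|u| + `|v| + `|v|)).
Proof.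
move=> [fd fd2] e0.
have /diff_locallyP[_ /eqaddoP/(_ _ e0)] := fd2 v.
move=> Gv.
have : \forall k \near (0 : V), differentiable f (k + x) /\
    `|'d f (k + x) v - 'd f x v - diff2 f x k v| <= e * `|k|.
  near=> k; split; last by near: k; move: Gv; apply: filterS => k;
    rewrite /= !fctE /= opprD addrA.
  near: k; move: fd; rewrite (near_shift 0) subr0; exact: filterS.
move=> /nbhs_norm0P[d /= d0 Hd].
(* All points used lie within [h * c] of [x]; the [+ 1] keeps [c] positive when [u] and [v]
   vanish. *)
set c := `|u| + `|v| + 1.
have c0 : 0 < c by rewrite ltr_wpDl // addr_ge0.
near=> h.
have h0 : 0 < h by near: h; exact: nbhs_right_gt.
have hc : h * c < d.
  by rewrite -ltr_pdivlMr //; near: h; apply: nbhs_right_lt; rewrite divr_gt0.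
have inD (s : R) (b : bool) : 0 <= s <= 1 ->
    `|b%:R *: (h *: u) + s *: (h *: v)| <= h * (b%:R * `|u| + `|v|).
  move=> /andP[s0 s1]; rewrite (le_trans (ler_normD _ _)) // !normrZ.
  rewrite (ger0_norm (ltW h0)) (ger0_norm s0) (ger0_norm (ler0n _ _)).
  rewrite mulrDr mulrCA lerD2l ler_piMl //.
  by rewrite mulr_ge0 // ltW.
have inDd (s : R) (b : bool) : 0 <= s <= 1 -> `|b%:R *: (h *: u) + s *: (h *: v)| < d.
  move=> s01; apply: le_lt_trans (inD _ _ s01) _.
  apply: le_lt_trans _ hc; rewrite ler_pM2l // /c -addrA lerD //.
    by case: b; rewrite ?mul1r ?mul0r.
  by rewrite lerDl.
(* The two sides parallel to [v] of the parallelogram at [x]: the boolean tells whether the side is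
   shifted by [h *: u]. *)
pose L (b : bool) (s : R) : V := x + b%:R *: (h *: u) + s *: (h *: v).
have LE b s : L b s = (b%:R *: (h *: u) + s *: (h *: v)) + x.
  by rewrite addrC addrA.
have fL (b : bool) (s : R) : 0 <= s <= 1 ->
    is_diff s (f \o L b) (fun t => 'd f (L b s) (t *: (h *: v))).
  move=> s01; have [fLd _] := Hd _ (inDd s b s01).
  have Ld : is_diff s (L b) (fun t => t *: (h *: v)) by exact: is_diff_line.
  by rewrite -LE in fLd; exact: (is_diff_comp Ld (differentiableP fLd)).
pose phi := (f \o L true) - (f \o L false).
pose dphi (s : R) : R := h * ('d f (L true s) v - 'd f (L false s) v).
have phid (s : R) : 0 <= s <= 1 -> is_derive s 1 phi (dphi s).
  move=> s01; have D := is_diff_is_derive (is_diffB (fL true s s01) (fL false s s01)).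
  apply: (is_derive_eq D).
  change ('d f (L true s) (1 *: (h *: v)) - 'd f (L false s) (1 *: (h *: v)) = dphi s).
  have Z b : 'd f (L b s) (h *: v) = h * 'd f (L b s) v by rewrite linearZ.
  by rewrite !scale1r !Z -mulrBr.
have [] := @MVT_segment _ phi dphi 0 1 ler01.
- by move=> s; rewrite in_itv /= => /andP[/ltW s0 /ltW s1]; apply: phid; rewrite s0.
- apply: derivable_within_continuous => s; rewrite in_itv /= => s01.
  by case: (phid _ s01).
move=> s; rewrite in_itv /= subr0 mulr1 => s01.
have -> : phi 1 - phi 0 =
    f (x + h *: u + h *: v) - f (x + h *: u) - f (x + h *: v) + f x.
  rewrite /phi !fctE /= /L !scale1r !scale0r !addr0; ring.
move=> ->.
have [_ H1] := Hd _ (inDd s true s01); have [_ H2] := Hd _ (inDd s false s01).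
rewrite -!LE in H1 H2.
have dE : diff2 f x (true%:R *: (h *: u) + s *: (h *: v)) v =
    diff2 f x (false%:R *: (h *: u) + s *: (h *: v)) v + h * diff2 f x u v.
  by rewrite /diff2 scale0r add0r scale1r linearD linearZ /= addrC.
rewrite dE in H1.
have -> : dphi s - h ^+ 2 * diff2 f x u v =
  h * (('d f (L true s) v - 'd f x v -
   (diff2 f x (false%:R *: (h *: u) + s *: (h *: v)) v + h * diff2 f x u v)) -
   ('d f (L false s) v - 'd f x v -
     diff2 f x (false%:R *: (h *: u) + s *: (h *: v)) v)).
  by rewrite /dphi; ring.
rewrite normrM (ger0_norm (ltW h0)) expr2 -mulrA ler_pM2l //.
apply: le_trans (ler_normB _ _) _.
apply: le_trans (lerD H1 H2) _.
rewrite -mulrDr mulrCA ler_pM2l //.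
apply: le_trans (lerD (inD s true s01) (inD s false s01)) _.
by rewrite -mulrDr ler_pM2l // mul1r mul0r add0r.
Unshelve. all: by end_near. Qed.

(** The second difference is symmetric in [u] and [v], and both mixed derivatives approximate it up
    to a small multiple of [h ^+ 2]. *)
Lemma schwarz_real (f : V -> R) (x u v : V) :
  twice_differentiable f x -> diff2 f x u v = diff2 f x v u.
Proof.
move=> f2; apply/eqP; rewrite -subr_eq0 -normr_le0; apply/ler_addgt0Pl => e e0.
rewrite addr0.
set c := `|u| + `|v| + 1.
have c0 : 0 < c by rewrite ltr_wpDl // addr_ge0.
(* The two error bounds add up to [3 * (|u| + |v|)] times this number, which is at most [e]. *)
have e'0 : 0 < e / (4 * c) by rewrite divr_gt0 // mulr_gt0.
suff : \forall h \near (0 : R)^'+, `|diff2 f x u v - diff2 f x v u| <= e.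
  by case/filter_ex.
have h0n : \forall h \near (0 : R)^'+, 0 < h by exact: nbhs_right_gt.
apply: filterS3 h0n (second_difference u v f2 e'0) (second_difference v u f2 e'0).
move=> h h0 H1 H2; have h20 : 0 < h ^+ 2 by rewrite exprn_gt0.
rewrite -(ler_pM2l h20) -[X in X * `|_|](ger0_norm (ltW h20)) -normrM.
set A := diff2 f x u v in H1 *; set B := diff2 f x v u in H2 *.
rewrite [x + h *: v + _]addrAC in H2.
set F := f (x + h *: u + h *: v) in H1 H2.
have -> : h ^+ 2 * (A - B) = (F - f (x + h *: v) - f (x + h *: u) + f x - h ^+ 2 * B) -
  (F - f (x + h *: u) - f (x + h *: v) + f x - h ^+ 2 * A) by ring.
apply: le_trans (ler_normB _ _) _; apply: le_trans (lerD H2 H1) _.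
rewrite -mulrDr ler_pM2l // -mulrDr -mulrA ler_piMr ?(ltW e0) //.
rewrite ler_pdivrMl ?mulr1 ?mulr_gt0 //.
have := normr_ge0 u; have := normr_ge0 v; rewrite /c; lra.
Qed.

End Schwarz.

Lemma schwarz (R : realType) (V : normedModType R) (m n : nat)
    (f : V -> 'M[R]_(m, n)) (x u v : V) :
  twice_differentiable f x -> diff2 f x u v = diff2 f x v u.
Proof.
move=> [fd f2]; apply/matrixP => i j.
pose fij y := f y i j.
have dij w : \forall y \near x, 'd f y w i j = 'd fij y w.
  move: fd; apply: filterS => y /differentiableP/is_diff_mxP/(_ i j)[_ ->].
  by [].
have D2 w := is_diff_near (dij w) ((is_diff_mxP _ _ _).1 (differentiableP (f2 w)) i j).
have fij2 : twice_differentiable fij x.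
  split; last by move=> w; case: (D2 w).
  by move: fd; apply: filterS => y /differentiableP/is_diff_mxP/(_ i j)[].
have E a b : diff2 f x a b i j = diff2 fij x a b.
  by case: (D2 b) => _ /(congr1 (@^~ a)).
by rewrite !E; exact: schwarz_real.
Qed.

(** * Smoothness of functions given by formulas *)

Section SmoothCalculus.
Context {R : realType} {V : normedModType R}.
Variable U : set V.
Hypothesis Uo : open U.
Local Notation nd := ndifferentiable_on.

Lemma ndiff_eq (W : normedModType R) k (f g : V -> W) :
  (forall x, U x -> f x = g x) -> nd k U f -> nd k U g.
Proof.
elim: k f g => [//|k IH] f g fg [fd fk].
have fgn x : U x -> \forall y \near x, f y = g y.
  by move=> Ux; apply: filterS (open_nbhs_nbhs (conj Uo Ux)) => y; exact: fg.
split=> [x Ux|v]; first by case: (near_is_diff (fgn x Ux) (fd x Ux)).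
apply: IH (fk v) => x Ux.
by case: (near_is_diff (fgn x Ux) (fd x Ux)) => _ ->.
Qed.

Lemma ndiffW (W : normedModType R) k (f : V -> W) : nd k.+1 U f -> nd k U f.
Proof.
elim: k f => [//|k IH] f [fd fk]; split => // v; exact: IH.
Qed.

(** Replaces the abstract differential by an explicit one, so that the inductions on the order run
    on formulas. *)
Lemma ndiff_is_diff (W : normedModType R) k (f : V -> W) (df : V -> V -> W) :
  (forall x, U x -> is_diff x f (df x)) -> (forall v, nd k U (df^~ v)) -> nd k.+1 U f.
Proof.
move=> fd dfk; split=> [x /fd[]//|v].
by apply: ndiff_eq (dfk v) => x /fd[_ ->].
Qed.

Lemma ndiff_cst (W : normedModType R) k (a : W) : nd k U (fun=> a).
Proof.
elim: k a => [//|k IH] a; by apply: (@ndiff_is_diff _ _ _ (fun=> 0)) => v; exact: (IH 0).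
Qed.

Lemma ndiff_linear (W : normedModType R) k (L : {linear V -> W}) :
  continuous L -> nd k U L.
Proof.
move=> Lc; case: k => // k; apply: (@ndiff_is_diff _ _ _ (fun=> L)) => [x _|v].
  exact: is_diff_linear.
exact: ndiff_cst.
Qed.

Lemma ndiff_linear_comp (W W' : normedModType R) k (L : {linear W -> W'}) (f : V -> W) :
  continuous L -> nd k U f -> nd k U (L \o f).
Proof.
move=> Lc; elim: k f => [//|k IH] f [fd fk].
apply: (@ndiff_is_diff _ _ _ (fun x v => L ('d f x v))) => [x Ux|v].
  exact: (is_diff_linear_comp Lc (differentiableP (fd x Ux))).
exact: (IH _ (fk v)).
Qed.

Lemma ndiffD (W : normedModType R) k (f g : V -> W) :
  nd k U f -> nd k U g -> nd k U (fun x => f x + g x).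
Proof.
elim: k f g => [//|k IH] f g [fd fk] [gd gk].
apply: (@ndiff_is_diff _ _ _ (fun x v => 'd f x v + 'd g x v)) => [x Ux|v].
  exact: is_diffD (differentiableP (fd x Ux)) (differentiableP (gd x Ux)).
exact: (IH _ _ (fk v) (gk v)).
Qed.

Lemma ndiff_sum (W : normedModType R) k (I : Type) (r : seq I) (f : I -> V -> W) :
  (forall i, nd k U (f i)) -> nd k U (fun x => \sum_(i <- r) f i x).
Proof.
move=> fk; elim: r => [|i r IH].
  by under eq_fun do rewrite big_nil; exact: ndiff_cst.
by under eq_fun do rewrite big_cons; exact: ndiffD.
Qed.

Lemma ndiffM k (f g : V -> R) :
  nd k U f -> nd k U g -> nd k U (fun x => f x * g x).
Proof.
elim: k f g => [//|k IH] f g fk1 gk1; have := (fk1, gk1) => -[[fd fk] [gd gk]].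
apply: (@ndiff_is_diff _ _ _ (fun x v => 'd f x v * g x + f x * 'd g x v)) => [x Ux|v].
  exact: is_diff_mul (differentiableP (fd x Ux)) (differentiableP (gd x Ux)).
(* The Leibniz formula leaves one factor undifferentiated; [ndiffW] lowers its order to that of the
   induction hypothesis. *)
by apply: ndiffD; [exact: IH (fk v) (ndiffW gk1)|exact: IH (ndiffW fk1) (gk v)].
Qed.

Lemma ndiffV k (f : V -> R) :
  (forall x, U x -> f x != 0) -> nd k U f -> nd k U (fun x => (f x)^-1).
Proof.
move=> f0; elim: k => [//|k IH] fk1; have [fd fk] := fk1.
apply: (@ndiff_is_diff _ _ _ (fun x v => -1 * ((f x)^-1 * (f x)^-1) * 'd f x v))
  => [x Ux|v].
  apply: DiffDef; first exact: differentiableV (fd x Ux) (f0 x Ux).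
  rewrite diffV ?f0 //; last exact: fd.
  by apply/funext => v /=; rewrite mulN1r -invfM -expr2.
have fVk := IH (ndiffW fk1).
apply: ndiffM (fk v); apply: ndiffM; first exact: ndiff_cst.
exact: ndiffM.
Qed.

Lemma ndiff_mxP m n k (f : V -> 'M[R]_(m, n)) :
  (forall i j, nd k U (fun x => f x i j)) -> nd k U f.
Proof.
elim: k f => [//|k IH] f fk.
have fd x : U x -> differentiable f x.
  move=> Ux; have D : is_diff x f (fun v => \matrix_(i, j) 'd (fun y => f y i j) x v).
    apply/is_diff_mxP => i j; have [fijd _] := fk i j.
    apply: is_diff_eq (differentiableP (fijd x Ux)) _.
    by apply/funext => v; rewrite mxE.
  by case: D.
split=> // v; apply: IH => i j; have [fijd fijk] := fk i j.
apply: ndiff_eq (fijk v) => x Ux.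
by have /is_diff_mxP/(_ i j)[_ ->] := differentiableP (fd x Ux).
Qed.

End SmoothCalculus.

Lemma is_diff_sinZ (R : realType) (d s : R) :
  is_diff s (fun s => sin (d * s)) (fun v => cos (d * s) * (d * v)).
Proof.
have ds : is_diff s (fun s => d * s) (fun v => d * v) by exact: is_diff_scaler.
have sd := (derivable1_diffP _ _).1 (@derivable_sin R (d * s)).
apply: is_diff_eq (is_diff_comp ds (differentiableP sd)) _; apply/funext => v /=.
rewrite diff1E // derive1E (@derive_val _ _ _ _ _ _ _ (is_derive_sin _)).
by rewrite /GRing.scale /= mulrC.
Qed.

Lemma is_diff_cosZ (R : realType) (d s : R) :
  is_diff s (fun s => cos (d * s)) (fun v => - sin (d * s) * (d * v)).
Proof.
have ds : is_diff s (fun s => d * s) (fun v => d * v) by exact: is_diff_scaler.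
have sd := (derivable1_diffP _ _).1 (@derivable_cos R (d * s)).
apply: is_diff_eq (is_diff_comp ds (differentiableP sd)) _; apply/funext => v /=.
rewrite diff1E // derive1E (@derive_val _ _ _ _ _ _ _ (is_derive_cos _)).
by rewrite /GRing.scale /= mulrC.
Qed.

(** Each function differentiates into the other, hence the joint induction; the coefficient [c]
    absorbs the sign that appears. *)
Lemma ndiff_sincos (R : realType) (U : set R) k (c d : R) :
  open U -> ndifferentiable_on k U (fun s : R => c * sin (d * s)) /\
  ndifferentiable_on k U (fun s : R => c * cos (d * s)).
Proof.
move=> Uo; elim: k c => [//|k IH] c.
split.
  apply: (@ndiff_is_diff _ _ _ Uo _ _ _ (fun s v => c * cos (d * s) * (d * v))) => [s _|v].
    apply: is_diff_eq (is_diff_mul (is_diff_cst c s) (is_diff_sinZ d s)) _.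
    by apply/funext => v /=; rewrite mul0r add0r /cst; ring.
  have [_ ck] := IH c; exact: (ndiffM Uo ck (ndiff_cst Uo k (d * v))).
apply: (@ndiff_is_diff _ _ _ Uo _ _ _ (fun s v => - c * sin (d * s) * (d * v))) => [s _|v].
  apply: is_diff_eq (is_diff_mul (is_diff_cst c s) (is_diff_cosZ d s)) _.
  by apply/funext => v /=; rewrite mul0r add0r /cst; ring.
have [ck _] := IH (- c); exact: (ndiffM Uo ck (ndiff_cst Uo k (d * v))).
Qed.

Lemma is_diff_mulrC (R : realType) (V : normedModType R) (f df : V -> R) (a : R) x :
  is_diff x f df -> is_diff x (fun y => f y * a) (fun v => df v * a).
Proof.
move=> fd; apply: is_diff_eq (is_diff_mul fd (is_diff_cst a x)) _.
by apply/funext => v /=; rewrite mulr0 addr0.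
Qed.

(** * The matrix curves that will be geodesics *)

Section DoubleAngle.
Context {R : realType} {m n : nat}.
Implicit Types A B C : 'M[R]_(m, n).

(** In terms of the double angle this is [cos 2t A + (sin 2t / 2) B + ((1 - cos 2t) / 2) C]. *)
Definition double_angle A B C (t : R) : 'M[R]_(m, n) :=
  (cos t ^+ 2 - sin t ^+ 2) *: A + (sin t * cos t) *: B + sin t ^+ 2 *: C.

(** The family is stable under differentiation, so a second application gives the acceleration
    needed in the geodesic equation. *)
Lemma is_diff_double_angle A B C (d s : R) :
  is_diff s (fun s => double_angle A B C (d * s))
    (fun v => (v * d) *: double_angle B (2 *: C - 4 *: A) 0 (d * s)).
Proof.
apply/is_diff_mxP => i j.
pose S (s : R) := sin (d * s); pose c (s : R) := cos (d * s).
have E A' B' C' t : double_angle A' B' C' (d * t) i j =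
    (c t * c t - S t * S t) * A' i j + S t * c t * B' i j + S t * S t * C' i j.
  by rewrite !mxE !expr2.
under [X in is_diff_def _ X]eq_fun do rewrite E.
have Sd := is_diff_sinZ d s; have cd := is_diff_cosZ d s.
have cc := is_diff_mul cd cd; have SS := is_diff_mul Sd Sd; have Sc := is_diff_mul Sd cd.
have := is_diffD (is_diffD
  (is_diff_mulrC (A i j) (is_diffB cc SS)) (is_diff_mulrC (B i j) Sc))
  (is_diff_mulrC (C i j) SS).
move=> D; apply: is_diff_eq D _; apply/funext => v.
rewrite [RHS]mxE E !mxE !fctE /= -/(S s) -/(c s); ring.
Qed.

Lemma ndiff_double_angle A B C (d : R) l (U : set R) i j : open U ->
  ndifferentiable_on l U (fun s => double_angle A B C (d * s) i j).
Proof.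
move=> Uo.
have nS : ndifferentiable_on l U (fun s => 1 * sin (d * s)) by case: (ndiff_sincos l 1 d Uo).
have nC c : ndifferentiable_on l U (fun s => c * cos (d * s)) by case: (ndiff_sincos l c d Uo).
have nA c := ndiffM Uo (ndiffM Uo nS nS) (ndiff_cst Uo l c).
have nB := ndiffM Uo nS (nC (B i j)).
have nD := ndiffM Uo (nC 1) (nC (A i j)).
apply: ndiff_eq (ndiffD Uo (ndiffD Uo (ndiffD Uo nD (nA (- A i j))) nB) (nA (C i j))) => //.
by move=> s _; rewrite !mxE; ring.
Qed.

End DoubleAngle.

(** * Pencils of quadratic forms *)

Section InnerProduct.
Context {R : realType}.

Definition ip n (x y : 'rV[R]_n) : R := (x *m y^T) 0 0.

Lemma ipE n (x y : 'rV[R]_n) : ip x y = \sum_i x 0 i * y 0 i.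
Proof. by rewrite /ip mxE; apply: eq_bigr => i _; rewrite mxE. Qed.

Lemma ipC n (x y : 'rV[R]_n) : ip x y = ip y x.
Proof. by rewrite !ipE; apply: eq_bigr => i _; rewrite mulrC. Qed.

Lemma ipDl n (x y z : 'rV[R]_n) : ip (x + y) z = ip x z + ip y z.
Proof. by rewrite /ip mulmxDl mxE. Qed.

Lemma ipZl n c (x y : 'rV[R]_n) : ip (c *: x) y = c * ip x y.
Proof. by rewrite /ip -scalemxAl mxE. Qed.

Lemma ipNl n (x y : 'rV[R]_n) : ip (- x) y = - ip x y.
Proof. by rewrite -scaleN1r ipZl mulN1r. Qed.

Lemma ip0l n (x : 'rV[R]_n) : ip 0 x = 0.
Proof. by rewrite /ip mul0mx mxE. Qed.

Lemma ipDr n (x y z : 'rV[R]_n) : ip z (x + y) = ip z x + ip z y.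
Proof. by rewrite ipC ipDl !(ipC z). Qed.

Lemma ipZr n c (x y : 'rV[R]_n) : ip x (c *: y) = c * ip x y.
Proof. by rewrite ipC ipZl ipC. Qed.

Lemma ipNr n (x y : 'rV[R]_n) : ip x (- y) = - ip x y.
Proof. by rewrite ipC ipNl ipC. Qed.

Lemma ip_mulmxl m n (x : 'rV[R]_m) (M : 'M[R]_(m, n)) (y : 'rV[R]_n) :
  ip (x *m M) y = ip x (y *m M^T).
Proof. by rewrite /ip trmx_mul trmxK mulmxA. Qed.

Lemma ip_rowE p n (x : 'rV[R]_n) (M : 'M[R]_(p, n)) i :
  (x *m M^T) 0 i = ip x (row i M).
Proof. by rewrite /ip !mxE; apply: eq_bigr => j _; rewrite !mxE. Qed.

Lemma ip_rows p n (M M' : 'M[R]_(p, n)) i j :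
  (M *m M'^T) i j = ip (row i M) (row j M').
Proof. by rewrite /ip !mxE; apply: eq_bigr => l _; rewrite !mxE. Qed.

Lemma ip_ge0 n (x : 'rV[R]_n) : 0 <= ip x x.
Proof. by rewrite ipE sumr_ge0 // => i _; rewrite -expr2 sqr_ge0. Qed.

Lemma ip_eq0 n (x : 'rV[R]_n) : (ip x x == 0) = (x == 0).
Proof.
apply/eqP/eqP => [|->]; last by rewrite ip0l.
rewrite ipE => /psumr_eq0P x0; apply/rowP => i; rewrite mxE.
apply/eqP; rewrite -sqrf_eq0 expr2; apply/eqP/x0 => // j _.
by rewrite -expr2 sqr_ge0.
Qed.

Lemma ip_gt0 n (x : 'rV[R]_n) : x != 0 -> 0 < ip x x.
Proof. by move=> x0; rewrite lt_def ip_eq0 x0 ip_ge0. Qed.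

Lemma quadratic_continuous n (M : 'M[R]_n) :
  continuous (fun u : 'rV[R]_n => ip (u *m M) u).
Proof.
move=> u; apply: differentiable_continuous.
pose tr : {linear 'rV[R]_n -> 'cV[R]_n} := @trmx R 1 n.
have trc : continuous tr by exact: linear_mx_continuous.
have Mc : continuous (mulmxr M : 'rV[R]_n -> 'rV[R]_n) by exact: linear_mx_continuous.
have := is_diff_mulmx (is_diff_linear u Mc) (is_diff_linear u trc).
by move/is_diff_mxP => /(_ 0 0)[].
Qed.

(** If [v = u *m M] were nonzero, a short step from [u] along [- v] would make the form negative. *)
Lemma nonneg_form_kernel n (M : 'M[R]_n) (u : 'rV[R]_n) : M^T = M ->
  (forall v, 0 <= ip (v *m M) v) -> ip (u *m M) u = 0 -> u *m M = 0.
Proof.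
move=> Ms M0 u0; apply/eqP; rewrite -ip_eq0.
set v := u *m M; set x := ip v v; set c := ip (v *m M) v.
have c0 : 0 <= c := M0 v.
have x0 : 0 <= x := ip_ge0 v.
(* With [s = x / (c + 1)] the form at [u - s v] is [c s^2 - 2 s x = - (c + 2) s^2]. The [+ 1] keeps
   the denominator positive when [c] is zero. *)
have := M0 (u - (x / (c + 1)) *: v).
have E : ip (v *m M) u = x by rewrite ip_mulmxl Ms.
rewrite mulmxBl -scalemxAl -/v !(ipDl, ipDr, ipNl, ipNr, ipZl, ipZr) u0 E -/x -/c.
have c1 : 0 < c + 1 by rewrite ltr_wpDl.
set s := x / (c + 1); have sE : x = s * (c + 1) by rewrite divfK // gt_eqF.
rewrite sE => H.
have s0 : 0 <= s by rewrite divr_ge0 // ltW.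
suff -> : s = 0 by rewrite mul0r.
by apply/eqP; rewrite -sqrf_eq0 eq_le sqr_ge0 andbT; nra.
Qed.

(** Continuity of the larger root of [a k^2 + b k - p], needed for the extreme value theorem. *)
Lemma root_cvg (T : Type) (F : set_system T) (FF : Filter F) (a b p : T -> R) (a0 b0 p0 : R) :
  a @ F --> a0 -> b @ F --> b0 -> p @ F --> p0 -> 2 * a0 != 0 ->
  (- b x + Num.sqrt (b x * b x + 4 * a x * p x)) / (2 * a x) @[x --> F] -->
  (- b0 + Num.sqrt (b0 * b0 + 4 * a0 * p0)) / (2 * a0).
Proof.
move=> ac bc pc a00.
have c2 c : c * a x @[x --> F] --> c * a0 by apply: cvgM ac; exact: cvg_cst.
apply: cvgM; last by apply: cvgV; last exact: c2.
apply: cvgD; first exact: cvgN.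
apply: (continuous_cvg _ (@sqrt_continuous R _)).
by apply: cvgD; [exact: cvgM|apply: cvgM => //; exact: c2].
Qed.

(* The largest root of k a + b - p / k = 0, with a, b, p the values at u of the
   three forms, is maximal over the unit sphere at a vector in the kernel. *)
Lemma pencil_pos n (A P B : 'M[R]_n) : A^T = A -> P^T = P -> B^T = B ->
  (forall u : 'rV[R]_n, u != 0 -> 0 < ip (u *m A) u) -> (forall u : 'rV[R]_n, 0 <= ip (u *m P) u) ->
  (forall k (u : 'rV[R]_n), 1 <= k -> u *m (k *: A - k^-1 *: P + B) = 0 -> u = 0) ->
  forall u : 'rV[R]_n, u != 0 -> 0 < ip (u *m (A - P + B)) u.
Proof.
move=> As Ps Bs A0 P0 ker u0 u00.
rewrite ltNge; apply/negP => neg.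
pose a (u : 'rV[R]_n) := ip (u *m A) u; pose b (u : 'rV[R]_n) := ip (u *m B) u.
pose p (u : 'rV[R]_n) := ip (u *m P) u.
have hom M (c : R) (u : 'rV[R]_n) : ip (c *: u *m M) (c *: u) = c ^+ 2 * ip (u *m M) u.
  by rewrite -scalemxAl ipZl ipZr mulrA.
(* This is the sphere of the maximum norm, not of [ip]. As [a], [b] and [p] are all quadratic, the
   root [r] is invariant under scaling and any compact sphere serves. *)
pose S := [set u : 'rV[R]_n | `|u| = 1].
pose r u := (- b u + Num.sqrt (b u * b u + 4 * a u * p u)) / (2 * a u).
have S0 u : S u -> u != 0 by move=> Su; rewrite -normr_eq0 Su oner_eq0.
have aS u : S u -> 0 < a u by move=> /S0; exact: A0.
have SN u : u != 0 -> S (`|u|^-1 *: u).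
  by move=> un0; rewrite /S /= normrZ normfV normr_id mulVf // normr_eq0.
have Sc : compact S.
  apply: bounded_closed_compact.
    exists 1; split=> [|x x1 u]; first exact: num_real.
    by rewrite /S /= => ->; exact: ltW.
  have -> : S = (fun u : 'rV[R]_n => `|u|) @^-1` [set 1] by [].
  apply: closed_comp; last exact: closed_eq.
  by move=> u _; exact: norm_continuous.
have rc : {within S, continuous r}.
  apply: continuous_in_subspaceT => u; rewrite inE => Su.
  have au0 : 2 * a u != 0 by rewrite mulf_neq0 // gt_eqF // aS.
  exact: (@root_cvg _ (nbhs u) _ a b p _ _ _ (@quadratic_continuous _ _ u)
    (@quadratic_continuous _ _ u) (@quadratic_continuous _ _ u) au0).
have [] := EVT_max_rV _ Sc rc; first by exists (`|u0|^-1 *: u0); exact: SN.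
move=> u1; rewrite inE => Su1 max.
set k := r u1.
have disc u : 0 <= b u ^+ 2 + 4 * a u * p u.
  apply: addr_ge0; first exact: sqr_ge0.
  apply: mulr_ge0; last exact: P0.
  apply: mulr_ge0 => //.
  have [->|/A0/ltW//] := eqVneq u 0; by rewrite /a mul0mx ip0l.
have rE u : S u -> a u * r u ^+ 2 + b u * r u - p u = 0.
  move=> Su; have au := aS u Su; rewrite /r -expr2.
  have := sqr_sqrtr (disc u); set q := Num.sqrt _ => qE.
  have -> : a u * ((- b u + q) / (2 * a u)) ^+ 2 + b u * ((- b u + q) / (2 * a u)) - p u
    = (q ^+ 2 - b u ^+ 2 - 4 * a u * p u) / (4 * a u).
    by field; rewrite gt_eqF.
  by rewrite qE; apply/eqP; rewrite mulf_eq0; apply/orP; left; apply/eqP; ring.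
have r2 u : S u -> 0 <= 2 * a u * r u + b u.
  move=> Su; have au := aS u Su; rewrite /r -expr2.
  have -> : 2 * a u * ((- b u + Num.sqrt (b u ^+ 2 + 4 * a u * p u)) / (2 * a u))
     + b u = Num.sqrt (b u ^+ 2 + 4 * a u * p u) by field; rewrite gt_eqF.
  exact: sqrtr_ge0.
have k1 : 1 <= k.
  set u := `|u0|^-1 *: u0; have Su : S u := SN _ u00.
  apply: (@le_trans _ _ (r u)); last by apply: max; rewrite inE.
  have nu : a u - p u + b u <= 0.
    rewrite /a /p /b !hom -mulrBr -mulrDr pmulr_rle0.
      by move: neg; rewrite mulmxDr mulmxBr !(ipDl, ipNl).
    by rewrite exprn_gt0 // invr_gt0 normr_gt0.
  (* The quadratic vanishes at [r u] with nonnegative slope and is strictly convex. If [r u] were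
     less than 1, its value at 1, which is [a u - p u + b u], would be positive. *)
  rewrite leNgt; apply/negP => r1.
  have E := rE u Su; have D := r2 u Su; have au := aS u Su.
  have r1' : 0 < 1 - r u by rewrite subr_gt0.
  have : 0 < (1 - r u) * (a u * (1 - r u) + (2 * a u * r u + b u)).
    by rewrite mulr_gt0 // ltr_pwDl // mulr_gt0.
  have -> : (1 - r u) * (a u * (1 - r u) + (2 * a u * r u + b u)) =
    (a u - p u + b u) - (a u * r u ^+ 2 + b u * r u - p u) by ring.
  by rewrite E subr0 ltNge nu.
have k0 : 0 < k by exact: lt_le_trans k1.
pose M := k *: A - k^-1 *: P + B.
have qM u : k * ip (u *m M) u = a u * k ^+ 2 + b u * k - p u.
  rewrite /M mulmxDr mulmxBr -!scalemxAr !(ipDl, ipNl, ipZl) -/(a u) -/(b u) -/(p u).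
  by field; rewrite gt_eqF.
have M0 u : 0 <= ip (u *m M) u.
  have [->|un0] := eqVneq u 0; first by rewrite mul0mx ip0l.
  have -> : u = `|u| *: (`|u|^-1 *: u) by rewrite scalerA mulfV ?normr_eq0 // scale1r.
  rewrite hom mulr_ge0 ?sqr_ge0 // -(pmulr_rge0 _ k0) qM.
  have Su := SN _ un0; set v := `|u|^-1 *: u in Su *.
  have rk : r v <= k by apply: max; rewrite inE.
  have E := rE v Su; have D := r2 v Su; have av := ltW (aS v Su).
  (* Expansion around the root [r v]: the slope there is nonnegative and [k] lies to its right. *)
  have -> : a v * k ^+ 2 + b v * k - p v =
    (k - r v) * (a v * (k - r v) + (2 * a v * r v + b v)) +
    (a v * r v ^+ 2 + b v * r v - p v) by ring.
  rewrite E addr0.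
  have kr : 0 <= k - r v by rewrite subr_ge0.
  by apply: mulr_ge0 => //; apply: addr_ge0 => //; exact: mulr_ge0.
have Ms : M^T = M by rewrite /M linearD linearB !linearZ /= As Ps Bs.
have Mu1 : ip (u1 *m M) u1 = 0.
  have k0' : k != 0 by rewrite gt_eqF.
  by apply: (mulfI k0'); rewrite qM mulr0; exact: rE.
have := ker k u1 k1 (nonneg_form_kernel Ms M0 Mu1).
by move/eqP; rewrite (negPf (S0 _ Su1)).
Qed.

End InnerProduct.

(** * Focal points in terms of projectors *)

(** The tangency equation counts the diagonal block on the range of [Q] twice, so that block is
    zero. *)
Lemma tangent_corner (R : realType) N (Q M : 'M[R]_N) :
  Q *m Q = Q -> M = Q *m M + M *m Q -> Q *m M *m Q = 0.
Proof.
move=> QQ MQ; have := congr1 (mulmx Q) MQ; rewrite mulmxDr !mulmxA QQ => E.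
by apply: (addrI (Q *m M)); rewrite addr0 -E.
Qed.

Section FocalPoint.
Context {R : realType} {k N m : nat}.
(** The data at one point: [J i] stands for right multiplication by the basis scalar [i], [z] is a
    unit vector of the line, [U] its frame, [X] the unit normal. The maps [a] and [b] are the
    differentials of the projector and of the normal along the hypersurface. *)
Variables (J : 'I_k.+1 -> 'M[R]_N) (z : 'rV[R]_N) (X : 'M[R]_N).
Variables (a b : {linear 'rV[R]_m -> 'M[R]_N}).
Let U : 'M[R]_(k.+1, N) := \matrix_i (z *m J i).
Variable Q : 'M[R]_N.
Hypothesis QE : Q = U^T *m U.
Hypothesis J0 : J ord0 = 1%:M.
Hypothesis JJ : forall i, J i *m (J i)^T = 1%:M.
Hypothesis JN : forall i, i != ord0 -> (J i)^T = - J i.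
Hypothesis UU : U *m U^T = 1%:M.
Hypothesis dimN : (m + (1 + k.+1) = N)%N.
Hypothesis XT : X^T = X.
Hypothesis XJ : forall i, X *m J i = J i *m X.
Hypothesis XQ : X = Q *m X + X *m Q.
Hypothesis XXQ : X *m X *m Q = Q.

Definition commutes (M : 'M[R]_N) := forall i, M *m J i = J i *m M.

Let z0 : z = row ord0 U.
Proof. by rewrite rowK J0 mulmx1. Qed.
Let UQ : U *m Q = U.
Proof. by rewrite QE mulmxA UU mul1mx. Qed.
Let zQ : z *m Q = z.
Proof. by rewrite z0 -row_mul UQ. Qed.
Let QT : Q^T = Q.
Proof. by rewrite QE trmx_mul trmxK. Qed.
Let QQ : Q *m Q = Q.
Proof. by rewrite {1}QE -mulmxA UQ QE. Qed.

(** All rows of the frame contribute equally, because [M] commutes with the isometries [J i]. *)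
Lemma tr_projector M : commutes M -> \tr (Q *m M) = k.+1%:R * ip (z *m M) z.
Proof.
move=> MJ; rewrite QE -mulmxA mxtrace_mulC /mxtrace.
transitivity (\sum_(i < k.+1) ip (z *m M) z); last first.
  by rewrite sumr_const card_ord mulr_natl.
apply: eq_bigr => i _.
transitivity (ip (row i U *m M) (row i U)).
  by rewrite /ip -row_mul !mxE; apply: eq_bigr => j _; rewrite !mxE.
by rewrite rowK -mulmxA -MJ mulmxA ip_mulmxl -mulmxA JJ mulmx1.
Qed.

(** Compares the trace form with the inner product of the horizontal lifts; the factor 2 comes from
    the two off-diagonal blocks, transposes of each other. *)
Lemma tr_tangent M M' : M^T = M -> M'^T = M' -> commutes M -> commutes M' ->
  M' = Q *m M' + M' *m Q -> \tr (M *m M') = 2 * k.+1%:R * ip (z *m M) (z *m M').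
Proof.
move=> MT M'T MJ MJ' M'Q.
have -> : \tr (M *m M') = 2 * \tr (Q *m (M *m M')).
  rewrite {1}M'Q mulmxDr mxtraceD.
  have -> : \tr (M *m (M' *m Q)) = \tr (Q *m (M *m M')).
    by rewrite [RHS]mxtrace_mulC mulmxA.
  have -> : \tr (M *m (Q *m M')) = \tr (Q *m (M *m M')).
    rewrite -mxtrace_tr trmx_mul trmx_mul QT MT M'T -mulmxA [LHS]mxtrace_mulC.
    by rewrite mulmxA.
  by rewrite -mulr2n mulr_natl.
rewrite tr_projector => [|i]; last by rewrite -mulmxA MJ' mulmxA MJ -mulmxA.
by rewrite mulmxA ip_mulmxl M'T; ring.
Qed.

Variable (w : 'rV[R]_N).
Hypothesis wE : w = z *m X.
Variable W : 'M[R]_(k.+1, N).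
Hypothesis WUX : W = U *m X.

Let QXX : Q *m (X *m X) = Q.
Proof.
transitivity ((X *m X *m Q)^T); last by rewrite XXQ QT.
by rewrite trmx_mul QT trmx_mul XT.
Qed.
Let UXX : U *m X *m X = U.
Proof.
transitivity (U *m (Q *m (X *m X))); last by rewrite QXX UQ.
by rewrite [RHS]mulmxA UQ mulmxA.
Qed.
Let zXX : z *m X *m X = z.
Proof. by rewrite z0 -!row_mul UXX. Qed.
Let QXQ : Q *m X *m Q = 0.
Proof. exact: tangent_corner QQ XQ. Qed.
Let UXQ : U *m X *m Q = 0.
Proof. by rewrite -UQ -mulmxA -mulmxA (mulmxA Q) QXQ mulmx0. Qed.
Let wQ : w *m Q = 0.
Proof. by rewrite wE z0 -!row_mul UXQ row0. Qed.
Let WW : W *m W^T = 1%:M.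
Proof. by rewrite WUX trmx_mul XT mulmxA UXX UU. Qed.
Let WE i : row i W = w *m J i.
Proof. by rewrite WUX row_mul rowK wE -!mulmxA XJ. Qed.

Hypothesis aT : forall u, (a u)^T = a u.
Hypothesis bT : forall u, (b u)^T = b u.
Hypothesis aJ : forall u, commutes (a u).
Hypothesis bJ : forall u, commutes (b u).
Hypothesis aQ : forall u, a u = Q *m a u + a u *m Q.
Hypothesis bQ : forall u, b u = a u *m X + X *m a u + (Q *m b u + b u *m Q).
Hypothesis unit_diff : forall u, (b u *m X + X *m b u) *m Q + X *m X *m a u = a u.
Hypothesis normal : forall u, \tr (X *m a u) = 0.
Hypothesis sym : forall u v, \tr (b u *m a v) = \tr (b v *m a u).
Hypothesis a_inj : forall u, a u = 0 -> u = 0.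

(** The derivative of [double_angle Q X (X *m X) t] along [u]; the last term is the product rule for
    [X *m X]. *)
Definition flow_diff (t : R) (u : 'rV[R]_m) : 'M[R]_N :=
  (cos t ^+ 2 - sin t ^+ 2) *: a u + (sin t * cos t) *: b u +
  sin t ^+ 2 *: (b u *m X + X *m b u).

Hypothesis flowT : forall t u, (flow_diff t u)^T = flow_diff t u.
Hypothesis flowJ : forall t u, commutes (flow_diff t u).
Hypothesis flow_tangent : forall t u, flow_diff t u =
  double_angle Q X (X *m X) t *m flow_diff t u + flow_diff t u *m double_angle Q X (X *m X) t.
Hypothesis flow_lift : forall t u,
  (cos t *: Q + sin t *: (Q *m X)) *m flow_diff t u +
  (cos t *: a u + sin t *: (a u *m X + Q *m b u)) *m double_angle Q X (X *m X) t =
  cos t *: a u + sin t *: (a u *m X + Q *m b u).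
Hypothesis nonsingular : forall t u, `|t| <= pi / 4 -> flow_diff t u = 0 -> u = 0.

Let al : {linear 'rV[R]_m -> 'rV[R]_N} := mulmx z \o a.
Let be : {linear 'rV[R]_m -> 'rV[R]_N} := mulmx z \o b.

Let alE u : al u = z *m a u. Proof. by []. Qed.
Let beE u : be u = z *m b u. Proof. by []. Qed.

Let QaQ u : Q *m a u *m Q = 0.
Proof. exact: tangent_corner QQ (aQ u). Qed.

Let alQ u : al u *m Q = 0.
Proof. by rewrite alE -zQ -!mulmxA (mulmxA Q) QaQ mulmx0. Qed.

Let toUt p (x : 'M[R]_(p, N)) : x *m Q = 0 -> x *m U^T = 0.
Proof.
move=> x0; have -> : U^T = Q *m U^T by rewrite QE -mulmxA UU mulmx1.
by rewrite mulmxA x0 mul0mx.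
Qed.

Let k2 : 2 * k.+1%:R != 0 :> R.
Proof. by rewrite mulf_neq0 ?pnatr_eq0. Qed.

Let al_w u : ip (al u) w = 0.
Proof.
have := tr_tangent XT (aT u) XJ (aJ u) (aQ u).
rewrite normal => /esym/eqP; rewrite mulf_eq0 (negPf k2) /=.
by rewrite -wE -alE ipC => /eqP.
Qed.

Let be_al_sym u v : ip (be u) (al v) = ip (be v) (al u).
Proof.
have := sym u v.
rewrite (tr_tangent (bT u) (aT v) (bJ u) (aJ v) (aQ v)).
rewrite (tr_tangent (bT v) (aT u) (bJ v) (aJ u) (aQ u)).
exact: mulfI k2 _ _.
Qed.

Let al_inj u : al u = 0 -> u = 0.
Proof.
move=> au0; apply: a_inj.
have Ua : U *m a u = 0.
  apply/row_matrixP => i; rewrite row0 row_mul rowK -mulmxA -aJ mulmxA -alE au0.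
  by rewrite mul0mx.
have Qa : Q *m a u = 0 by rewrite QE -mulmxA Ua mulmx0.
by rewrite aQ Qa -[a u *m Q]trmxK trmx_mul aT QT Qa trmx0 addr0.
Qed.

(** The infinitesimal form of the normal having constant length, [unit_diff] being the derivative of
    [X *m X *m Q = Q]. *)
Let be_w u : ip (be u) w = 0.
Proof.
have az : ip (al u) z = 0 by rewrite -{1}zQ -{1}QT -ip_mulmxl alQ ip0l.
have := congr1 (fun M => ip (z *m M) z) (unit_diff u).
rewrite -alE az mulmxDr ipDl !mulmxA zXX -alE az addr0 ip_mulmxl QT zQ mulmxDr ipDl.
rewrite !mulmxA -beE ip_mulmxl XT -wE ip_mulmxl bT -beE [ip w _]ipC.
by move/eqP; rewrite -mulr2n mulrn_eq0 => /eqP.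
Qed.

Let alWT_e0 u : (al u *m W^T) 0 ord0 = 0.
Proof.
by rewrite ip_rowE WE J0 mulmx1 al_w.
Qed.

(** Since [w] is orthogonal to the line, the tangent matrix [a u] sends it into the line. Its
    coordinates in the frame [U] are found by moving [a u] and the antisymmetric [J i] across the
    inner product; the one along [z] is zero by [al_w]. *)
Let wa u : w *m a u = - (al u *m W^T *m U).
Proof.
have -> : w *m a u = w *m a u *m Q.
  by rewrite {1}aQ mulmxDr mulmxA wQ mul0mx add0r mulmxA.
rewrite QE mulmxA -mulNmx; congr (_ *m _); apply/rowP => i.
have -> : (w *m a u *m U^T) 0 i = ip w (al u *m J i).
  by rewrite ip_rowE rowK ip_mulmxl aT -mulmxA -aJ mulmxA.
rewrite mxE ip_rowE WE.
have [->|i0] := eqVneq i ord0; first by rewrite J0 !mulmx1 ipC al_w oppr0.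
by rewrite ipC ip_mulmxl JN // mulmxN ipNr.
Qed.

Let A0 : 'M[R]_(m, N) := lin1_mx al.
Let A0E u : u *m A0 = al u. Proof. exact: mul_rV_lin1. Qed.

(** By [dimN], the lifts [al u], the vector [w] and the frame [U] together have as many rows as the
    dimension, and they are independent. The orthogonality assumptions kill the coefficients on [w]
    and [U]. *)
Let normal_span y : y *m U^T = 0 -> ip y w = 0 -> exists u, y = al u.
Proof.
move=> yU yw.
pose S : 'M[R]_(m + (1 + k.+1), N) := col_mx A0 (col_mx w U).
have decomp (v : 'rV[R]_(m + (1 + k.+1))) : v *m S *m U^T = 0 -> ip (v *m S) w = 0 ->
    v *m S = al (lsubmx v) /\ v = row_mx (lsubmx v) 0.
  have [u [c [d ->]]] : exists u c d, v = row_mx u (row_mx c d).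
    by exists (lsubmx v), (lsubmx (rsubmx v)), (rsubmx (rsubmx v)); rewrite !hsubmxK.
  rewrite /S !mul_row_col A0E row_mxKl.
  have wU : w *m U^T = 0 by exact: toUt.
  rewrite !mulmxDl (toUt (alQ u)) -!mulmxA wU UU mulmx0 mulmx1 !add0r => ->.
  rewrite mul0mx addr0 ipDl al_w add0r {1}[c]mx11_scalar mul_scalar_mx ipZl.
  have -> : ip w w = 1.
    by rewrite -{1}[w]mulmx1 -{2}[w]mulmx1 -J0 -!WE -ip_rows WW mxE eqxx.
  rewrite mulr1 => c0; rewrite [c]mx11_scalar c0 raddf0.
  by rewrite mul0mx addr0 row_mx0.
have Sfree (v : 'rV[R]_(m + (1 + k.+1))) : v *m S = 0 -> v = 0.
  move=> vS; have [||E ->] := decomp v; rewrite ?vS ?mul0mx ?ip0l //.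
  by rewrite (al_inj (esym (etrans (esym vS) E))) row_mx0.
have rS : row_free S.
  rewrite -kermx_eq0; apply/eqP/row_matrixP => i; rewrite row0.
  by apply: Sfree; rewrite -row_mul mulmx_ker row0.
have : (y <= S)%MS by apply: submx_full; rewrite /row_full (eqP rS); apply/eqP.
case/submxP => v yv; exists (lsubmx v); rewrite yv.
by have [||] := decomp v; rewrite -?yv.
Qed.

(** Exhibits the curve as the projector onto the line of [cos t z + sin t w], a great circle in the
    sphere. *)
Lemma double_angle_frame t : double_angle Q X (X *m X) t =
  (cos t *: U + sin t *: W)^T *m (cos t *: U + sin t *: W).
Proof.
have WUT : W^T = X *m U^T by rewrite WUX trmx_mul XT.
have XQX : X *m Q *m X = X *m X - Q.
  have -> : X *m X = X *m Q *m X + Q.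
    by rewrite {2}XQ mulmxDr mulmxA [X *m (X *m Q)]mulmxA XXQ.
  by rewrite addrK.
have E1 : U^T *m W = Q *m X by rewrite WUX mulmxA -QE.
have E2 : W^T *m U = X *m Q by rewrite WUT -mulmxA -QE.
have E3 : W^T *m W = X *m X - Q by rewrite WUT -mulmxA E1 mulmxA XQX.
have -> : (cos t *: U + sin t *: W)^T = cos t *: U^T + sin t *: W^T.
  by rewrite linearD !linearZ.
rewrite mulmxDl !mulmxDr -!scalemxAl -!scalemxAr E1 E2 E3 -QE /double_angle {1}XQ.
by apply/matrixP => i j; move: (Q *m X) (X *m Q) (X *m X) => A B C; rewrite !mxE; ring.
Qed.

(** By [normal_span] the vector is itself some [al v], hence orthogonal to itself. *)
Let AWT_span k0 u (y := k0 *: al u - k0^-1 *: (al u *m W^T *m W) + be u *m (1%:M - Q)) :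
  (forall v, ip y (al v) = 0) -> y = 0.
Proof.
move=> yal; apply/eqP; rewrite -ip_eq0; apply/eqP.
suff [v yv] : exists v, y = al v by rewrite {2}yv.
have WQ : W *m Q = 0 by rewrite WUX UXQ.
apply: normal_span; first apply: toUt.
  have pQ : al u *m W^T *m W *m Q = 0 by rewrite -mulmxA WQ mulmx0.
  have qQ : be u *m (1%:M - Q) *m Q = 0.
    by rewrite -mulmxA mulmxBl mul1mx QQ subrr mulmx0.
  by rewrite /y mulmxDl mulmxBl -!scalemxAl alQ pQ qQ !scaler0 subr0 addr0.
have pw : ip (al u *m W^T *m W) w = 0.
  have -> : w = row ord0 W by rewrite WE J0 mulmx1.
  by rewrite ip_mulmxl -row_mul WW -ip_rowE trmx1 mulmx1 alWT_e0.
rewrite /y !ipDl ipNl !ipZl al_w pw !mulr0 subrr add0r ip_mulmxl linearB /= trmx1 QT.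
by rewrite mulmxBr mulmx1 wQ subr0 be_w.
Qed.

(** A kernel vector of the pencil only gives an identity tested against the lifts [al v]; [AWT_span]
    upgrades it to an identity of vectors. *)
Let coefficients_vanish k0 u :
  u *m (k0 *: (A0 *m A0^T) - k0^-1 *: (A0 *m W^T *m (W *m A0^T)) +
        lin1_mx be *m A0^T) = 0 ->
  k0 *: al u - k0^-1 *: (al u *m W^T *m W) + be u *m (1%:M - Q) = 0.
Proof.
move=> u0; apply: AWT_span => v.
have : ip (u *m (k0 *: (A0 *m A0^T) - k0^-1 *: (A0 *m W^T *m (W *m A0^T)) +
        lin1_mx be *m A0^T)) v = 0 by rewrite u0 ip0l.
have -> : k0 *: (A0 *m A0^T) - k0^-1 *: (A0 *m W^T *m (W *m A0^T)) +
        lin1_mx be *m A0^T =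
   (k0 *: A0 - k0^-1 *: (A0 *m W^T *m W) + lin1_mx be) *m A0^T.
  by rewrite mulmxDl mulmxBl -!scalemxAl !mulmxA.
rewrite mulmxA ip_mulmxl trmxK A0E => E; rewrite -[RHS]E.
have -> : u *m (k0 *: A0 - k0^-1 *: (A0 *m W^T *m W) + lin1_mx be) =
    k0 *: al u - k0^-1 *: (al u *m W^T *m W) + be u.
  by rewrite mulmxDr mulmxBr -!scalemxAr !mulmxA A0E mul_rV_lin1.
rewrite [LHS]ipDl [RHS]ipDl; congr (_ + _).
by rewrite ip_mulmxl linearB /= trmx1 QT mulmxBr mulmx1 alQ subr0.
Qed.

(** The equation says that the lift of the moving point has, at time [t], a derivative lying in the
    moving line itself. The projector onto that line then has zero derivative, which [nonsingular]
    forbids unless [u] is zero. *)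
Let singular k0 u : 1 <= `|k0| ->
  k0 *: al u - k0^-1 *: (al u *m W^T *m W) + be u *m (1%:M - Q) = 0 -> u = 0.
Proof.
(* [k0] is the cotangent of [t]; negative values correspond to flowing in the opposite direction. *)
move=> k1 y0; pose t := atan k0^-1.
have k00 : k0 != 0 by rewrite -normr_gt0 (lt_le_trans ltr01).
have t4 : `|t| <= pi / 4.
  have k1' : `|k0^-1| <= 1 by rewrite normfV invf_le1 // normr_gt0.
  rewrite ler_norml -atan1 -atanN; move: k1'; rewrite ler_norml => /andP[? ?].
  by rewrite !le_atan.
have c0 : cos t != 0.
  by rewrite cos_atan invr_neq0 // gt_eqF // sqrtr_gt0 ltr_pwDl // sqr_ge0.
have st : sin t = k0^-1 * cos t by rewrite -[k0^-1]atanK -/t /tan divfK.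
apply: (nonsingular t4).
pose x := al u *m W^T.
pose Ut := cos t *: U + sin t *: W.
have UWT : U *m W^T = 0 by rewrite WUX trmx_mul XT mulmxA (toUt UXQ).
have UtUt : Ut *m Ut^T = 1%:M.
  have -> : Ut^T = cos t *: U^T + sin t *: W^T by rewrite /Ut linearD !linearZ.
  have WUT : W *m U^T = 0 by rewrite -[W]trmxK -trmx_mul UWT trmx0.
  rewrite mulmxDl !mulmxDr -!scalemxAl -!scalemxAr UU UWT WUT WW !scaler0 add0r addr0.
  by rewrite !scalerA -scalerDl -!expr2 cos2Dsin2 scale1r.
have UtQ : Ut *m double_angle Q X (X *m X) t = Ut.
  by rewrite double_angle_frame mulmxA UtUt mul1mx.
pose T := flow_diff t u; pose ct := cos t *: z + sin t *: w.
pose D := cos t *: al u + sin t *: (al u *m X + be u).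
have liftE : ct *m T + D *m double_angle Q X (X *m X) t = D.
  have := congr1 (mulmx z) (flow_lift t u).
  rewrite [in LHS]mulmxDr [in LHS]mulmxA [in LHS](mulmxA z _ (double_angle Q X (X *m X) t)).
  have -> : z *m (cos t *: a u + sin t *: (a u *m X + Q *m b u)) = D.
    by rewrite mulmxDr -!scalemxAr mulmxDr !mulmxA zQ.
  have -> : z *m (cos t *: Q + sin t *: (Q *m X)) = ct => //.
  by rewrite mulmxDr -!scalemxAr mulmxA zQ -wE.
have alX : al u *m X = al u *m X *m Q.
  by rewrite {1}XQ mulmxDr !mulmxA alQ mul0mx add0r.
(* The component of [be u] in the line is forced by the derivative [bQ] of the tangency equation,
   compressed by [z] and [Q]; the pencil only controls the other component. *)
have beQ : be u *m Q = x *m U - al u *m X.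
  have : be u *m Q = be u *m Q + (be u *m Q + (al u *m X + w *m a u)).
    rewrite {1}beE {1}bQ !mulmxDr !mulmxDl !mulmxA zQ -alE -beE -wE -alX.
    have -> : w *m a u *m Q = w *m a u by rewrite wa -mulNmx -mulmxA UQ.
    by rewrite -[be u *m Q *m Q]mulmxA QQ addrCA [X in _ + X]addrC addrA [_ + be u *m Q]addrC.
  move/eqP; rewrite -subr_eq0 opprD addNKr oppr_eq0 addr_eq0 => /eqP ->.
  by rewrite wa opprD opprK addrC.
have be1Q : be u *m (1%:M - Q) = k0^-1 *: (x *m W) - k0 *: al u.
  by move/eqP: y0; rewrite addrC addr_eq0 opprB => /eqP.
(* [D] is a combination of the rows of [Ut], the frame of the moving line. *)
have DE : D = k0^-1 *: (x *m Ut).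
  have -> : D = cos t *: al u + sin t *: (be u *m (1%:M - Q) + x *m U).
    by rewrite /D mulmxBr mulmx1 beQ opprB addrA subrK addrC.
  rewrite be1Q st /Ut mulmxDr -!scalemxAr st.
  move: (x *m W) (x *m U) (al u) => A B C; apply/rowP => i; rewrite !mxE.
  by field.
have ctT : ct *m T = 0.
  move: liftE; rewrite DE -scalemxAl -mulmxA UtQ => /eqP.
  by rewrite -subr_eq0 addrK => /eqP.
have UtT : Ut *m T = 0.
  apply/row_matrixP => i; rewrite row0 row_mul.
  have -> : row i Ut = ct *m J i.
    by rewrite !linearD !linearZ /= rowK WE mulmxDl -!scalemxAl.
  by rewrite -mulmxA -flowJ mulmxA ctT mul0mx.
have QT0 : double_angle Q X (X *m X) t *m T = 0 by rewrite double_angle_frame -mulmxA UtT mulmx0.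
rewrite -/T /T flow_tangent -/T QT0 add0r.
have QtT : (double_angle Q X (X *m X) t)^T = double_angle Q X (X *m X) t.
  by rewrite double_angle_frame trmx_mul trmxK.
by rewrite -[LHS]trmxK trmx_mul QtT flowT QT0 trmx0.
Qed.

Lemma focal_point_contradiction (i1 : 'I_k.+1) : i1 != ord0 -> False.
Proof.
move=> i10; have w0 : w = row ord0 W by rewrite WE J0 mulmx1.
(* The direction X.i is orthogonal to the line and to the normal, hence tangent to the
   hypersurface. *)
have [u1 u1E] : exists u, w *m J i1 = al u.
  apply: normal_span; first by rewrite -WE -row_mul WUX (toUt UXQ) row0.
  by rewrite -WE [X in ip _ X]w0 -ip_rows WW mxE (negPf i10).
pose Bm := lin1_mx be *m A0^T.
pose Am := A0 *m A0^T.
pose Pm := A0 *m W^T *m (W *m A0^T).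
have PmT : W *m A0^T = (A0 *m W^T)^T by rewrite trmx_mul trmxK.
have gramE (p : nat) (M : 'M[R]_(m, p)) u v : ip (u *m (M *m M^T)) v = ip (u *m M) (v *m M).
  by rewrite mulmxA ip_mulmxl trmxK.
have gramT (p : nat) (M : 'M[R]_(m, p)) : (M *m M^T)^T = M *m M^T.
  by rewrite trmx_mul trmxK.
have BmE u v : ip (u *m Bm) v = ip (be u) (al v).
  by rewrite mulmxA ip_mulmxl trmxK mul_rV_lin1 A0E.
have BmT : Bm^T = Bm.
  apply/matrixP => i j; have ent (M : 'M[R]_m) i' j' :
      M i' j' = ip (delta_mx 0 i' *m M) (delta_mx 0 j').
    by rewrite -rowE -[delta_mx 0 j']mulmx1 -rowE -ip_rowE trmx1 mulmx1 mxE.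
  by rewrite mxE ent [RHS]ent !BmE be_al_sym.
have Am0 u : u != 0 -> 0 < ip (u *m Am) u.
  move=> u0; rewrite gramE A0E; apply: ip_gt0.
  by apply: contra u0 => /eqP/al_inj ->.
have Pm0 u : 0 <= ip (u *m Pm) u by rewrite /Pm PmT gramE ip_ge0.
have PmS : Pm^T = Pm by rewrite /Pm PmT gramT.
have u10 : u1 != 0.
  apply: contraTneq isT => u10.
  have : ip (w *m J i1) (w *m J i1) = 1 by rewrite -WE -ip_rows WW mxE eqxx.
  by rewrite u1E u10 linear0 ip0l => /eqP; rewrite eq_sym oner_eq0.
have AP : ip (u1 *m (Am - Pm)) u1 = 0.
  rewrite mulmxBr ipDl ipNl gramE /Pm PmT gramE mulmxA A0E -u1E -WE -row_mul WW.
  by rewrite -!ip_rows WW trmx1 mulmx1 !mxE eqxx subrr.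
have pos := pencil_pos (gramT _ A0) PmS BmT Am0 Pm0 _ u10.
have NBmT : (- Bm)^T = - Bm by rewrite linearN /= BmT.
have neg := pencil_pos (gramT _ A0) PmS NBmT Am0 Pm0 _ u10.
have H1 : 0 < ip (u1 *m Bm) u1.
  have -> : ip (u1 *m Bm) u1 = ip (u1 *m (Am - Pm + Bm)) u1.
    by rewrite [in RHS]mulmxDr ipDl AP add0r.
  apply: pos => k0 u k1 E.
  apply: (@singular k0); first by rewrite ger0_norm // (le_trans ler01).
  exact: coefficients_vanish E.
have : 0 < ip (u1 *m - Bm) u1.
  have -> : ip (u1 *m - Bm) u1 = ip (u1 *m (Am - Pm - Bm)) u1.
    by rewrite [in RHS]mulmxDr ipDl AP add0r.
  apply: neg => k0 u k1 E.
  (* Replacing [B] by its opposite amounts to replacing [k0] by [- k0] and changing the sign of the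
     whole equation. *)
  apply: (@singular (- k0)); first by rewrite normrN ger0_norm // (le_trans ler01).
  apply: coefficients_vanish.
  rewrite invrN !scaleNr opprK -[RHS]oppr0 -E -mulmxN !opprD !opprK.
  by [].
by rewrite mulmxN ipNl oppr_gt0 ltNge ltW.
Qed.

End FocalPoint.

(** * The projective space as a space of projectors *)

Section Scalars.
Context {R : realType} (K : scalars).
Local Notation k := (kdim K).
Local Notation scal := 'rV[R]_k.

(** Row [i] is the product of the basis scalar [i] by [q], in this order, so that scalars act on
    rows from the right. Lists indexed by numbers let identities be checked by cases on ordinals. *)
Definition rmul_entries (q : nat -> R) : seq (seq R) :=
  match K with
  | Complex => [:: [:: q 0%N; q 1%N]; [:: - q 1%N; q 0%N]]
  | Quaternion =>
    [:: [:: q 0%N; q 1%N; q 2%N; q 3%N]; [:: - q 1%N; q 0%N; - q 3%N; q 2%N];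
        [:: - q 2%N; q 3%N; q 0%N; - q 1%N]; [:: - q 3%N; - q 2%N; q 1%N; q 0%N]]
  end.

Definition co (q : scal) (l : nat) : R := q 0 (inord l).

Definition rmul (q : scal) : 'M[R]_k :=
  \matrix_(i, j) nth 0 (nth [::] (rmul_entries (co q)) i) j.

Lemma coordE (q : scal) (i : 'I_k) : q 0 i = co q i.
Proof. by rewrite /co inord_val. Qed.

Lemma kmulE (p q : scal) : kmul p q = p *m rmul q.
Proof.
apply/rowP => j; rewrite !mxE; under [RHS]eq_bigr do rewrite coordE mxE.
move: j; rewrite /co /rmul_entries /kmul; case: K p q => p q [[|[|[|[|//]]]] ?] //=;
  rewrite !big_ord_recl big_ord0 /=; ring.
Qed.

Lemma rmul_is_linear : linear rmul.
Proof.
move=> c p q; apply/matrixP => i j; rewrite !mxE.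
move: i j; rewrite /co /rmul_entries; case: K p q => p q [[|[|[|[|//]]]] ?] [[|[|[|[|//]]]] ?] //=;
  rewrite !mxE; ring.
Qed.
HB.instance Definition _ := GRing.isLinear.Build _ _ _ _ _ rmul_is_linear.

Lemma rmulM (p q : scal) : rmul p *m rmul q = rmul (p *m rmul q).
Proof.
apply/matrixP => i j; rewrite !mxE; under [LHS]eq_bigr do rewrite !mxE.
have -> : co (p *m rmul q) =
    fun l => \sum_(i < k) co p i *
      nth 0 (nth [::] (rmul_entries (co q)) i) (inord l : 'I_k).
  by apply/funext => l; rewrite {1}/co mxE; apply: eq_bigr => a _; rewrite coordE mxE.
move: i j; rewrite /co /rmul_entries; move: p q; case: K.
  move=> p q [[|[|//]] ?] [[|[|//]] ?] /=;
   rewrite !big_ord_recl !big_ord0 /= ?inordK //=; ring.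
move=> p q [[|[|[|[|//]]]] ?] [[|[|[|[|//]]]] ?] /=;
   rewrite !big_ord_recl !big_ord0 /= ?inordK //=; ring.
Qed.

Lemma rmulT (q : scal) : rmul q *m (rmul q)^T = (ip q q)%:M.
Proof.
apply/matrixP => i j; rewrite ipE !mxE; under [LHS]eq_bigr do rewrite !mxE.
under [in RHS]eq_bigr do rewrite coordE.
move: i j; rewrite /co /rmul_entries; move: q; case: K.
  move=> q [[|[|//]] ?] [[|[|//]] ?] /=;
   rewrite !big_ord_recl !big_ord0 /= -?val_eqE /=; ring.
move=> q [[|[|[|[|//]]]] ?] [[|[|[|[|//]]]] ?] /=;
   rewrite !big_ord_recl !big_ord0 /= -?val_eqE /=; ring.
Qed.

Definition e_ (i : 'I_k) : scal := delta_mx 0 i.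

Lemma rmul1 : rmul (e_ 0) = 1%:M.
Proof.
apply/matrixP => i j; rewrite !mxE.
have -> : co (e_ 0) = fun l => (val (inord l : 'I_k) == 0%N)%:R.
  by apply/funext => l; rewrite /co mxE -val_eqE.
move: i j; rewrite /co /rmul_entries; case: K.
  by move=> [[|[|//]] ?] [[|[|//]] ?] /=; rewrite ?inordK //= ?oppr0.
by move=> [[|[|[|[|//]]]] ?] [[|[|[|[|//]]]] ?] /=; rewrite ?inordK //= ?oppr0.
Qed.

Lemma mul_e0_rmul (q : scal) : e_ 0 *m rmul q = q.
Proof.
apply/rowP => j; rewrite -rowE !mxE coordE.
by move: j; rewrite /co /rmul_entries; case: K q => q [[|[|[|[|//]]]] ?] //=.
Qed.

End Scalars.

(** * Norm and conjugation of scalars *)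

Section Frames.
Context {R : realType} (K : scalars).
Local Notation k := (kdim K).
Local Notation scal := 'rV[R]_k.

Lemma dotE a b (A B : 'M[R]_(a, b)) : dot A B = \tr (A *m B^T).
Proof.
apply: eq_bigr => i _; rewrite mxE; apply: eq_bigr => j _.
by rewrite mxE.
Qed.

Lemma dot_ip b (x y : 'rV[R]_b) : dot x y = ip x y.
Proof. by rewrite dotE /ip /mxtrace big_ord1. Qed.

Lemma ip_mxvec a b (A B : 'M[R]_(a, b)) : ip (mxvec A) (mxvec B) = dot A B.
Proof.
rewrite ipE /dot pair_big /=.
rewrite (reindex _ (curry_mxvec_bij a b)) /=.
by apply: eq_bigr => -[i j] _; rewrite !mxvecE.
Qed.

Lemma rmulZ c (q : scal) : rmul (c *: q) = c *: rmul q.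
Proof. exact: linearZ. Qed.

Lemma mxvecZ a b c (A : 'M[R]_(a, b)) : mxvec (c *: A) = c *: mxvec A.
Proof. exact: linearZ. Qed.

Lemma rmul_polar (p q : scal) :
  rmul p *m (rmul q)^T + rmul q *m (rmul p)^T = (2 * ip p q)%:M.
Proof.
have := rmulT (p + q); rewrite (linearD (@rmul R K)).
have -> : (rmul p + rmul q)^T = (rmul p)^T + (rmul q)^T by exact: linearD.
rewrite mulmxDl !mulmxDr !rmulT.
rewrite !ipDl !ipDr [ip q p]ipC => E.
apply/matrixP => i j; have := congr1 (fun M : 'M[R]_k => M i j) E.
by rewrite !mxE; case: (i == j); rewrite ?mulr1n ?mulr0n => H; lra.
Qed.

Lemma dot_rmul a (A : 'M[R]_(a, k)) (p q : scal) :
  dot (A *m rmul p) (A *m rmul q) = ip p q * dot A A.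
Proof.
apply: (@mulfI _ 2); first by rewrite pnatr_eq0.
have E : dot (A *m rmul p) (A *m rmul q) = dot (A *m rmul q) (A *m rmul p).
  by rewrite !dotE -mxtrace_tr trmx_mul trmxK.
have D (M M' : 'M[R]_k) : dot (A *m M) (A *m M') = \tr (A *m (M *m M'^T) *m A^T).
  by rewrite dotE trmx_mul !mulmxA.
rewrite mulr_natl mulr2n {2}E !D -mxtraceD -mulmxDl -mulmxDr rmul_polar.
by rewrite mul_mx_scalar -scalemxAl mxtraceZ -dotE mulrA.
Qed.

(** The first row of the transposed multiplication matrix; [kconjE] shows that it is the usual
    conjugate, uniformly in the kind of scalars. *)
Definition kconj (q : scal) : scal := e_ (0 : 'I_k) *m (rmul q)^T.

Lemma kconjE q : kconj q = (2 * ip (e_ (0 : 'I_k)) q) *: e_ (0 : 'I_k) - q.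
Proof.
have := rmul_polar (e_ (0 : 'I_k)) q.
rewrite rmul1 mul1mx trmx1 mulmx1 => /(congr1 (mulmx (e_ (0 : 'I_k)))).
by rewrite mulmxDr mul_e0_rmul mul_mx_scalar => <-; rewrite addrK.
Qed.

Lemma rmul_kconj q : rmul (kconj q) = (rmul q)^T.
Proof.
have := rmul_polar (e_ (0 : 'I_k)) q; rewrite rmul1 mul1mx trmx1 mulmx1 => E.
by rewrite kconjE linearB linearZ /= rmul1 scalemx1 -E addrK.
Qed.

(** Both sides are twice the product of the real parts minus [ip p q], so noncommutativity does no
    harm. *)
Lemma real_partC (p q : scal) : ip (e_ (0 : 'I_k)) (p *m rmul q) = ip (e_ (0 : 'I_k)) (q *m rmul p).
Proof.
rewrite ![ip (e_ (0 : 'I_k)) (_ *m _)]ipC !ip_mulmxl -/(kconj q) -/(kconj p) !kconjE.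
by rewrite !(ipDr, ipNr, ipZr) [ip q p]ipC [ip q _]ipC [ip p (e_ (0 : 'I_k))]ipC; ring.
Qed.

Lemma ip_e (q : scal) i : ip q (e_ i) = q 0 i.
Proof. by rewrite -[e_ i]mulmx1 -rowE -ip_rowE trmx1 mulmx1. Qed.

Lemma kinvE (q : scal) : kinv q = (ip q q)^-1 *: kconj q.
Proof.
rewrite /kinv dot_ip; congr (_ *: _); rewrite kconjE; apply/rowP => j.
rewrite ipC ip_e !mxE eqxx /=; case: eqP => [->|_] /=; rewrite ?mulr1 ?mulr0; ring.
Qed.

Lemma kactE n (z : 'M[R]_(n.+1, k)) q : kact z q = z *m rmul q.
Proof. by apply/matrixP => i j; rewrite mxE kmulE -row_mul mxE. Qed.

End Frames.

(** * Projectors onto lines over the scalars *)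

Section Projectors.
Context {R : realType} (K : scalars) (n : nat).
Local Notation k := (kdim K).
Local Notation scal := 'rV[R]_k.
Local Notation vect := 'M[R]_(n.+1, k).
Local Notation N := (n.+1 * k)%N.

Definition Jact (q : scal) : 'M[R]_N := lin_mulmxr (rmul q).

Lemma mxvec_Jact (z : vect) q : mxvec z *m Jact q = mxvec (z *m rmul q).
Proof. exact: mul_vec_lin. Qed.

Lemma vec_Jact x q : x *m Jact q = mxvec (vec_mx x *m rmul q).
Proof. by rewrite -mxvec_Jact vec_mxK. Qed.

Lemma eq_mulmx_row p (M M' : 'M[R]_(p, N)) : (forall x : 'rV_p, x *m M = x *m M') -> M = M'.
Proof. by move=> E; apply/row_matrixP => i; rewrite !rowE E. Qed.

Lemma Jact_is_linear : linear Jact.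
Proof.
move=> c p q; apply: eq_mulmx_row => x.
by rewrite mulmxDr -scalemxAr !vec_Jact linearP mulmxDr -scalemxAr linearP.
Qed.
HB.instance Definition _ := GRing.isLinear.Build _ _ _ _ _ Jact_is_linear.

Lemma JactM p q : Jact p *m Jact q = Jact (p *m rmul q).
Proof.
by apply: eq_mulmx_row => x; rewrite mulmxA !vec_Jact mxvecK -mulmxA rmulM.
Qed.

Lemma Jact1 : Jact (e_ (0 : 'I_k)) = 1%:M.
Proof.
by apply: eq_mulmx_row => x; rewrite vec_Jact rmul1 !mulmx1 vec_mxK.
Qed.

Lemma ip_Jact x p q : ip (x *m Jact p) (x *m Jact q) = ip p q * ip x x.
Proof. by rewrite !vec_Jact ip_mxvec dot_rmul -ip_mxvec vec_mxK. Qed.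

Lemma JactT q : Jact (kconj q) = (Jact q)^T.
Proof.
apply: eq_mulmx_row => x; apply/eqP; rewrite -subr_eq0 -ip_eq0.
have E y : ip (x *m Jact (kconj q)) y = ip (x *m (Jact q)^T) y.
  rewrite [RHS]ip_mulmxl trmxK !vec_Jact -{1}[y]vec_mxK -{2}[x]vec_mxK !ip_mxvec !dotE.
  by rewrite rmul_kconj trmx_mul mulmxA.
by rewrite ipDl ipNl E subrr.
Qed.

Lemma Jact_unit q : Jact q *m (Jact q)^T = (ip q q)%:M.
Proof.
rewrite -JactT JactM rmul_kconj.
have -> : q *m (rmul q)^T = ip q q *: e_ (0 : 'I_k).
  by rewrite -{1}[q]mul_e0_rmul -mulmxA rmulT mul_mx_scalar.
by rewrite linearZ /= Jact1 scalemx1.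
Qed.

Definition frame (x : 'rV[R]_N) : 'M[R]_(k, N) := \matrix_i (x *m Jact (e_ i)).

Lemma mul_frame q x : q *m frame x = x *m Jact q.
Proof.
rewrite mulmx_sum_row {2}(row_sum_delta q) linear_sum mulmx_sumr.
by apply: eq_bigr => i _; rewrite rowK linearZ scalemxAr.
Qed.

Lemma frame0 x : row 0 (frame x) = x.
Proof. by rewrite rowK Jact1 mulmx1. Qed.

Lemma frame_unit x : frame x *m (frame x)^T = (ip x x)%:M.
Proof.
apply/matrixP => i j; rewrite ip_rows !rowK ip_Jact ip_e !mxE eqxx /= [j == i]eq_sym.
by case: eqP => _; rewrite ?mul1r ?mul0r.
Qed.

Lemma frame_Jact x q : frame x *m Jact q = rmul q *m frame x.
Proof.
apply/row_matrixP => i; rewrite !row_mul rowK -mulmxA JactM.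
by rewrite mul_frame rowE.
Qed.

(** For a unit vector, the orthogonal projector onto its line; in general, that projector multiplied
    by [ip x x]. *)
Definition kproj (x : 'rV[R]_N) : 'M[R]_N := (frame x)^T *m frame x.

Lemma frameZ c x : frame (c *: x) = c *: frame x.
Proof. by apply: eq_mulmx_row => q; rewrite -scalemxAr !mul_frame; rewrite -scalemxAl. Qed.

Lemma kprojZ c x : kproj (c *: x) = c ^+ 2 *: kproj x.
Proof.
have E : (c *: frame x)^T = c *: (frame x)^T by exact: linearZ.
by rewrite /kproj frameZ E -scalemxAl -scalemxAr scalerA.
Qed.

Lemma kprojT x : (kproj x)^T = kproj x.
Proof. by rewrite trmx_mul trmxK. Qed.

Lemma mul_kproj x : ip x x = 1 -> x *m kproj x = x.
Proof.
by move=> x1; rewrite -{1}[x]frame0 -row_mul mulmxA frame_unit x1 mul1mx frame0.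
Qed.

Lemma kproj_idem x : ip x x = 1 -> kproj x *m kproj x = kproj x.
Proof.
by move=> x1; rewrite {1}/kproj -mulmxA (mulmxA (frame x)) frame_unit x1 mul1mx.
Qed.

Lemma unit_trmx p (M : 'M[R]_p) c : M *m M^T = c%:M -> M^T *m M = c%:M.
Proof.
have [->|c0] := eqVneq c 0.
  move=> M0; suff -> : M = 0 by rewrite mulmx0 raddf0.
  apply/row_matrixP => i; apply/eqP; rewrite row0 -ip_eq0 -ip_rows M0.
  by rewrite mxE mul0rn.
move=> MM; have : (c^-1 *: M) *m M^T = 1%:M.
  by rewrite -scalemxAl MM -[c%:M]scalemx1 scalerA mulVf // scale1r.
move/mulmx1C; rewrite -scalemxAr => E.
by rewrite -[c%:M]scalemx1 -E scalerA mulfV // scale1r.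
Qed.

Lemma kproj_Jact x q : kproj (x *m Jact q) = ip q q *: kproj x.
Proof.
pose L : 'M[R]_k := \matrix_i (q *m rmul (e_ i)).
have FE : frame (x *m Jact q) = L *m frame x.
  apply/row_matrixP => i; rewrite row_mul !rowK -mulmxA JactM -mul_frame.
  by [].
have LL : L *m L^T = (ip q q)%:M.
  apply/matrixP => i j.
  rewrite ip_rows !rowK -dot_ip dot_rmul ip_e dot_ip !mxE eqxx /= [j == i]eq_sym.
  by case: eqP => _; rewrite ?mul1r ?mul0r.
rewrite {1}/kproj FE trmx_mul -mulmxA (mulmxA L^T) (unit_trmx LL) mul_scalar_mx -scalemxAr.
by [].
Qed.

(** Multiplication by a unit scalar rotates the frame by an orthogonal matrix, which cancels in
    [kproj]. *)
Lemma kproj_commutes x i : kproj x *m Jact (e_ i) = Jact (e_ i) *m kproj x.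
Proof.
have e1 : ip (e_ i) (e_ i) = 1 :> R by rewrite ip_e mxE !eqxx.
set q := e_ i in e1 *.
have E : (Jact q)^T *m kproj x *m Jact q = kproj x.
  rewrite /kproj mulmxA -trmx_mul -mulmxA frame_Jact trmx_mul -mulmxA (mulmxA (rmul q)^T).
  by rewrite (unit_trmx (rmulT q)) e1 mul1mx.
by rewrite -{2}E !mulmxA Jact_unit e1 mul1mx.
Qed.

Lemma in_frame x y : ip x x = 1 -> ip y y = 1 -> y *m kproj x = y ->
  exists2 q, ip q q = 1 & y = x *m Jact q.
Proof.
move=> x1 y1 yx; exists (y *m (frame x)^T); last by rewrite -mul_frame -mulmxA.
by rewrite ip_mulmxl trmxK -mulmxA -/(kproj x) yx.
Qed.

End Projectors.

(** * Affine charts in terms of projectors *)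

Section ProjectiveSpace.
Context {R : realType} {K : scalars} {n : nat}.
Local Notation k := (kdim K).
Local Notation scal := 'rV[R]_k.
Local Notation vect := 'M[R]_(n.+1, k).
Local Notation model := 'M[R]_(n, k).
Local Notation N := (n.+1 * k)%N.
Local Notation space := (proj_space R K n).
Local Notation e0 := (e_ (0 : 'I_k)).

Lemma sphere_ip (z : sphere R K n) : ip (mxvec (val z)) (mxvec (val z)) = 1.
Proof. by rewrite ip_mxvec; exact/eqP/(valP z). Qed.

Lemma hopf_fibreP (z w : vect) :
  hopf_fibre z w <-> exists2 q, ip q q = 1 & mxvec w = mxvec z *m Jact n q.
Proof.
split=> [[q /= q1 <-]|[q q1 E]].
  by exists q; rewrite -?dot_ip // kactE mxvec_Jact.
by exists q; rewrite /= ?dot_ip // kactE; apply: (can_inj mxvecK); rewrite E mxvec_Jact.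
Qed.

Lemma hopf_fibre_refl (z : vect) : hopf_fibre z z.
Proof.
by apply/hopf_fibreP; exists e0; rewrite ?Jact1 ?mulmx1 // ip_e mxE !eqxx.
Qed.

Lemma proj_fibre (z w : vect) : hopf_fibre z w -> kproj (mxvec w) = kproj (mxvec z).
Proof. by move=> /hopf_fibreP[q q1 ->]; rewrite kproj_Jact q1 scale1r. Qed.

Definition sphere_lift (p : space) : sphere R K n := projT1 (cid (asboolW (valP p))).

Lemma val_lift p : val p = hopf_fibre (val (sphere_lift p)).
Proof. exact: projT2 (cid (asboolW (valP p))). Qed.

Lemma hopf_lift p : hopf (sphere_lift p) = p.
Proof. by apply: val_inj; rewrite /= -val_lift. Qed.

Definition projector (p : space) : 'M[R]_N := kproj (mxvec (val (sphere_lift p))).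

Lemma projector_fibre p w : val p w -> projector p = kproj (mxvec w).
Proof. by rewrite val_lift => /proj_fibre ->. Qed.

Lemma projector_hopf z : projector (hopf z) = kproj (mxvec (val z)).
Proof. by apply: projector_fibre; exact: hopf_fibre_refl. Qed.

Lemma sub_hopf_fibre (z w : sphere R K n) : kproj (mxvec (val z)) = kproj (mxvec (val w)) ->
  hopf_fibre (val z) `<=` hopf_fibre (val w).
Proof.
move=> E y /hopf_fibreP[q q1 yE].
have [|q' q'1 zE] := in_frame (sphere_ip w) (sphere_ip z).
  by rewrite -E mul_kproj // sphere_ip.
apply/hopf_fibreP; exists (q' *m rmul q); last by rewrite yE zE -mulmxA JactM.
by rewrite -dot_ip dot_rmul q1 dot_ip q'1 mulr1.
Qed.

Lemma projector_inj : injective projector.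
Proof.
move=> p p' E; rewrite -(hopf_lift p) -(hopf_lift p'); apply: val_inj => /=.
by apply/seteqP; split; exact: sub_hopf_fibre.
Qed.

Variable i : 'I_n.+1.

Definition chart_idx : 'I_N := mxvec_index i (0 : 'I_k).

(** On the projector of [z] this is [z] times the conjugate of its entry [i] ([column_kproj]), so a
    representative of the line is read off the projector. *)
Definition column (M : 'M[R]_N) : vect := vec_mx (row chart_idx M).

(** The affine coordinates, extended to rational functions of an arbitrary matrix so that they can
    be differentiated in the matrix space. *)
Definition rho (M : 'M[R]_N) : model :=
  \matrix_(j, c) (column M (lift i j) c / column M i 0).

Lemma columnZ c M : column (c *: M) = c *: column M.
Proof. by rewrite /column !linearZ. Qed.

Lemma column_kproj (z : vect) : column (kproj (mxvec z)) = z *m (rmul (row i z))^T.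
Proof.
rewrite /column /kproj row_mul mul_frame.
suff -> : row chart_idx (frame (mxvec z))^T = kconj (row i z).
  by rewrite mxvec_Jact mxvecK rmul_kconj.
apply/rowP => a; rewrite mxE mxE mxE mxvec_Jact mxvecE.
have -> : (z *m rmul (e_ a)) i 0 = ip e0 (row i z *m rmul (e_ a)).
  by rewrite ipC ip_e -row_mul [RHS]mxE.
by rewrite real_partC ipC ip_mulmxl -/(kconj _) ipC ip_e.
Qed.

Lemma row_column (z : vect) :
  row i (z *m (rmul (row i z))^T) = ip (row i z) (row i z) *: e0.
Proof. by rewrite row_mul -{1}[row i z]mul_e0_rmul -mulmxA rmulT mul_mx_scalar. Qed.

Lemma column_diag (z : vect) :
  column (kproj (mxvec z)) i 0 = ip (row i z) (row i z).
Proof.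
rewrite column_kproj; have := congr1 (fun M : 'rV[R]_k => M 0 0) (row_column z).
by rewrite [LHS]mxE => ->; rewrite mxE -ip_e ip_e mxE !eqxx mulr1.
Qed.

Lemma affine_coordE (z : vect) : affine_coord i z = rho (kproj (mxvec z)).
Proof.
apply/matrixP => j c; rewrite [LHS]mxE [RHS]mxE column_diag column_kproj kmulE kinvE rmulZ.
by rewrite rmul_kconj -scalemxAr mxE mulrC -row_mul [X in X / _]mxE.
Qed.

Lemma affine_chartE p : Defs.coord (affine_chart R K i) p = rho (projector p).
Proof.
rewrite /= affine_coordE; congr rho; apply/esym/projector_fibre.
case: xgetP => [w _ //|/(_ (val (sphere_lift p)))]; rewrite val_lift.
by move/(_ (hopf_fibre_refl _)).
Qed.

Lemma affine_domE p : dom (affine_chart R K i) p <-> column (projector p) i 0 != 0.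
Proof.
split=> [[z pz zi]|pi].
  by rewrite (projector_fibre pz) column_diag ip_eq0.
exists (val (sphere_lift p)); first by rewrite val_lift; exact: hopf_fibre_refl.
by rewrite -ip_eq0 -column_diag.
Qed.

Definition affine_vect (y : model) : vect :=
  \matrix_(j, c) if unlift i j is Some j' then y j' c else (e0 0 c).

Definition psi (y : model) : 'M[R]_N :=
  (dot (affine_vect y) (affine_vect y))^-1 *: kproj (mxvec (affine_vect y)).

Lemma row_affine_vect y : row i (affine_vect y) = e0.
Proof. by apply/rowP => c; rewrite mxE mxE unlift_none. Qed.

Lemma dot_affine_gt0 y : 0 < dot (affine_vect y) (affine_vect y).
Proof.
rewrite -ip_mxvec; apply: ip_gt0; apply: contraTneq isT => /(congr1 vec_mx).
rewrite mxvecK linear0 => E; have := row_affine_vect y; rewrite E row0.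
by move/rowP => /(_ 0); rewrite !mxE !eqxx => /eqP; rewrite eq_sym oner_eq0.
Qed.

Lemma column_psi y :
  column (psi y) = (dot (affine_vect y) (affine_vect y))^-1 *: affine_vect y.
Proof. by rewrite columnZ column_kproj row_affine_vect rmul1 trmx1 mulmx1. Qed.

Lemma column_psi_neq0 y : column (psi y) i 0 != 0.
Proof.
rewrite column_psi !mxE unlift_none ?mxE !eqxx mulr1 invr_neq0 // gt_eqF //.
exact: dot_affine_gt0.
Qed.

Lemma psiK : cancel psi rho.
Proof.
move=> y; apply/matrixP => j c; rewrite mxE column_psi !mxE unlift_none liftK.
rewrite ?mxE !eqxx mulr1 invrK mulrAC mulVf ?mul1r // gt_eqF //.
exact: dot_affine_gt0.
Qed.

Lemma rhoK p : dom (affine_chart R K i) p -> psi (rho (projector p)) = projector p.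
Proof.
move=> /affine_domE; rewrite /projector; set z := val (sphere_lift p).
rewrite column_diag => z0; set c := ip _ _ in z0.
have E : affine_vect (rho (kproj (mxvec z))) = c^-1 *: (z *m (rmul (row i z))^T).
  apply/matrixP => j a; rewrite [LHS]mxE; case: unliftP => [j' ->|->].
    by rewrite mxE column_diag column_kproj [RHS]mxE mulrC.
  have Er : (z *m (rmul (row i z))^T) i a = c * e0 0 a.
    have := congr1 (fun M : 'rV[R]_k => M 0 a) (row_column z).
    by rewrite [LHS]mxE => ->; rewrite [LHS]mxE.
  by rewrite [RHS]mxE Er mulrA mulVf // mul1r.
have zz : dot z z = 1 by exact/eqP/(valP (sphere_lift p)).
have c1 : ip (kconj (row i z)) (kconj (row i z)) = c.
  rewrite {1}/kconj ip_mulmxl trmxK /kconj -mulmxA (unit_trmx (rmulT _)) mul_mx_scalar.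
  by rewrite ipZr ip_e mxE !eqxx mulr1.
rewrite /psi E -rmul_kconj mxvecZ kprojZ -mxvec_Jact kproj_Jact c1.
rewrite -ip_mxvec mxvecZ -mxvec_Jact ipZl ipZr ip_Jact c1 ip_mxvec zz.
by rewrite mulr1 !scalerA -[RHS]scale1r; congr (_ *: _); field.
Qed.

Lemma psi_projector y : exists p, projector p = psi y.
Proof.
pose a := (Num.sqrt (dot (affine_vect y) (affine_vect y)))^-1.
have a2 : a ^+ 2 = (dot (affine_vect y) (affine_vect y))^-1.
  by rewrite /a exprVn sqr_sqrtr // ltW // dot_affine_gt0.
have z1 : dot (a *: affine_vect y) (a *: affine_vect y) == 1.
  rewrite -ip_mxvec mxvecZ ipZl ipZr mulrA -expr2 a2 ip_mxvec mulVf //.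
  by rewrite gt_eqF // dot_affine_gt0.
exists (hopf (exist (fun z : vect => is_true (dot z z == 1)) _ z1)).
by rewrite projector_hopf /= mxvecZ kprojZ a2.
Qed.

(** Every [psi y] is a projector in the domain of the chart, so the default value [p0] is never
    taken. *)
Lemma projector_cinv p0 y : projector (cinv (affine_chart R K i) p0 y) = psi y.
Proof.
rewrite /cinv; case: xgetP => [p _ /= [pd pE]|].
  by rewrite -rhoK // -affine_chartE; congr psi; exact: pE.
have [p pE] := psi_projector y.
move/(_ p); case; split; first by apply/affine_domE; rewrite pE column_psi_neq0.
by rewrite affine_chartE pE psiK.
Qed.

End ProjectiveSpace.

(** * Smoothness of the charts, and tangent vectors as matrices *)

Section Charts.
Context {R : realType} {K : scalars} {n : nat}.
Local Notation k := (kdim K).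
Local Notation vect := 'M[R]_(n.+1, k).
Local Notation model := 'M[R]_(n, k).
Local Notation N := (n.+1 * k)%N.
Local Notation space := (proj_space R K n).
Local Notation B := (proj_atlas R K n).

Lemma mxcoord_continuous a b i j : continuous (@mxcoord R a b i j).
Proof. exact: linear_mx_continuous. Qed.

Lemma psi_smooth i l : ndifferentiable_on l [set: model] (@psi R K n i).
Proof.
have oT := @openT model.
have av : ndifferentiable_on l [set: model] (@affine_vect R K n i).
  apply: ndiff_mxP => // j c; rewrite /affine_vect.
  under eq_fun do rewrite mxE.
  case: (unlift i j) => [j'|]; last exact: ndiff_cst.
  exact: (ndiff_linear oT _ (mxcoord_continuous (i := j') (j := c))).
have ave j c : ndifferentiable_on l [set: model] (fun y => @affine_vect R K n i y j c).
  exact: (ndiff_linear_comp oT (mxcoord_continuous (i := j) (j := c)) av).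
have fr a r : ndifferentiable_on l [set: model]
    (fun y => frame (mxvec (@affine_vect R K n i y)) a r).
  under eq_fun do rewrite mxE.
  have mvc : continuous (mxvec : vect -> 'rV[R]_N) by exact: linear_mx_continuous.
  have rJc : continuous (mulmxr (Jact n (e_ a)) : 'rV[R]_N -> 'rV[R]_N).
    exact: linear_mx_continuous.
  have := ndiff_linear_comp oT rJc (ndiff_linear_comp oT mvc av).
  by apply: (ndiff_linear_comp oT (mxcoord_continuous (i := 0) (j := r))).
apply: ndiff_mxP => // r s.
pose D y := dot (@affine_vect R K n i y) (@affine_vect R K n i y).
have -> : (fun y => @psi R K n i y r s) = fun y => (D y)^-1 *
    \sum_a (frame (mxvec (affine_vect i y)) a r * frame (mxvec (affine_vect i y)) a s).
  by apply/funext => y; rewrite /psi !mxE; congr (_ * _); apply: eq_bigr => a _; rewrite mxE.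
apply: ndiffM => //.
  apply: ndiffV => // [y _|]; first by rewrite gt_eqF // dot_affine_gt0.
  by apply: ndiff_sum => // j; apply: ndiff_sum => // c; exact: ndiffM.
by apply: ndiff_sum => // a; exact: ndiffM.
Qed.

Lemma psi_smooth_at i y : smooth_at (@psi R K n i) y.
Proof. by exists setT; split; [split=> //; exact: openT|exact: psi_smooth]. Qed.

Definition chart_region i := [set M : 'M[R]_N | column (K := K) i M i 0 != 0].

Lemma columnE (i : 'I_n.+1) (M : 'M[R]_N) j (c : 'I_k) :
  column i M j c = M (chart_idx i) (mxvec_index j c).
Proof. by rewrite /column mxE mxE. Qed.

Lemma chart_region_open i : open (chart_region i).
Proof.
have -> : chart_region i = (@mxcoord R N N (chart_idx i) (mxvec_index i 0)) @^-1`
    [set x | x != 0].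
  by apply/seteqP; split=> M /=; rewrite /chart_region /= columnE.
by apply: open_comp => [M _|]; [exact: mxcoord_continuous|exact: open_neq].
Qed.

Lemma rho_smooth i l : ndifferentiable_on l (chart_region i) (@rho R K n i).
Proof.
have oC := @chart_region_open i.
have cc j c : ndifferentiable_on l (chart_region i) (fun M => column i M j c : R).
  under eq_fun do rewrite columnE.
  exact: (ndiff_linear oC _ (mxcoord_continuous (i := chart_idx i) (j := mxvec_index j c))).
apply: ndiff_mxP => // j c; under eq_fun do rewrite mxE.
by apply: ndiffM => //; apply: ndiffV.
Qed.

Lemma rho_smooth_at i M : chart_region i M -> smooth_at (@rho R K n i) M.
Proof.
by exists (chart_region i); split; [split=> //; exact: chart_region_open|exact: rho_smooth].
Qed.

Lemma ex_chart (p : space) : exists i,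
  chart_at B p = affine_chart R K i /\ chart_region i (projector p).
Proof.
rewrite /chart_at; case: xgetP => [c _ [[i _ <-] pd]|].
  by exists i; split=> //; exact/affine_domE.
have [i zi] : exists i, row i (val (sphere_lift p)) != 0.
  apply/existsP; rewrite -negb_forall; apply/negP => /forallP z0.
  have := sphere_ip (sphere_lift p).
  have -> : val (sphere_lift p) = 0.
    by apply/row_matrixP => i; rewrite row0; exact/eqP/z0.
  by rewrite linear0 ip0l => /eqP; rewrite eq_sym oner_eq0.
move/(_ (affine_chart R K i)); case; split; first by exists i.
by apply/affine_domE; rewrite column_diag ip_eq0.
Qed.

Definition chart_no (p : space) := projT1 (cid (ex_chart p)).

Lemma chart_atE p : chart_at B p = affine_chart R K (chart_no p).
Proof. by case: (projT2 (cid (ex_chart p))). Qed.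

Lemma chart_noP p : chart_region (chart_no p) (projector p).
Proof. by case: (projT2 (cid (ex_chart p))). Qed.

Lemma coord_atE p q : coord_at B p q = rho (chart_no p) (projector q).
Proof. by rewrite /coord_at chart_atE affine_chartE. Qed.

Lemma cinv_atE p y : projector (cinv_at B p y) = psi (chart_no p) y.
Proof. by rewrite /cinv_at chart_atE projector_cinv. Qed.

Lemma dom_atE p q : dom (chart_at B p) q <-> chart_region (chart_no p) (projector q).
Proof. by rewrite chart_atE; exact: affine_domE. Qed.

Lemma rho_projectorK i p : chart_region i (projector p) ->
  psi i (rho i (projector p)) = projector p.
Proof. by move=> /affine_domE; exact: rhoK. Qed.

Lemma psi_region i y : chart_region i (psi i y).
Proof. exact: column_psi_neq0. Qed.

(** Differentiates [psi i \o rho i \o psi j = psi j], which holds near [y] because the region of the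
    chart is open. *)
Lemma psi_transition i j y v : chart_region i (psi j y) ->
  'd (psi i) (rho i (psi j y)) ('d (rho i \o psi j) y v) = 'd (psi j) y v.
Proof.
move=> ij; have jd : differentiable (psi j) y.
  exact/smooth_at_differentiable/psi_smooth_at.
have id : differentiable (rho i) (psi j y).
  exact/smooth_at_differentiable/rho_smooth_at.
have ijd : differentiable (rho i \o psi j) y by exact: differentiable_comp.
have pd : differentiable (psi i) ((rho i \o psi j) y).
  exact/smooth_at_differentiable/psi_smooth_at.
rewrite -[LHS](diff_compE v ijd pd).
have [//|_ E] := near_is_diff (g := psi i \o (rho i \o psi j)) _ jd; last first.
  exact: (congr1 (@^~ v) E).
have jc : psi j x @[x --> y] --> psi j y by exact: differentiable_continuous.
have reg : \forall x \near y, chart_region i (psi j x).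
  exact: jc _ (open_nbhs_nbhs (conj (@chart_region_open i) ij)).
apply: filterS reg => x /=; have [q <-] := psi_projector j x.
by move=> ?; rewrite rho_projectorK.
Qed.

(** By [psi_transition] this matrix is the same in all charts, so tangent vectors at different
    points live in one space. *)
Definition embed (p : space) (v : model) : 'M[R]_N :=
  'd (psi (chart_no p)) (coord_at B p p) v.

Lemma embedZ p c v : embed p (c *: v) = c *: embed p v.
Proof. exact: linearZ. Qed.

Lemma embed0 p : embed p 0 = 0.
Proof. exact: linear0. Qed.

Lemma psi_coord_at p q : dom (chart_at B p) q -> psi (chart_no p) (coord_at B p q) = projector q.
Proof. by move=> /dom_atE pq; rewrite coord_atE rho_projectorK. Qed.

Lemma dom_chart_at (p : space) : dom (chart_at B p) p.
Proof. by apply/dom_atE; exact: chart_noP. Qed.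

Lemma embed_tangent_from p q v : dom (chart_at B p) q ->
  embed q (tangent_from B p q v) = 'd (psi (chart_no p)) (coord_at B p q) v.
Proof.
move=> pq; rewrite /embed /tangent_from.
have -> : coord_at B q \o cinv_at B p = rho (chart_no q) \o psi (chart_no p).
  by apply/funext => y /=; rewrite coord_atE cinv_atE.
have E := psi_coord_at pq.
have -> : coord_at B q q = rho (chart_no q) (psi (chart_no p) (coord_at B p q)).
  by rewrite E coord_atE.
apply: psi_transition; rewrite E; exact: chart_noP.
Qed.

Lemma embed_tangent_to p q v : dom (chart_at B p) q ->
  'd (psi (chart_no p)) (coord_at B p q) (tangent_to B p q v) = embed q v.
Proof.
move=> pq; rewrite /embed /tangent_to.
have -> : coord_at B p \o cinv_at B q = rho (chart_no p) \o psi (chart_no q).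
  by apply/funext => y /=; rewrite coord_atE cinv_atE.
have E := psi_coord_at (dom_chart_at q).
have -> : coord_at B p q = rho (chart_no p) (psi (chart_no q) (coord_at B q q)).
  by rewrite E coord_atE.
apply: psi_transition; rewrite E; exact/dom_atE.
Qed.

Lemma embed_inj p : injective (embed p).
Proof.
move=> u v; rewrite /embed coord_atE => E.
pose i := chart_no p; pose y := rho i (projector p).
have yE : psi i y = projector p by rewrite rho_projectorK //; exact: chart_noP.
have pd : differentiable (psi i) y by exact/smooth_at_differentiable/psi_smooth_at.
have rd : differentiable (rho i) (psi i y).
  by apply/smooth_at_differentiable/rho_smooth_at; rewrite yE; exact: chart_noP.
have K1 w : 'd (rho i) (psi i y) ('d (psi i) y w) = w.
  rewrite -(diff_compE w pd rd).
  have -> : rho i \o psi i = id :> (model -> model).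
    by apply/funext => x; exact: psiK.
  by have [_ ->] := is_diff_id y.
by rewrite -[u]K1 -[v]K1; congr ('d _ _ _).
Qed.

(** The linearization at [Q] of the equations of a projector: symmetric, linear over the scalars,
    idempotent. *)
Definition tangent_mx (Q M : 'M[R]_N) : Prop :=
  [/\ M^T = M, forall i, M *m Jact n (e_ i) = Jact n (e_ i) *m M & M = Q *m M + M *m Q].

Lemma projectorT (p : space) : (projector p)^T = projector p.
Proof. exact: kprojT. Qed.

Lemma projector_idem (p : space) : projector p *m projector p = projector p.
Proof. exact/kproj_idem/sphere_ip. Qed.

Lemma projector_commutes (p : space) i :
  projector p *m Jact n (e_ i) = Jact n (e_ i) *m projector p.
Proof. exact: kproj_commutes. Qed.

Lemma tangent_of_curve (V : normedModType R) (f df : V -> 'M[R]_N) x v :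
  is_diff x f df -> (\forall y \near x, exists p : space, f y = projector p) ->
  tangent_mx (f x) (df v).
Proof.
move=> fd fp.
split=> [|i|].
- apply: (is_diff_linear_eq (L1 := @trmx R N N) (L2 := idfun) v fd).
  by apply: filterS fp => y [p ->]; exact: projectorT.
- apply: (is_diff_linear_eq (L1 := mulmxr (Jact n (e_ i))) (L2 := mulmx (Jact n (e_ i))) v fd).
  by apply: filterS fp => y [p ->] /=; exact: projector_commutes.
- rewrite addrC; apply: (is_diff_near_eq v fd (is_diff_mulmx fd fd)).
  by apply: filterS fp => y [p ->]; rewrite projector_idem.
Qed.

Lemma embed_tangent_mx p v : tangent_mx (projector p) (embed p v).
Proof.
rewrite -{1}(psi_coord_at (dom_chart_at p)).
have pd := differentiableP (smooth_at_differentiable (psi_smooth_at (chart_no p) (coord_at B p p))).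
apply: (tangent_of_curve v pd).
have all y : exists q : space, psi (chart_no p) y = projector q.
  by have [q <-] := psi_projector (chart_no p) y; exists q.
exact: (@filterE _ (nbhs (coord_at B p p)) _ _ all).
Qed.

End Charts.

(** * Great circles, and the metric as a trace form *)

Section GreatCircles.
Context {R : realType} {K : scalars} {n : nat}.
Local Notation k := (kdim K).
Local Notation vect := 'M[R]_(n.+1, k).
Local Notation model := 'M[R]_(n, k).
Local Notation N := (n.+1 * k)%N.
Local Notation space := (proj_space R K n).
Local Notation B := (proj_atlas R K n).

Lemma JactTE (i : 'I_k) : (Jact n (e_ i) : 'M[R]_N) *m (Jact n (e_ i))^T = 1%:M.
Proof. by rewrite Jact_unit ip_e mxE !eqxx. Qed.

Lemma tr_tangent_mx (x : 'rV[R]_N) (M M' : 'M[R]_N) :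
  tangent_mx (K := K) (kproj x) M -> tangent_mx (K := K) (kproj x) M' ->
  \tr (M *m M') = 2 * k%:R * ip (x *m M) (x *m M').
Proof.
move=> [MT MJ _] [M'T M'J M'Q].
exact: (tr_tangent (J := fun i => Jact n (e_ i)) (z := x) erefl JactTE MT M'T MJ M'J M'Q).
Qed.

Section Circle.
Variables (x : 'rV[R]_N) (X : 'M[R]_N).
Hypothesis x1 : ip x x = 1.
Hypothesis tX : tangent_mx (K := K) (kproj x) X.
Hypothesis w1 : ip (x *m X) (x *m X) = 1.
Local Notation Q := (kproj (K := K) x).

Lemma tangent_lift_proj M : tangent_mx (K := K) Q M -> x *m M *m Q = 0.
Proof.
move=> [_ _ MQ]; rewrite -{1}(mul_kproj (K := K) x1) -2!mulmxA (mulmxA Q).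
by rewrite (tangent_corner (kproj_idem x1) MQ) mulmx0.
Qed.

Lemma tangent_lift_orth M : tangent_mx (K := K) Q M -> ip (x *m M) x = 0.
Proof.
move=> tM; rewrite -{2}(mul_kproj (K := K) x1) -(kprojT (K := K) x) -ip_mulmxl.
by rewrite tangent_lift_proj // ip0l.
Qed.

Lemma frame_mulmx (M : 'M[R]_N) : (forall i : 'I_k, M *m Jact n (e_ i) = Jact n (e_ i) *m M) ->
  frame (K := K) (x *m M) = frame x *m M.
Proof.
by move=> MJ; apply/row_matrixP => i; rewrite row_mul !rowK -mulmxA MJ mulmxA.
Qed.

(** The frame of [x *m X] is orthonormal, which settles the block of [X *m X] on the range of [Q].
    As [X] exchanges that range and its complement, its square preserves it. *)
Lemma unit_tangent : X *m X *m Q = Q.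
Proof.
have [XT XJ XQ] := tX; have QXQ := tangent_corner (kproj_idem x1) XQ.
have QXXQ : Q *m X *m X *m Q = Q.
  have E : frame x *m X *m (frame x *m X)^T = 1%:M by rewrite -frame_mulmx // frame_unit w1.
  transitivity ((frame x)^T *m (frame (K := K) x *m X *m (frame x *m X)^T) *m frame x).
    by rewrite trmx_mul XT /kproj !mulmxA.
  by rewrite E mulmx1.
rewrite {1}XQ !mulmxDl QXXQ -[RHS]addr0; congr (_ + _).
by rewrite -2!mulmxA (mulmxA Q X Q) QXQ mulmx0.
Qed.

Definition circle_vec (s : R) : 'rV[R]_N := cos s *: x + sin s *: (x *m X).

Lemma circle_vec1 s : ip (circle_vec s) (circle_vec s) = 1.
Proof.
rewrite /circle_vec !(ipDl, ipDr, ipZl, ipZr) x1 w1 [ip x _]ipC tangent_lift_orth //.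
by rewrite !mulr0 addr0 add0r !mulr1 -!expr2 cos2Dsin2.
Qed.

Lemma circle_subproof s : dot (vec_mx (circle_vec s) : vect) (vec_mx (circle_vec s)) == 1.
Proof. by rewrite -ip_mxvec vec_mxK circle_vec1. Qed.

Definition circle (s : R) : sphere R K n :=
  exist (fun z : vect => is_true (dot z z == 1)) _ (circle_subproof s).

Lemma projector_circle s : projector (hopf (circle s)) = double_angle Q X (X *m X) s.
Proof.
have [XT XJ XQ] := tX.
rewrite projector_hopf /= vec_mxK /kproj /circle_vec.
have -> : frame (K := K) (cos s *: x + sin s *: (x *m X)) =
    cos s *: frame x + sin s *: (frame x *m X).
  rewrite -frame_mulmx // -!frameZ; apply/row_matrixP => i.
  by rewrite linearD /= !rowK mulmxDl.
apply/esym.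
exact: (double_angle_frame (J := fun i => Jact n (e_ i)) (z := x) erefl XT XQ unit_tangent erefl).
Qed.

End Circle.

Definition lift_vec (p : space) : 'rV[R]_N := mxvec (val (sphere_lift p)).

Lemma lift_vec1 p : ip (lift_vec p) (lift_vec p) = 1.
Proof. exact: sphere_ip. Qed.

Lemma great_circle p X : tangent_mx (K := K) (projector p) X ->
  ip (lift_vec p *m X) (lift_vec p *m X) = 1 ->
  exists c : R -> sphere R K n,
    [/\ c 0 = sphere_lift p,
        forall s, mxvec (val (c s)) = cos s *: lift_vec p + sin s *: (lift_vec p *m X) &
        forall s, projector (hopf (c s)) = double_angle (projector p) X (X *m X) s].
Proof.
move=> tX w1; exists (circle (lift_vec1 p) tX w1); split=> [|s|s].
- by apply: val_inj => /=; rewrite /circle_vec cos0 sin0 scale1r scale0r addr0 mxvecK.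
- by rewrite /= vec_mxK.
- exact: projector_circle.
Qed.

Lemma double_angle0 (A X Y : 'M[R]_N) : double_angle A X Y 0 = A.
Proof.
by rewrite /double_angle cos0 sin0 mul0r expr1n expr0n /= subr0 scale1r !scale0r !addr0.
Qed.

Lemma near_projector (gam : R -> space) t (q : R -> 'M[R]_N) :
  (forall s, projector (gam s) = q s) -> {for t, continuous q} ->
  \forall s \near t, dom (chart_at B (gam t)) (gam s).
Proof.
move=> gq qc; have reg : chart_region (chart_no (gam t)) (q t).
  by rewrite -gq; exact: chart_noP.
have nreg : \forall s \near t, chart_region (chart_no (gam t)) (q s).
  exact: qc _ (open_nbhs_nbhs (conj (@chart_region_open R K n _) reg)).
by apply: filterS nreg => s; rewrite -gq => ?; apply/dom_atE.
Qed.

Lemma is_diff_coord_at (gam : R -> space) t (dq : R -> 'M[R]_N) :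
  is_diff t (@projector R K n \o gam) dq ->
  differentiable (coord_at B (gam t) \o gam) t /\
  embed (gam t) (velocity B gam t) = dq 1.
Proof.
move=> qd; have [qdif _] := qd; set i := chart_no (gam t).
have reg : chart_region i (projector (gam t)) by exact: chart_noP.
have cE : coord_at B (gam t) \o gam = rho i \o (@projector R K n \o gam).
  by apply/funext => s /=; rewrite coord_atE.
have rd : differentiable (rho i) (projector (gam t)).
  exact/smooth_at_differentiable/rho_smooth_at.
have cd : differentiable (coord_at B (gam t) \o gam) t.
  by rewrite cE; exact: differentiable_comp.
split=> //; rewrite /velocity derive1E' // /embed.
have pd : differentiable (psi i) ((coord_at B (gam t) \o gam) t).
  exact/smooth_at_differentiable/psi_smooth_at.
rewrite -[LHS](diff_compE (1 : R) cd pd).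
have qn : \forall s \near t, (@projector R K n \o gam) s =
    (psi i \o (coord_at B (gam t) \o gam)) s.
  have := near_projector (fun s => erefl (projector (gam s))) (differentiable_continuous qdif).
  by apply: filterS => s ds /=; rewrite psi_coord_at.
by have [_ E] := is_diff_near qn qd; exact: (congr1 (@^~ (1 : R)) E).
Qed.

Lemma tangent_mxZ (Q M : 'M[R]_N) c : tangent_mx (K := K) Q M -> tangent_mx (K := K) Q (c *: M).
Proof.
move=> [MT MJ MQ]; split=> [|i|].
- by rewrite [LHS]linearZ /= MT.
- by rewrite -scalemxAl MJ scalemxAr.
- by rewrite -scalemxAl -scalemxAr -scalerDr -MQ.
Qed.

Lemma tangent_lift_eq0 p M : tangent_mx (K := K) (projector p) M ->
  lift_vec p *m M = 0 -> M = 0.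
Proof.
move=> [MT MJ MQ] xM.
have QM : projector p *m M = 0.
  have F0 : frame (R := R) (K := K) (n := n) 0 = 0.
    by apply/row_matrixP => i; rewrite rowK mul0mx row0.
  by rewrite /projector /kproj -mulmxA -frame_mulmx // xM F0 mulmx0.
by rewrite MQ QM add0r -[LHS]trmxK trmx_mul MT projectorT QM trmx0.
Qed.

(** Realizing [X] as the velocity of a great circle takes the place of a dimension count of the
    tangent space. *)
Lemma embed_surj_unit p X : tangent_mx (K := K) (projector p) X ->
  ip (lift_vec p *m X) (lift_vec p *m X) = 1 ->
  exists2 c : R -> sphere R K n,
    [/\ c 0 = sphere_lift p,
        forall s, mxvec (val (c s)) = cos s *: lift_vec p + sin s *: (lift_vec p *m X) &
        forall s, projector (hopf (c s)) = double_angle (projector p) X (X *m X) s] &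
    embed p (velocity B (@hopf R K n \o c) 0) = X.
Proof.
move=> tX w1; have [c [c0 cs cp]] := great_circle tX w1; exists c => //.
have D := is_diff_double_angle (projector p) X (X *m X) 1 0.
have qE : (@projector R K n \o (@hopf R K n \o c)) =
    fun s => double_angle (projector p) X (X *m X) (1 * s).
  by apply/funext => s; rewrite /= mul1r cp.
rewrite -qE in D; have [_] := is_diff_coord_at D.
by rewrite /= c0 hopf_lift mulr1 mulr0 scale1r double_angle0.
Qed.

Lemma normalize_tangent p M : tangent_mx (K := K) (projector p) M -> M != 0 ->
  exists r X, [/\ r != 0, M = r *: X, tangent_mx (K := K) (projector p) X &
    ip (lift_vec p *m X) (lift_vec p *m X) = 1].
Proof.
move=> tM M0; set w := lift_vec p *m M.
have w0 : 0 < ip w w.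
  by apply: ip_gt0; apply: contra M0 => /eqP/(tangent_lift_eq0 tM) ->.
pose r := Num.sqrt (ip w w).
have r0 : r != 0 by rewrite gt_eqF // sqrtr_gt0.
exists r, (r^-1 *: M); split=> //; first by rewrite scalerA mulfV // scale1r.
  exact: tangent_mxZ.
rewrite -scalemxAr ipZl ipZr mulrA -expr2 exprVn sqr_sqrtr ?ip_ge0 // mulVf //.
by rewrite gt_eqF.
Qed.

Lemma embed_surj (p : space) M : tangent_mx (K := K) (projector p) M -> exists v, embed p v = M.
Proof.
move=> tM; have [->|M0] := eqVneq M 0.
  by exists 0; rewrite embed0.
have [r [X [r0 -> tX w1]]] := normalize_tangent tM M0.
have [c _ cX] := embed_surj_unit tX w1.
by exists (r *: velocity B (@hopf R K n \o c) 0); rewrite embedZ cX.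
Qed.

Lemma is_diff_circle (p : space) X (c : R -> sphere R K n) :
  (forall s, mxvec (val (c s)) = cos s *: lift_vec p + sin s *: (lift_vec p *m X)) ->
  is_diff (0 : R) (fun t => val (c t) : vect) (fun v => v *: vec_mx (lift_vec p *m X)).
Proof.
move=> cs; set x := lift_vec p in cs *; set w := x *m X in cs *.
have D : is_diff (0 : R) (fun s : R => cos (1 * s) *: x + sin (1 * s) *: w) (fun v => v *: w).
  have Dc := is_diff_scale (is_diff_cosZ 1 0) (is_diff_cst x (0 : R)).
  have Ds := is_diff_scale (is_diff_sinZ 1 0) (is_diff_cst w (0 : R)).
  apply: is_diff_eq (is_diffD Dc Ds) _; apply/funext => v.
  by rewrite !fctE /= mulr0 sin0 cos0 oppr0 !mul0r !mul1r !scale0r !scaler0 !addr0 add0r.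
have vc : continuous (vec_mx : 'rV[R]_N -> vect) by exact: linear_mx_continuous.
have := is_diff_linear_comp vc D.
have -> : vec_mx \o (fun s : R => cos (1 * s) *: x + sin (1 * s) *: w) = fun t => val (c t).
  by apply/funext => s /=; rewrite mul1r -cs mxvecK.
by move/is_diff_eq; apply; apply/funext => v /=; rewrite linearZ.
Qed.

(** A curve in the fibre is fixed by the projector, so its velocity lies in the line, to which the
    lift of a tangent matrix is orthogonal. *)
Lemma horizontal_tangent (p : space) M : tangent_mx (K := K) (projector p) M ->
  horizontal (sphere_lift p) (vec_mx (lift_vec p *m M)).
Proof.
move=> tM c cd c0 cp; rewrite -ip_mxvec vec_mxK.
have cQ t : mxvec (val (c t)) = mxvec (val (c t)) *m projector p.
  have -> : projector p = projector (hopf (c t)) by rewrite cp hopf_lift.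
  by rewrite projector_hopf mul_kproj // sphere_ip.
have dc : is_diff (0 : R) (fun t => val (c t) : vect) (fun v => v *: speed0 c).
  have cd' := (derivable1_diffP _ _).1 cd.
  by apply: DiffDef => //; rewrite diff1E.
have mc : continuous (mxvec : vect -> 'rV[R]_N) by exact: linear_mx_continuous.
have Qc : continuous (mulmxr (projector p) : 'rV[R]_N -> 'rV[R]_N) by exact: linear_mx_continuous.
have [_ E1] := is_diff_linear_comp mc dc.
have [_ E2] := is_diff_linear_comp Qc (is_diff_linear_comp mc dc).
have fE : mulmxr (projector p) \o (mxvec \o (fun t => val (c t) : vect)) =
          mxvec \o (fun t => val (c t) : vect) by apply/funext => t /=; rewrite -cQ.
rewrite fE in E2.
have := congr1 (@^~ (1 : R)) (etrans (esym E1) E2); rewrite /= scale1r => sQ.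
by rewrite sQ ipC ip_mulmxl projectorT ipC tangent_lift_proj ?ip0l // lift_vec1.
Qed.

Variable g : space -> model -> model -> R.
Hypothesis g_metric : riemannian_metric B g.
Hypothesis g_hopf : hopf_riemannian_submersion g.

Lemma metric_unit p u v :
  ip (lift_vec p *m embed p u) (lift_vec p *m embed p u) = 1 ->
  ip (lift_vec p *m embed p v) (lift_vec p *m embed p v) = 1 ->
  g p u v = ip (lift_vec p *m embed p u) (lift_vec p *m embed p v).
Proof.
move=> u1 v1.
have [c [c0 cs _] cv] := embed_surj_unit (embed_tangent_mx p u) u1.
have [c' [c'0 c's _] c'v] := embed_surj_unit (embed_tangent_mx p v) v1.
have speedE (f : R -> sphere R K n) w :
    (forall s, mxvec (val (f s)) = cos s *: lift_vec p + sin s *: (lift_vec p *m embed p w)) ->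
    speed0 f = vec_mx (lift_vec p *m embed p w) /\ sphere_curve f.
  move=> /is_diff_circle[fd E]; split; last exact/derivable1_diffP.
  by rewrite /speed0 derive1E' // E scale1r.
have [sc dc] := speedE _ _ cs; have [sc' dc'] := speedE _ _ c's.
have := g_hopf dc dc'; rewrite c0 c'0 => /(_ erefl).
rewrite sc sc' => /(_ (horizontal_tangent (embed_tangent_mx p u))
  (horizontal_tangent (embed_tangent_mx p v))).
rewrite hopf_lift (embed_inj cv) (embed_inj c'v) => ->.
by rewrite -ip_mxvec !vec_mxK.
Qed.

(** Great circles determine [g] on unit vectors by the submersion property, and homogeneity does the
    rest; the factor is that of [tr_tangent]. *)
Lemma metricE p u v : g p u v = (2 * k%:R)^-1 * \tr (embed p u *m embed p v).
Proof.
have [gl gs _ _] := g_metric.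
have g0 p' w : g p' 0 w = 0.
  by have := gl p' 1 0 0 w; rewrite scaler0 addr0 mul1r => /eqP;
    rewrite addrC -subr_eq subrr eq_sym => /eqP.
have gZ p' a w w' : g p' (a *: w) w' = a * g p' w w'.
  by have := gl p' a w 0 w'; rewrite addr0 g0 addr0.
rewrite (tr_tangent_mx (embed_tangent_mx p u) (embed_tangent_mx p v)).
rewrite mulKf ?mulf_neq0 ?pnatr_eq0 //.
have unitP w : w != 0 -> exists r w', w = r *: w' /\
    ip (lift_vec p *m embed p w') (lift_vec p *m embed p w') = 1.
  move=> w0; have ew0 : embed p w != 0.
    by apply: contra w0 => /eqP ew; apply/eqP/(@embed_inj _ _ _ p); rewrite ew embed0.
  have [r [X [r0 E tX X1]]] := normalize_tangent (embed_tangent_mx p w) ew0.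
  exists r, (r^-1 *: w); split; first by rewrite scalerA mulfV // scale1r.
  have -> : embed p (r^-1 *: w) = X => //.
  by rewrite embedZ E scalerA mulVf // scale1r.
have [->|/unitP[r [u' [-> u1]]]] := eqVneq u 0; first by rewrite g0 embed0 mulmx0 ip0l.
have [->|/unitP[r' [v' [-> v1]]]] := eqVneq v 0.
  by rewrite gs g0 embed0 mulmx0 ipC ip0l.
rewrite gZ gs gZ gs !embedZ -!scalemxAr ipZl ipZr.
by rewrite metric_unit.
Qed.

End GreatCircles.

(** * Geodesics *)

Section Curves.
Context {R : realType} {N : nat}.
Implicit Types q : R -> 'M[R]_N.

Lemma diff0_constant q : (forall s, is_diff s q (fun=> 0)) -> forall s, q s = q 0.
Proof.
move=> qd s; apply/matrixP => i j.
apply: (@is_derive_0_is_cst R (fun s => q s i j)) => x.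
have := is_diff_is_derive ((is_diff_mxP _ _ _).1 (qd x) i j).
by rewrite mxE.
Qed.

Lemma tr_sqr_eq0 (M : 'M[R]_N) : M^T = M -> \tr (M *m M) = 0 -> M = 0.
Proof.
move=> MT M0; apply/row_matrixP => i; apply/eqP; rewrite row0 -ip_eq0 -ip_rows MT.
move: M0; rewrite /mxtrace => /psumr_eq0P -> // j _.
by rewrite -{2}MT ip_rows ip_ge0.
Qed.

Lemma tr_corner (Q M : 'M[R]_N) : Q *m Q = Q -> M = Q *m M + M *m Q -> \tr (Q *m M) = 0.
Proof.
move=> QQ MQ; have := tangent_corner QQ MQ => /(congr1 mxtrace).
by rewrite mxtrace_mulC mulmxA QQ mxtrace0.
Qed.

(* The momentum W = q' q - q q' of such a curve is constant, and q' = [W, q] is a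
   linear equation whose flow preserves the trace form. *)
Lemma projector_curve_unique q1 q1' q1'' q2 q2' q2'' :
  (forall s, is_diff s q1 (fun v => v *: q1' s)) ->
  (forall s, is_diff s q1' (fun v => v *: q1'' s)) ->
  (forall s, is_diff s q2 (fun v => v *: q2' s)) ->
  (forall s, is_diff s q2' (fun v => v *: q2'' s)) ->
  (forall s, q1 s *m q1'' s = q1'' s *m q1 s) ->
  (forall s, q2 s *m q2'' s = q2'' s *m q2 s) ->
  (forall s, q1 s *m q1 s = q1 s) -> (forall s, q2 s *m q2 s = q2 s) ->
  (forall s, (q1 s)^T = q1 s) -> (forall s, (q2 s)^T = q2 s) ->
  (forall s, q1' s = q1 s *m q1' s + q1' s *m q1 s) ->
  (forall s, q2' s = q2 s *m q2' s + q2' s *m q2 s) ->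
  q1 0 = q2 0 -> q1' 0 = q2' 0 -> forall s, q1 s = q2 s.
Proof.
move=> d1 dd1 d2 dd2 c1 c2 i1 i2 s1 s2 t1 t2 q0 q'0.
have momentum q q' q'' : (forall s, is_diff s q (fun v => v *: q' s)) ->
    (forall s, is_diff s q' (fun v => v *: q'' s)) ->
    (forall s, q s *m q'' s = q'' s *m q s) ->
    forall s, q' s *m q s - q s *m q' s = q' 0 *m q 0 - q 0 *m q' 0.
  move=> dq dq' cq; pose F s := q' s *m q s - q s *m q' s.
  suff Fd s : is_diff s F (fun=> 0) by exact: diff0_constant Fd.
  have D := is_diff_sub (is_diff_mulmx (dq' s) (dq s)) (is_diff_mulmx (dq s) (dq' s)).
  apply: (is_diff_ext D).
  move=> v; rewrite -!scalemxAl -!scalemxAr cq.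
  by rewrite opprD addrA addrK subrr.
have linear_eq q q' W : (forall s, q s *m q s = q s) ->
    (forall s, q' s = q s *m q' s + q' s *m q s) ->
    (forall s, q' s *m q s - q s *m q' s = W) ->
    forall s, q' s = W *m q s - q s *m W.
  move=> qi qt qW s; rewrite -(qW s) mulmxBl mulmxBr -!(mulmxA _ (q s) (q s)) qi.
  rewrite !(mulmxA (q s)) qi (tangent_corner (qi s) (qt s)) subr0 sub0r opprK addrC.
  exact: qt.
have [W W1] : exists W, q1' 0 *m q1 0 - q1 0 *m q1' 0 = W by eexists.
have e1 := linear_eq q1 q1' W i1 t1
  (fun s => etrans (momentum _ _ _ d1 dd1 c1 s) W1).
have WE : q2' 0 *m q2 0 - q2 0 *m q2' 0 = W by rewrite -W1 q0 q'0.
have e2 := linear_eq q2 q2' W i2 t2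
  (fun s => etrans (momentum _ _ _ d2 dd2 c2 s) WE).
pose d s := q1 s - q2 s.
have dd s : is_diff s d (fun v => v *: (W *m d s - d s *m W)).
  apply: is_diff_ext (is_diff_sub (d1 s) (d2 s)) _ => v.
  rewrite -scalerBr e1 e2 /d; congr (_ *: _); rewrite [in RHS]mulmxBr [in RHS]mulmxBl.
  by rewrite !opprB addrACA [RHS]addrACA; congr (_ + _); rewrite addrC.
have trc : continuous (mxtrace : 'M[R]_N -> R).
  exact: (@linear_mx_continuous R R N N (@mxtrace R N)).
have cst0 s : \tr (d s *m d s) = 0.
  have := @is_derive_0_is_cst R (fun s => \tr (d s *m d s)) s 0.
  have -> : \tr (d 0 *m d 0) = 0 by rewrite /d q0 subrr mulmx0 mxtrace0.
  apply=> x; have := is_diff_linear_comp trc (is_diff_mulmx (dd x) (dd x)).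
  move/is_diff_is_derive; rewrite /= !scale1r mxtraceD [\tr (d x *m _)]mxtrace_mulC.
  rewrite mulmxBl linearB /= -[d x *m W *m d x]mulmxA [\tr (d x *m _)]mxtrace_mulC.
  by rewrite subrr addr0.
move=> s; apply/eqP; rewrite -subr_eq0; apply/eqP.
by apply: tr_sqr_eq0 (cst0 s); rewrite /d linearB /= s1 s2.
Qed.

(* The off-diagonal part of D with respect to Q is itself tangent, hence an
   admissible test direction. *)
Lemma normal_commutes (Q D : 'M[R]_N) : Q *m Q = Q -> Q^T = Q -> D^T = D ->
  \tr (D *m (D *m Q + Q *m D - 2 *: (Q *m D *m Q))) = 0 -> Q *m D = D *m Q.
Proof.
move=> QQ QT DT.
set M := D *m Q + Q *m D - 2 *: (Q *m D *m Q) => trDM.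
have MT : M^T = M.
  rewrite /M linearB linearD linearZ /= !trmx_mul DT QT mulmxA addrC.
  by rewrite [Q *m D + _]addrC addrC.
have QM : Q *m M = Q *m D - Q *m D *m Q.
  rewrite /M mulmxBr mulmxDr -scalemxAr !mulmxA QQ.
  by apply/matrixP => i j; move: (Q *m D *m Q) (Q *m D) => a b; rewrite !mxE; ring.
have MQ : M *m Q = D *m Q - Q *m D *m Q.
  rewrite /M mulmxBl mulmxDl -scalemxAl -!(mulmxA _ Q Q) QQ.
  by apply/matrixP => i j; move: (Q *m D *m Q) (D *m Q) => a b; rewrite !mxE; ring.
have Mt : M = Q *m M + M *m Q.
  rewrite QM MQ /M; apply/matrixP => i j.
  by move: (Q *m D) (D *m Q) (Q *m D *m Q) => a b c; rewrite !mxE; ring.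
have M0 : M = 0.
  apply: tr_sqr_eq0 => //.
  have -> : M *m M = D *m (Q *m M) + Q *m D *m M - 2 *: (Q *m D *m (Q *m M)).
    by rewrite {1}/M mulmxBl mulmxDl -scalemxAl !mulmxA.
  rewrite linearB /= mxtraceD mxtraceZ -[Q *m D *m M]mulmxA [\tr (Q *m (D *m M))]mxtrace_mulC.
  rewrite -[Q *m D *m (Q *m M)]mulmxA [\tr (Q *m (D *m _))]mxtrace_mulC.
  rewrite -[D *m (Q *m M) *m Q]mulmxA (tangent_corner QQ Mt) mulmx0 mxtrace0 mulr0 subr0.
  by rewrite -[D *m M *m Q]mulmxA -mxtraceD -mulmxDr -Mt.
have QDQ : Q *m D = Q *m D *m Q by apply/eqP; rewrite -subr_eq0 -QM M0 mulmx0.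
have DQQ : D *m Q = Q *m D *m Q by apply/eqP; rewrite -subr_eq0 -MQ M0 mul0mx.
by rewrite QDQ DQQ.
Qed.

End Curves.

(** * The geodesic equation and the exponential map *)

Section Geodesics.
Context {R : realType} {K : scalars} {n : nat}.
Local Notation k := (kdim K).
Local Notation model := 'M[R]_(n, k).
Local Notation N := (n.+1 * k)%N.
Local Notation space := (proj_space R K n).
Local Notation B := (proj_atlas R K n).
Local Notation prj := (@projector R K n).
Variable g : space -> model -> model -> R.
Hypothesis g_metric : riemannian_metric B g.
Hypothesis g_hopf : hopf_riemannian_submersion g.
Let kappa : R := (2 * k%:R)^-1.

Lemma psi_twice i y : twice_differentiable (@psi R K n i) y.
Proof. exact/smooth_at_twice/psi_smooth_at. Qed.

Lemma local_metricE p u v : local_metric B g p u v =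
  fun y => kappa * \tr ('d (psi (chart_no p)) y u *m 'd (psi (chart_no p)) y v).
Proof.
apply/funext => y; rewrite /local_metric /=.
set q := cinv_at B p y.
have qE : projector q = psi (chart_no p) y by exact: cinv_atE.
have pq : dom (chart_at B p) q by apply/dom_atE; rewrite qE; exact: psi_region.
have cq : coord_at B p q = y by rewrite coord_atE qE psiK.
rewrite (metricE g_metric g_hopf).
by rewrite (embed_tangent_from u pq) (embed_tangent_from v pq) cq.
Qed.

Lemma mxtrace_continuous : continuous (mxtrace : 'M[R]_N -> R).
Proof. exact: (@linear_mx_continuous R R N N (@mxtrace R N)). Qed.

Lemma derive_local_metric p u v w :
  let y := coord_at B p p in let f := psi (chart_no p) in
  'D_w (local_metric B g p u v) y =
  kappa * (\tr (diff2 f y w u *m 'd f y v) + \tr ('d f y u *m diff2 f y w v)).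
Proof.
move=> y f; rewrite local_metricE.
have [_ f2] := psi_twice (chart_no p) y.
have D := is_diff_linear_comp mxtrace_continuous
  (is_diff_mulmx (differentiableP (f2 u)) (differentiableP (f2 v))).
have kd := is_diff_mulrC kappa D.
have E : (fun z => kappa * \tr ('d f z u *m 'd f z v)) =
    fun z => (mxtrace \o (fun y => 'd f y u *m 'd f y v)) z * kappa.
  by apply/funext => z; rewrite mulrC.
rewrite E deriveE; last by case: kd.
have [_ kE] := kd; rewrite (congr1 (@^~ w) kE) /= mulrC mxtraceD.
by [].
Qed.

(** The usual formula for a metric induced by a parametrization: the terms containing mixed
    derivatives cancel by symmetry of the second differential. *)
Lemma christoffelE p u v :
  christoffel B g p u u v =
  kappa * \tr (diff2 (psi (chart_no p)) (coord_at B p p) u u *m embed p v).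
Proof.
rewrite /christoffel !derive_local_metric -/(embed p v) -/(embed p u).
rewrite (schwarz v u (psi_twice _ _)).
move: (diff2 _ _ u u) (diff2 _ _ u v) => a b.
have C := mxtrace_mulC b (embed p u); rewrite C; clear C.
move: (\tr _) (\tr _) => c d.
by field.
Qed.

Lemma derive1_diff (V : normedModType R) (f : R -> V) t :
  twice_differentiable f t ->
  derive1 f t = 'd f t 1 /\ derive1 (derive1 f) t = diff2 f t 1 1.
Proof.
move=> [fd f2]; split; first by rewrite derive1E' //; exact: nbhs_singleton fd.
have dn : \forall s \near t, 'd f s 1 = derive1 f s.
  by apply: filterS fd => s fs; rewrite derive1E'.
have [dd dE] := near_is_diff dn (f2 1).
have C := congr1 (@^~ (1 : R)) dE.
by rewrite (derive1E' dd); exact: C.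
Qed.

(** By the chain rule the second derivative of [psi \o x] has one term in [x''] and one quadratic in
    [x']. Paired with a tangent vector they give the two terms of the geodesic equation. *)
Lemma curve_acceleration gam t : smooth_curve B gam ->
  twice_differentiable (prj \o gam) t /\ forall v,
  let x := coord_at B (gam t) \o gam in
  g (gam t) (derive1 (derive1 x) t) v + christoffel B g (gam t) (derive1 x t) (derive1 x t) v =
  kappa * \tr (diff2 (prj \o gam) t 1 1 *m embed (gam t) v).
Proof.
move=> /(_ t)[dn xs]; set x := coord_at B (gam t) \o gam in xs *.
have x2 := smooth_at_twice xs.
have qn : \forall s \near t, (psi (chart_no (gam t)) \o x) s = (prj \o gam) s.
  by apply: filterS dn => s ds; rewrite /= /x /= psi_coord_at.
have [c2 cE] := twice_differentiable_comp (psi_twice (chart_no (gam t)) (x t)) x2.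
have [q2 qE] := twice_differentiable_near qn c2.
split=> // v y; rewrite /y.
have [-> ->] := derive1_diff x2.
rewrite (metricE g_metric g_hopf) christoffelE -mulrDr -mxtraceD -mulmxDl.
have E2 := etrans (qE 1 1) (cE 1 1).
congr (_ * \tr (_ *m _)); exact: (etrans (addrC _ _) (esym E2)).
Qed.

Lemma geodesic_normal gam : geodesic B g gam -> forall t M,
  tangent_mx (K := K) (prj (gam t)) M -> \tr (diff2 (prj \o gam) t 1 1 *m M) = 0.
Proof.
move=> [gs geq] t M /embed_surj[v <-].
have [_ /(_ v) /= E] := curve_acceleration t gs.
have := geq t v; rewrite /= E => /eqP.
by rewrite mulf_eq0 invr_eq0 mulf_eq0 !pnatr_eq0 /= => /eqP.
Qed.

Lemma normal_geodesic gam : smooth_curve B gam ->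
  (forall t v, \tr (diff2 (prj \o gam) t 1 1 *m embed (gam t) v) = 0) -> geodesic B g gam.
Proof.
move=> gs gn; split=> // t v x.
have [_ /(_ v) E] := curve_acceleration t gs.
by rewrite E gn mulr0.
Qed.

Lemma curve_data gam : geodesic B g gam ->
  [/\ forall s, is_diff s (prj \o gam) (fun v => v *: 'd (prj \o gam) s 1),
      forall s, is_diff s (fun y => 'd (prj \o gam) y 1) (fun v => v *: diff2 (prj \o gam) s 1 1),
      forall s, prj (gam s) *m diff2 (prj \o gam) s 1 1 = diff2 (prj \o gam) s 1 1 *m prj (gam s) &
      forall s, tangent_mx (K := K) (prj (gam s)) ('d (prj \o gam) s 1)].
Proof.
move=> gg; have [gs _] := gg; set q := prj \o gam.
have q2 t : twice_differentiable q t by case: (curve_acceleration t gs).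
have lin1 (V : normedModType R) (f : R -> V) s : differentiable f s ->
    is_diff s f (fun v => v *: 'd f s 1).
  move=> fd; apply: is_diff_ext (differentiableP fd) _ => v.
  by rewrite -{1}[v]mulr1 linearZ.
have d1 s : is_diff s q (fun v => v *: 'd q s 1).
  by apply: lin1; exact: nbhs_singleton (q2 s).1.
have d2 s : is_diff s (fun y => 'd q y 1) (fun v => v *: diff2 q s 1 1).
  by apply: lin1; exact: (q2 s).2.
have t1 s : tangent_mx (K := K) (prj (gam s)) ('d q s 1).
  have := tangent_of_curve (1 : R) (d1 s); rewrite scale1r; apply.
  by apply: (@filterE _ (nbhs s)) => y; exists (gam y).
split=> // s; set D := diff2 q s 1 1.
have DT : D^T = D.
  have := is_diff_linear_eq (L1 := @trmx R N N) (L2 := idfun) (1 : R) (d2 s).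
  by rewrite !scale1r /=; apply; apply: (@filterE _ (nbhs s)) => y; case: (t1 y).
have DJ i : D *m Jact n (e_ i) = Jact n (e_ i) *m D.
  have := is_diff_linear_eq (L1 := mulmxr (Jact n (e_ i))) (L2 := mulmx (Jact n (e_ i)))
    (1 : R) (d2 s).
  by rewrite !scale1r /=; apply; apply: (@filterE _ (nbhs s)) => y; case: (t1 y).
have QT := projectorT (gam s); have QQ := projector_idem (gam s).
have QJ := projector_commutes (gam s).
have trM := geodesic_normal gg (t := s); rewrite -/q -/D in trM.
move: (prj (gam s)) QT QQ QJ trM => Q QT QQ QJ trM.
(* What remains is that the off-diagonal part of the acceleration is a tangent matrix, against which
   normality may be tested. *)
apply: normal_commutes => //; apply: trM; split=> [|i|].
- rewrite linearB linearD linearZ /= !trmx_mul DT QT mulmxA.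
  by rewrite [Q *m D + _]addrC.
- rewrite mulmxBl mulmxBr mulmxDl mulmxDr -scalemxAl -scalemxAr.
  have com A A' J : A *m J = J *m A -> A' *m J = J *m A' ->
      A *m A' *m J = J *m (A *m A') :> 'M[R]_N.
    by move=> AJ A'J; rewrite -mulmxA A'J mulmxA AJ -mulmxA.
  by rewrite (com _ _ _ (DJ i) (QJ i)) (com _ _ _ (QJ i) (DJ i))
    (com _ _ _ (com _ _ _ (QJ i) (DJ i)) (QJ i)).
- have E1 : Q *m (D *m Q + Q *m D - 2 *: (Q *m D *m Q)) = Q *m D - Q *m D *m Q.
    rewrite mulmxBr mulmxDr -scalemxAr !mulmxA QQ.
    by apply/matrixP => i j; move: (Q *m D *m Q) (Q *m D) => a b; rewrite !mxE; ring.
  have E2 : (D *m Q + Q *m D - 2 *: (Q *m D *m Q)) *m Q = D *m Q - Q *m D *m Q.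
    rewrite mulmxBl mulmxDl -scalemxAl -!(mulmxA _ Q Q) QQ.
    by apply/matrixP => i j; move: (Q *m D *m Q) (D *m Q) => a b; rewrite !mxE; ring.
  rewrite E1 E2; apply/matrixP => i j.
  by move: (Q *m D) (D *m Q) (Q *m D *m Q) => a b c; rewrite !mxE; ring.
Qed.

Lemma geodesic_unique gam1 gam2 : geodesic B g gam1 -> geodesic B g gam2 ->
  gam1 0 = gam2 0 -> velocity B gam1 0 = velocity B gam2 0 ->
  forall s, prj (gam1 s) = prj (gam2 s).
Proof.
move=> gg1 gg2 g0 v0.
have [d1 dd1 c1 t1] := curve_data gg1; have [d2 dd2 c2 t2] := curve_data gg2.
have vE (gam : R -> space) :
    (forall s : R, is_diff s (prj \o gam) (fun v => v *: 'd (prj \o gam) s (1 : R))) ->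
    'd (prj \o gam) (0 : R) (1 : R) = embed (gam 0) (velocity B gam 0).
  by move=> d; have [_ ->] := is_diff_coord_at (d 0); rewrite scale1r.
apply: (projector_curve_unique d1 dd1 d2 dd2 c1 c2).
- by move=> s; exact: projector_idem.
- by move=> s; exact: projector_idem.
- by move=> s; exact: projectorT.
- by move=> s; exact: projectorT.
- by move=> s; case: (t1 s).
- by move=> s; case: (t2 s).
- by rewrite /= g0.
- have e : embed (gam1 0) (velocity B gam1 0) = embed (gam2 0) (velocity B gam2 0).
    by rewrite v0 g0.
  exact: (etrans (vE _ d1) (etrans e (esym (vE _ d2)))).
Qed.

Section GreatCircleGeodesic.
Variables (p : space) (X : 'M[R]_N) (t : R).
Hypothesis tX : tangent_mx (K := K) (projector p) X.
Hypothesis w1 : ip (lift_vec p *m X) (lift_vec p *m X) = 1.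
Let Q := projector p.
Let q (s : R) := double_angle Q X (X *m X) (t * s).
Variable gam : R -> space.
Hypothesis gamE : forall s, prj (gam s) = q s.

Lemma double_angle_smooth_curve : smooth_curve B gam.
Proof.
move=> s0; split.
  apply: (near_projector gamE); apply: differentiable_continuous.
  by case: (is_diff_double_angle Q X (X *m X) t s0).
set i := chart_no (gam s0).
have qe l (U : set R) a b : open U -> ndifferentiable_on l U (fun s => q s a b).
  exact: ndiff_double_angle.
pose a := chart_idx (K := K) i; pose b := mxvec_index i (0 : 'I_k).
have oU : open [set s | q s a b != 0].
  have -> : [set s | q s a b != 0] = (fun s => q s a b) @^-1` [set x | x != 0] by [].
  apply: open_comp => [s _|]; last exact: open_neq.
  have [d _] := qe 1%N setT a b openT; exact: differentiable_continuous (d s _).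
exists [set s | q s a b != 0]; split.
  split=> //=; have := chart_noP (gam s0).
  by rewrite /chart_region /= columnE gamE.
move=> l; have -> : coord_at B (gam s0) \o gam = fun s => rho i (q s).
  by apply/funext => s /=; rewrite coord_atE gamE.
apply: ndiff_mxP => // j c.
have -> : (fun s => rho i (q s) j c) =
    fun s => q s a (mxvec_index (lift i j) c) * (q s a b)^-1.
  by apply/funext => s; rewrite /rho mxE !columnE.
by apply: ndiffM => //; [exact: qe|apply: ndiffV => //; exact: qe].
Qed.

(** The acceleration is a combination of [X *m X] and [q s]. Both preserve the range of [q s] and
    its complement, while a tangent matrix exchanges them, so the traces vanish. *)
Lemma double_angle_geodesic : geodesic B g gam.
Proof.
apply: (normal_geodesic double_angle_smooth_curve) => s v.
have [XT XJ XQ] := tX.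
have YQ : X *m X *m Q = Q.
  have := @unit_tangent R K n (lift_vec p) X (lift_vec1 p) tX w1; exact.
have qdE : prj \o gam = q by apply/funext => y; exact: gamE.
have dq y : 'd q y 1 = t *: double_angle X (2 *: (X *m X) - 4 *: Q) 0 (t * y).
  have [_ E] := is_diff_double_angle Q X (X *m X) t y.
  by have := congr1 (@^~ (1 : R)) E; rewrite mul1r.
have ddq : diff2 q s 1 1 = t *: (t *: (2 *: (X *m X) - 4 *: q s)).
  rewrite /diff2; under [X in 'd X _ _]eq_fun do rewrite dq.
  have D := is_diff_double_angle X (2 *: (X *m X) - 4 *: Q) 0 t s.
  have [_ E] := is_diffZ t D.
  transitivity (t *: ((1 * t) *: double_angle (2 *: (X *m X) - 4 *: Q)
    (2 *: 0 - 4 *: X) 0 (t * s))); first exact: (congr1 (@^~ (1 : R)) E).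
  rewrite mul1r; congr (t *: (t *: _)).
  rewrite /q; move: (X *m X) => Y; apply/matrixP => i j; rewrite !mxE.
  have := cos2Dsin2 (t * s); set c := cos _; set d := sin _ => cd.
  have -> : c ^+ 2 = 1 - d ^+ 2 by rewrite -cd addrK.
  ring.
rewrite qdE ddq -!scalemxAl !mxtraceZ mulmxBl linearB /= -!scalemxAl !mxtraceZ.
have [_ _ MQ] := embed_tangent_mx (gam s) v.
have qM := tr_corner (projector_idem (gam s)) MQ.
rewrite gamE in MQ qM.
have XXX : X *m X *m X = X.
  have -> : X *m X *m X = X *m X *m (Q *m X + X *m Q) by rewrite -XQ.
  rewrite mulmxDr (mulmxA _ Q) YQ -(mulmxA X X (X *m Q)) (mulmxA X X Q) YQ.
  exact/esym.
have Yq : X *m X *m q s = q s.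
  rewrite /q /double_angle !mulmxDr -!scalemxAr YQ XXX.
  by rewrite [X *m X *m (X *m X)]mulmxA XXX.
have qY : q s *m (X *m X) = q s.
  have qT : (q s)^T = q s by rewrite -gamE projectorT.
  have YT : (X *m X)^T = X *m X by rewrite trmx_mul XT.
  by rewrite -[LHS]trmxK trmx_mul YT qT Yq qT.
rewrite qM {1}MQ mulmxDr mxtraceD mulmxA Yq qM add0r.
by rewrite mulmxA mxtrace_mulC mulmxA qY qM !mulr0 subr0 !mulr0.
Qed.

Lemma double_angle_velocity : gam 0 = p /\ embed p (velocity B gam 0) = t *: X.
Proof.
have g0 : gam 0 = p by apply: projector_inj; rewrite gamE /q mulr0 double_angle0.
split=> //.
have qdE : prj \o gam = q by apply/funext => y; exact: gamE.
have := is_diff_double_angle Q X (X *m X) t 0; rewrite -/q -qdE => D.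
by have [_] := is_diff_coord_at D; rewrite g0 mul1r mulr0 double_angle0.
Qed.

End GreatCircleGeodesic.

Lemma unit_lift p v : g p v v = 1 ->
  ip (lift_vec p *m embed p v) (lift_vec p *m embed p v) = 1.
Proof.
have tX := embed_tangent_mx p v.
have k2 : 2 * k%:R != 0 :> R by rewrite mulf_neq0 // pnatr_eq0.
by rewrite (metricE g_metric g_hopf) (tr_tangent_mx tX tX) mulKf.
Qed.

(** The double angle curve is one admissible geodesic, and by uniqueness the one chosen in [rexp]
    ends at the same projector. Putting [t] into the parameter treats all speeds at once, zero
    included. *)
Lemma projector_rexp p v t : g p v v = 1 ->
  prj (rexp B g p (t *: v)) =
  double_angle (prj p) (embed p v) (embed p v *m embed p v) t.
Proof.
move=> v1; have tX := embed_tangent_mx p v.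
have w1 := unit_lift v1.
have [c [_ _ cE]] := great_circle tX w1.
pose gam s := hopf (c (t * s)).
have gE s : prj (gam s) = double_angle (prj p) (embed p v) (embed p v *m embed p v) (t * s).
  exact: cE.
have gg := double_angle_geodesic tX w1 gE.
have [g0 gv] := double_angle_velocity gE.
have gv' : velocity B gam 0 = t *: v by apply: (@embed_inj _ _ _ p); rewrite gv embedZ.
rewrite /rexp; case: xgetP => [q _ [gam' [gg' g'0 g'v <-]]|/(_ (gam 1))]; last first.
  by case; exists gam.
rewrite (geodesic_unique gg' gg); first by rewrite gE mulr1.
  by rewrite g0.
by rewrite gv' g'v.
Qed.

End Geodesics.

(** * The normal flow of a hypersurface *)

Section NormalFlow.
Context {R : realType} {K : scalars} {n m : nat}.
Local Notation k := (kdim K).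
Local Notation N := (n.+1 * k)%N.
Local Notation space := (proj_space R K n).
Local Notation prj := (@projector R K n).

Lemma JactN (i : 'I_k) : i != 0 -> (Jact n (e_ i) : 'M[R]_N)^T = - Jact n (e_ i).
Proof.
move=> i0; rewrite -JactT kconjE ip_e mxE eqxx /= (negPf i0) mulr0 scale0r sub0r.
exact: linearN.
Qed.

Lemma ex_imaginary : exists i : 'I_k, i != 0.
Proof. by exists (inord 1); rewrite -val_eqE /= inordK //; case: K. Qed.

Variables (q X : 'rV[R]_m -> 'M[R]_N) (y0 : 'rV[R]_m).
Hypothesis qX : \forall y \near y0, exists p : space,
  [/\ q y = prj p, tangent_mx (K := K) (prj p) (X y) &
      ip (lift_vec p *m X y) (lift_vec p *m X y) = 1].
Hypothesis q2 : twice_differentiable q y0.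
Hypothesis X1 : differentiable X y0.
Hypothesis normal : \forall y \near y0, forall u, \tr (X y *m 'd q y u) = 0.
Hypothesis q_inj : forall u, 'd q y0 u = 0 -> u = 0.
Let G t y := double_angle (q y) (X y) (X y *m X y) t.
Hypothesis G_inj : forall t u, `|t| <= pi / 4 -> 'd (G t) y0 u = 0 -> u = 0.
Hypothesis codim1 : m.+1 = (n * k)%N.

(** The rows on the left span the line at time [t]; the derivative of this identity is the
    hypothesis [flow_lift]. *)
Lemma double_angle_lift (Q Y : 'M[R]_N) t : Q *m Q = Q -> Q *m Y *m Q = 0 ->
  Q *m (Y *m Y) = Q ->
  (cos t *: Q + sin t *: (Q *m Y)) *m double_angle Q Y (Y *m Y) t =
  cos t *: Q + sin t *: (Q *m Y).
Proof.
move=> QQ QYQ QYY; have := cos2Dsin2 t.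
rewrite /double_angle; move: (cos t) (sin t) => c s cs.
have E1 : Q *m ((c ^+ 2 - s ^+ 2) *: Q + (s * c) *: Y + s ^+ 2 *: (Y *m Y)) =
    c ^+ 2 *: Q + (s * c) *: (Q *m Y).
  rewrite !mulmxDr -!scalemxAr QQ QYY.
  by apply/matrixP => i j; move: (Q *m Y) => A; rewrite !mxE; ring.
have E2 : Q *m Y *m ((c ^+ 2 - s ^+ 2) *: Q + (s * c) *: Y + s ^+ 2 *: (Y *m Y)) =
    (s * c) *: Q + s ^+ 2 *: (Q *m Y).
  rewrite !mulmxDr -!scalemxAr QYQ -!(mulmxA Q Y) QYY (mulmxA Y) (mulmxA Q).
  by rewrite (mulmxA Q Y Y) -(mulmxA Q Y Y) QYY scaler0 add0r.
rewrite mulmxDl -!scalemxAl E1 E2; apply/matrixP => i j.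
move: (Q *m Y) => A; rewrite !mxE.
have -> : c ^+ 2 = 1 - s ^+ 2 by rewrite -cs addrK.
have -> : c * ((1 - s ^+ 2) * Q i j + s * c * A i j) + s * (s * c * Q i j + s ^+ 2 * A i j)
   = c * Q i j + s * (c ^+ 2 + s ^+ 2) * A i j by ring.
by rewrite cs; ring.
Qed.

(** The hypotheses of [focal_point_contradiction] on [a] and [b] are mostly derivatives at [y0] of
    identities that hold near it. *)
Lemma normal_flow_singular : False.
Proof.
have [p0 [qp0 tX0 X01]] := nbhs_singleton qX.
set z := lift_vec p0 in X01; set X0 := X y0 in tX0 X01; set Q := q y0.
have [a qd] : exists a : {linear 'rV[R]_m -> 'M[R]_N}, is_diff y0 q a.
  by exists ('d q y0); apply: differentiableP; exact: nbhs_singleton q2.1.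
have [b Xd] : exists b : {linear 'rV[R]_m -> 'M[R]_N}, is_diff y0 X b.
  by exists ('d X y0); exact: differentiableP.
have aE u : 'd q y0 u = a u by case: qd => _ E; exact: (congr1 (@^~ u) E).
have XXd := is_diff_mulmx Xd Xd.
have near_facts : \forall y \near y0,
    [/\ tangent_mx (K := K) (q y) (X y), X y *m X y *m q y = q y, q y *m q y = q y,
        (q y)^T = q y & forall t, exists p, G t y = prj p].
  apply: filterS qX => y [p [qp tX w1]].
  have U := @unit_tangent R K n (lift_vec p) (X y) (lift_vec1 p) tX w1.
  rewrite !qp; split=> //; [exact: projector_idem|exact: projectorT|move=> t].
  have [c [_ _ cE]] := great_circle tX w1.
  by exists (hopf (c t)); rewrite /G qp cE.
have ta u : tangent_mx (K := K) Q (a u).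
  by apply: tangent_of_curve qd _; apply: filterS qX => y [p [qp _ _]]; exists p.
have [XT XJ XQ] := tX0; rewrite -qp0 -/Q in XQ.
have bT u : (b u)^T = b u.
  apply: (is_diff_linear_eq (L1 := @trmx R N N) (L2 := idfun) u Xd).
  by apply: filterS near_facts => y [[]].
have bJ u i : b u *m Jact n (e_ i) = Jact n (e_ i) *m b u.
  apply: (is_diff_linear_eq (L1 := mulmxr (Jact n (e_ i))) (L2 := mulmx (Jact n (e_ i))) u Xd).
  by apply: filterS near_facts => y [[_ XyJ _] _ _ _ _]; exact: XyJ.
have XqqX := is_diff_add (is_diff_mulmx qd Xd) (is_diff_mulmx Xd qd).
have bQ u : b u = a u *m X0 + X0 *m a u + (Q *m b u + b u *m Q).
  have -> : a u *m X0 + X0 *m a u + (Q *m b u + b u *m Q) =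
      a u *m X0 + Q *m b u + (b u *m Q + X0 *m a u).
    by rewrite addrACA; congr (_ + _); rewrite addrC.
  apply: (is_diff_near_eq u Xd XqqX).
  by apply: filterS near_facts => y [[]].
have unit_diff u : (b u *m X0 + X0 *m b u) *m Q + X0 *m X0 *m a u = a u.
  apply: (is_diff_near_eq u (is_diff_mulmx XXd qd) qd).
  by apply: filterS near_facts => y [].
(* Symmetry of the second fundamental form: differentiating the orthogonality of [X] to ['d q]
   expresses it through the second differential of [q]. *)
have sym u v : \tr (b u *m a v) = \tr (b v *m a u).
  have E s t : \tr (b s *m a t) = - \tr (X0 *m diff2 q y0 s t).
    have D := is_diff_linear_comp (@mxtrace_continuous R K n)
      (is_diff_mulmx Xd (differentiableP (q2.2 t))).
    have Z := is_diff_cst (0 : R) y0.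
    have nE : \forall y \near y0, (mxtrace \o (fun y => X y *m 'd q y t)) y = cst (0 : R) y.
      by apply: filterS normal => y /(_ t).
    have T0 : \tr (b s *m 'd q y0 t + X0 *m diff2 q y0 s t) = 0 := is_diff_near_eq s D Z nE.
    by move/eqP: T0; rewrite aE mxtraceD addr_eq0 => /eqP.
  by rewrite !E (schwarz _ _ q2).
have Gd t : is_diff y0 (G t) (flow_diff X0 a b t).
  rewrite /G /double_angle.
  apply: (is_diff_ext (is_diff_add (is_diff_add
    (is_diff_scale (is_diff_cst (cos t ^+ 2 - sin t ^+ 2) y0) qd)
    (is_diff_scale (is_diff_cst (sin t * cos t) y0) Xd))
    (is_diff_scale (is_diff_cst (sin t ^+ 2) y0) XXd))) => u.
  by rewrite !scale0r !add0r.
have tG t u : tangent_mx (K := K) (G t y0) (flow_diff X0 a b t u).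
  by apply: tangent_of_curve (Gd t) _; apply: filterS near_facts => y [].
have lift_diff t u :
  (cos t *: Q + sin t *: (Q *m X0)) *m flow_diff X0 a b t u +
  (cos t *: a u + sin t *: (a u *m X0 + Q *m b u)) *m double_angle Q X0 (X0 *m X0) t =
  cos t *: a u + sin t *: (a u *m X0 + Q *m b u).
  pose cQ (A B : 'M[R]_N) := cos t *: A + sin t *: B.
  have Cd : is_diff y0 (fun y => cQ (q y) (q y *m X y))
      (fun u => cQ (a u) (a u *m X0 + Q *m b u)).
    apply: is_diff_ext (is_diff_add (is_diff_scale (is_diff_cst (cos t) y0) qd)
      (is_diff_scale (is_diff_cst (sin t) y0) (is_diff_mulmx qd Xd))) _ => v.
    by rewrite !scale0r !add0r.
  rewrite addrC; apply: (is_diff_near_eq u (is_diff_mulmx Cd (Gd t)) Cd).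
  apply: filterS near_facts => y [[XyT _ XyQ] XXq qq qT _].
  apply: double_angle_lift => //; first exact: tangent_corner.
  have YT : (X y *m X y)^T = X y *m X y by rewrite trmx_mul XyT.
  by rewrite -[LHS]trmxK trmx_mul YT qT XXq qT.
have [i1 i10] := ex_imaginary.
have dimN : (m + (1 + k) = N)%N by rewrite addnA addn1 codim1 mulSn addnC.
have UU : frame (K := K) z *m (frame z)^T = 1%:M by rewrite frame_unit lift_vec1.
have XXQ : X0 *m X0 *m Q = Q by case: (nbhs_singleton near_facts).
apply: (focal_point_contradiction (J := fun i => Jact n (e_ i)) (z := z) (X := X0)
  (a := a) (b := b) (Q := Q) qp0 (Jact1 _ _) (@JactTE R K n) JactN UU dimN XT XJ XQ XXQ
  erefl erefl _ bT _ bJ _ bQ unit_diff _ sym _ _ _ _ lift_diff _ i10).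
- by move=> u; case: (ta u).
- by move=> u; case: (ta u).
- by move=> u; case: (ta u).
- by move=> u; rewrite -aE; exact: nbhs_singleton normal u.
- by move=> u; rewrite -aE; exact: q_inj.
- by move=> t u; case: (tG t u).
- by move=> t u; case: (tG t u).
- by move=> t u; case: (tG t u).
- move=> t u t4 fu0; apply: G_inj t4 _.
  by have [_ E] := Gd t; rewrite (congr1 (@^~ u) E).
Qed.

End NormalFlow.

(** * Inverse charts and transition maps *)

Section SmoothAtlas.
Context {R : realType} {E : normedModType R} {M : topologicalType}.
Variable A : set (chart M E).
Hypothesis A_smooth : smooth_atlas A.

Lemma chart_at_dom (x : M) : A (chart_at A x) /\ dom (chart_at A x) x.
Proof.
rewrite /chart_at; case: xgetP => [c _ //|no].
by have [/(_ x)[c Ac cx] _ _] := A_smooth; case: (no c).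
Qed.

Lemma cinvK c p x : A c -> dom c x -> cinv c p (Defs.coord c x) = x.
Proof.
move=> Ac cx; have [_ /(_ c Ac)[_ c_inj _ _] _] := A_smooth.
rewrite /cinv; case: xgetP => [y _ [cy yx]|/(_ x)[]//].
by apply: c_inj => //; rewrite inE.
Qed.

Lemma near_chart c p x (U : set M) : A c -> dom c x -> open U -> U x ->
  \forall y \near Defs.coord c x,
    [/\ dom c (cinv c p y), U (cinv c p y) & Defs.coord c (cinv c p y) = y].
Proof.
move=> Ac cx Uo Ux; have [_ /(_ c Ac)[co _ _ cop] _] := A_smooth.
have V_open : open (dom c `&` U) by exact: openI.
have cV : open (Defs.coord c @` (dom c `&` U)).
  by apply/cop => // z [].
have Vx : (Defs.coord c @` (dom c `&` U)) (Defs.coord c x) by exists x.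
have := open_nbhs_nbhs (conj cV Vx).
by apply: filterS => _ [z [cz Uz] <-]; rewrite cinvK.
Qed.

Lemma chart_open c : A c -> open (dom c).
Proof. by move=> Ac; have [_ /(_ c Ac)[]] := A_smooth. Qed.

(** [smooth_atlas] uses the point itself as default value of the inverse chart; near its coordinates
    the default is never taken, so any [p] will do. *)
Lemma transition_twice c c' p x : A c -> A c' -> dom c x -> dom c' x ->
  twice_differentiable (Defs.coord c' \o cinv c p) (Defs.coord c x).
Proof.
move=> Ac Ac' cx c'x; have [_ _ /(_ c c' x Ac Ac' cx c'x)/smooth_at_twice tr] := A_smooth.
have nE : \forall y \near Defs.coord c x,
    (Defs.coord c' \o cinv c x) y = (Defs.coord c' \o cinv c p) y.
  apply: filterS (near_chart x Ac cx openT I) => y [cy _ yE] /=.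
  by rewrite -{2}yE cinvK.
by have [] := twice_differentiable_near nE tr.
Qed.

Lemma twice_differentiableW (V W : normedModType R) (f : V -> W) x :
  twice_differentiable f x -> differentiable f x.
Proof. by move=> [fd _]; exact: nbhs_singleton fd. Qed.

Lemma transition_inj c c' p x u : A c -> A c' -> dom c x -> dom c' x ->
  'd (Defs.coord c' \o cinv c p) (Defs.coord c x) u = 0 -> u = 0.
Proof.
move=> Ac Ac' cx c'x.
pose t := Defs.coord c' \o cinv c p; pose t' := Defs.coord c \o cinv c' p.
have td := twice_differentiableW (transition_twice p Ac Ac' cx c'x).
have tx : t (Defs.coord c x) = Defs.coord c' x by rewrite /t /= cinvK.
have t'd : differentiable t' (t (Defs.coord c x)).
  by rewrite tx; exact: twice_differentiableW (transition_twice p Ac' Ac c'x cx).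
have nE : \forall y \near Defs.coord c x, id y = (t' \o t) y.
  apply: filterS (near_chart p Ac cx (chart_open Ac') c'x) => y [cy c'y yE].
  by rewrite /t' /t /= cinvK.
have D := is_diff_near nE (is_diff_id (Defs.coord c x)).
move=> tu; have [_ idE] := D.
have : 'd t' (t (Defs.coord c x)) ('d t (Defs.coord c x) u) = u.
  by rewrite -(diff_compE u td t'd); exact: (congr1 (@^~ u) idE).
by rewrite tu linear0 => <-.
Qed.

End SmoothAtlas.

(** * Reduction to a local parametrization *)

Section Hypersurface.
Context {R : realType} {K : scalars} {n m : nat}.
Local Notation k := (kdim K).
Local Notation model := 'M[R]_(n, k).
Local Notation N := (n.+1 * k)%N.
Local Notation space := (proj_space R K n).
Local Notation B := (proj_atlas R K n).
Local Notation prj := (@projector R K n).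
Variable g : space -> model -> model -> R.
Hypothesis g_metric : riemannian_metric B g.
Hypothesis g_hopf : hopf_riemannian_submersion g.
Hypothesis codim1 : m.+1 = (n * k)%N.
Variables (Sigma : topologicalType) (A : set (chart Sigma 'rV[R]_m)).
Hypothesis A_smooth : smooth_atlas A.
Variable F : Sigma -> space.
Hypothesis F_immersion : immersion A B F.

Lemma map_local_map x :
  twice_differentiable (prj \o F \o cinv_at A x) (coord_at A x x) /\
  forall u, 'd (prj \o F \o cinv_at A x) (coord_at A x x) u =
            embed (F x) (mdiff A B F x u).
Proof.
have [/(_ x)[dn sm] _] := F_immersion.
have [Ac cx] := chart_at_dom A_smooth x.
have fx : local_map A B F x (coord_at A x x) = coord_at B (F x) (F x).
  by rewrite /local_map /= /cinv_at /coord_at (cinvK A_smooth).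
have E : \forall y \near coord_at A x x,
    (psi (chart_no (F x)) \o local_map A B F x) y = (prj \o F \o cinv_at A x) y.
  by apply: filterS dn => y dy /=; rewrite /local_map /= psi_coord_at.
have f2 := smooth_at_twice sm.
have [c2 _] := twice_differentiable_comp (psi_twice (chart_no (F x)) _) f2.
have [h2 _] := twice_differentiable_near E c2.
split; [exact: h2|move=> u].
have fd := twice_differentiableW f2.
have pd := twice_differentiableW (psi_twice (chart_no (F x)) (local_map A B F x (coord_at A x x))).
have [_ hE] := near_is_diff E (twice_differentiableW c2).
rewrite (congr1 (@^~ u) hE) (diff_compE u fd pd) /embed -fx.
by [].
Qed.

Section LocalNormal.
(** Any chart and any open part [W] of its domain are allowed, because such data define the charts
    of the normal cover; a global normal field restricts to them as well. *)
Variables (c : chart Sigma 'rV[R]_m) (x0 : Sigma) (W : set Sigma).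
Variable nu : Sigma -> model.
Hypothesis Ac : A c.
Hypothesis Wc : W `<=` dom c.
Hypothesis cW_open : open (Defs.coord c @` W).
Hypothesis Wx0 : W x0.
Hypothesis nu_normal : unit_normal_field A B g F W nu.
Let iota := cinv c x0.
Let y0 := Defs.coord c x0.
Let q := prj \o F \o iota.
Let X y := embed (F (iota y)) (nu (iota y)).

Lemma W_open : open W.
Proof. by have [_ /(_ c Ac)[_ _ _ /(_ W Wc) ->] _] := A_smooth. Qed.

Lemma near_W : \forall y \near y0, W (iota y) /\ Defs.coord c (iota y) = y.
Proof.
apply: filterS (near_chart A_smooth x0 Ac (Wc Wx0) W_open Wx0) => y [_ Wy yE].
by split.
Qed.

(** Needed at all points of the chart, not only at [x0], since orthogonality to the normal is to be
    differentiated. The preferred chart used by [mdiff] varies with [x], hence the transition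
    map. *)
Lemma lifted_map_diff x : dom c x ->
  twice_differentiable q (Defs.coord c x) /\
  forall u, 'd q (Defs.coord c x) u = embed (F x)
    (mdiff A B F x ('d (coord_at A x \o iota) (Defs.coord c x) u)).
Proof.
move=> cx; have [Ac' c'x] := chart_at_dom A_smooth x.
have t2 := transition_twice A_smooth x0 Ac Ac' cx c'x.
have [h2 hE] := map_local_map x.
have tx : (coord_at A x \o iota) (Defs.coord c x) = coord_at A x x.
  by rewrite /= /iota (cinvK A_smooth).
have E : \forall y \near Defs.coord c x,
    ((prj \o F \o cinv_at A x) \o (coord_at A x \o iota)) y = q y.
  have := near_chart A_smooth x0 Ac cx (chart_open A_smooth Ac') c'x.
  apply: filterS => y [_ c'y _]; rewrite /q /= /cinv_at /coord_at.
  by rewrite (cinvK A_smooth).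
rewrite -tx in h2.
have [c2 _] := twice_differentiable_comp h2 t2.
have [q2 _] := twice_differentiable_near E c2.
split; [exact: q2|move=> u].
have [_ qE] := near_is_diff E (twice_differentiableW c2).
rewrite (congr1 (@^~ u) qE).
rewrite (diff_compE u (twice_differentiableW t2) (twice_differentiableW h2)) -hE tx.
by [].
Qed.

Lemma iota0 : iota y0 = x0.
Proof. exact: cinvK A_smooth _ _ _ Ac (Wc Wx0). Qed.

Lemma lifted_map_inj u : 'd q y0 u = 0 -> u = 0.
Proof.
have [_ qE] := lifted_map_diff (Wc Wx0).
rewrite (qE u) => E0; have := embed_inj (etrans E0 (esym (embed0 (F x0)))).
have [_ /(_ x0) F_inj] := F_immersion.
have z : mdiff A B F x0 0 = 0 by exact: linear0.
move=> e1; have := F_inj _ _ (etrans e1 (esym z)).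
have [Ac' c'x] := chart_at_dom A_smooth x0.
exact: (transition_inj A_smooth Ac Ac' (Wc Wx0) c'x).
Qed.

Lemma lifted_normal : \forall y \near y0, forall u, \tr (X y *m 'd q y u) = 0.
Proof.
apply: filterS near_W => y [Wy yE] u.
have [[nn _] _] := nu_normal Wy.
have [_ /(_ u) qE] := lifted_map_diff (Wc Wy).
rewrite yE in qE; rewrite qE mxtrace_mulC.
have := nn ('d (coord_at A (iota y) \o iota) y u).
rewrite (metricE g_metric g_hopf) => /eqP.
by rewrite mulf_eq0 invr_eq0 mulf_eq0 !pnatr_eq0 /= => /eqP.
Qed.

Lemma lifted_unit : \forall y \near y0, exists p : space,
  [/\ q y = prj p, tangent_mx (K := K) (prj p) (X y) &
      ip (lift_vec p *m X y) (lift_vec p *m X y) = 1].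
Proof.
apply: filterS near_W => y [Wy _]; exists (F (iota y)).
have [[_ n1] _] := nu_normal Wy.
by split=> //; [exact: embed_tangent_mx|exact: (unit_lift g_metric g_hopf n1)].
Qed.

(** In the fixed charts at [x0] and [F x0], where smoothness of [nu] is stated, [X] is the
    differential of [psi] at a moving point, applied to a moving vector. *)
Lemma lifted_normal_diff : differentiable X y0.
Proof.
have [_ nu_smooth] := nu_normal Wx0; set nu' := (fun y => _) in nu_smooth.
have [Ac' c'x] := chart_at_dom A_smooth x0.
pose t := coord_at A x0 \o iota; pose f := local_map A B F x0.
have tx : t y0 = coord_at A x0 x0 by rewrite /t /= iota0.
have td : differentiable t y0.
  exact: twice_differentiableW (transition_twice A_smooth x0 Ac Ac' (Wc Wx0) c'x).
have [/(_ x0)[dn fs] _] := F_immersion.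
have fd : differentiable f (t y0) by rewrite tx; exact: smooth_at_differentiable.
have nd : differentiable nu' (t y0) by rewrite tx; exact: smooth_at_differentiable.
have ftd := differentiable_comp td fd; have ntd := differentiable_comp td nd.
have D := is_diff_apply (psi_twice (chart_no (F x0)) ((f \o t) y0))
  (differentiableP ftd) (differentiableP ntd).
have nE : \forall y \near y0, 'd (psi (chart_no (F x0))) ((f \o t) y) ((nu' \o t) y) = X y.
  have tc : t y @[y --> y0] --> t y0 by exact: differentiable_continuous.
  rewrite -tx in dn.
  have dn' : \forall y \near y0, dom (chart_at B (F x0)) (F (cinv_at A x0 (t y))).
    exact: tc _ dn.
  have := near_chart A_smooth x0 Ac (Wc Wx0) (chart_open A_smooth Ac') c'x.
  apply: filterS2 dn' => y dy [_ c'y _].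
  have ty : cinv_at A x0 (t y) = iota y.
    by rewrite /t /= /cinv_at /coord_at (cinvK A_smooth).
  rewrite ty in dy.
  rewrite /f /nu' /local_map /= -/(t y) ty; exact: embed_tangent_to.
by have [] := is_diff_near nE D.
Qed.

Lemma lifted_flow t : \forall y \near y0,
  prj (rexp B g (F (iota y)) (t *: nu (iota y))) =
  double_angle (q y) (X y) (X y *m X y) t.
Proof.
apply: filterS near_W => y [Wy _]; have [[_ n1] _] := nu_normal Wy.
exact: (projector_rexp g_metric g_hopf t n1).
Qed.

(** Stated on the coordinates [y], so that immersions of the hypersurface and of its normal cover
    both reduce to it. *)
Lemma local_focal_bound r : pi / 4 < r ->
  (forall t, `|t| < r ->
    let Phi y := rexp B g (F (iota y)) (t *: nu (iota y)) in
    [/\ \forall y \near y0, dom (chart_at B (Phi y0)) (Phi y),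
        differentiable (coord_at B (Phi y0) \o Phi) y0 &
        injective ('d (coord_at B (Phi y0) \o Phi) y0)]) -> False.
Proof.
move=> r4 Phi_imm.
have [q2 _] := lifted_map_diff (Wc Wx0).
apply: (normal_flow_singular lifted_unit q2 lifted_normal_diff lifted_normal
  lifted_map_inj _ codim1) => t u t4 Gu0.
pose Phi y := rexp B g (F (iota y)) (t *: nu (iota y)).
pose L := coord_at B (Phi y0) \o Phi.
have [dn Ld L_inj] : [/\ \forall y \near y0, dom (chart_at B (Phi y0)) (Phi y),
    differentiable L y0 & injective ('d L y0)] by exact: Phi_imm (le_lt_trans t4 r4).
have nE : \forall y \near y0, double_angle (q y) (X y) (X y *m X y) t =
    (psi (chart_no (Phi y0)) \o L) y.
  apply: filterS2 dn (lifted_flow t) => y dy <-.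
  by rewrite /= /L /= psi_coord_at.
have pd := twice_differentiableW (psi_twice (chart_no (Phi y0)) (L y0)).
have cd := differentiable_comp Ld pd.
have nE' : \forall y \near y0, (psi (chart_no (Phi y0)) \o L) y =
    double_angle (q y) (X y) (X y *m X y) t.
  by apply: filterS nE => y ->.
have [_ GE] := near_is_diff nE' cd.
have LE : embed (Phi y0) ('d L y0 u) = 0.
  rewrite -[RHS]Gu0; apply: esym; rewrite (congr1 (@^~ u) GE).
  exact: diff_compE.
have L0 := embed_inj (etrans LE (esym (embed0 (Phi y0)))).
by apply: L_inj; rewrite L0 linear0.
Qed.

End LocalNormal.

End Hypersurface.

(** * The focal radius, on the hypersurface and on its normal cover *)

Section FocalRadius.
Context {R : realType} {K : scalars} {n m : nat}.
Local Notation k := (kdim K).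
Local Notation model := 'M[R]_(n, k).
Local Notation space := (proj_space R K n).
Local Notation B := (proj_atlas R K n).
Variable g : space -> model -> model -> R.
Hypothesis g_metric : riemannian_metric B g.
Hypothesis g_hopf : hopf_riemannian_submersion g.
Hypothesis codim1 : m.+1 = (n * k)%N.
Variables (Sigma : topologicalType) (A : set (chart Sigma 'rV[R]_m)).
Hypothesis A_smooth : smooth_atlas A.
Variable F : Sigma -> space.
Hypothesis F_immersion : immersion A B F.

Lemma focal_radius_le (M : choiceType) (C : set (chart M 'rV[R]_m)) (F' : M -> space)
    (nu : M -> model) :
  (forall r, pi / 4 < r -> (forall t, `|t| < r -> immersion C B (normal_flow B g F' nu t)) ->
     False) ->
  (focal_radius C B g F' nu <= (pi / 4)%:E)%E.
Proof.
move=> H; apply: ub_ereal_sup => _ [r [r0 imm] <-].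
rewrite lee_fin leNgt; apply/negP => r4; exact: (H r).
Qed.

Lemma two_sided_focal_radius nu (x0 : Sigma) :
  unit_normal_field A B g F [set: Sigma] nu ->
  (focal_radius A B g F nu <= (pi / 4)%:E)%E.
Proof.
move=> nuN; apply: focal_radius_le => r r4 imm.
have [Ac cx] := chart_at_dom A_smooth x0.
have Wc : dom (chart_at A x0) `<=` dom (chart_at A x0) by [].
have [_ /(_ _ Ac)[_ _ cWo _] _] := A_smooth.
have nuW : unit_normal_field A B g F (dom (chart_at A x0)) nu by move=> x _; exact: nuN.
apply: (local_focal_bound g_metric g_hopf codim1 A_smooth F_immersion
  Ac Wc cWo cx nuW r4) => t tr Phi.
have [/(_ x0)[dn sm] /(_ x0) inj] := imm t tr.
have i0 : cinv (chart_at A x0) x0 (Defs.coord (chart_at A x0) x0) = x0.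
  exact: cinvK A_smooth _ _ _ Ac cx.
have P0 : Phi (Defs.coord (chart_at A x0) x0) = normal_flow B g F nu t x0.
  by rewrite /Phi i0.
rewrite P0; split; [exact: dn|exact: smooth_at_differentiable sm|exact: inj].
Qed.

(** Orthogonality to the hypersurface is [m] linear equations in [m.+1] unknowns; a nonzero solution
    is then normalized. *)
Lemma ex_unit_normal x : exists v, unit_normal A B g F x v.
Proof.
have [gl gs gp _] := g_metric.
pose w i : model := mdiff A B F x (delta_mx 0 i).
pose Mat : 'M[R]_(n * k, m) := \matrix_(j, i) g (F x) (w i) (vec_mx (delta_mx 0 j)).
have : kermx Mat != 0.
  rewrite kermx_eq0 /row_free neq_ltn.
  by rewrite (leq_ltn_trans (rank_leq_col _)) // -codim1.
move=> /rowV0Pn[u /sub_kermxP uM u0].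
pose v : model := vec_mx u.
have g0 p a : g p 0 a = 0.
  have := gl p 1 0 0 a; rewrite scaler0 addr0 mul1r => /eqP.
  by rewrite addrC -subr_eq subrr eq_sym => /eqP.
have gsum p a (I : finType) (c : I -> R) (f : I -> model) :
    g p (\sum_i c i *: f i) a = \sum_i c i * g p (f i) a.
  by elim/big_rec2: _ => [|i y1 y2 _ <-]; [exact: g0|exact: gl].
have gw i : g (F x) (w i) v = 0.
  have -> : v = \sum_j u 0 j *: vec_mx (delta_mx 0 j).
    by rewrite /v {1}(row_sum_delta u) linear_sum; apply: eq_bigr => j _; rewrite linearZ.
  rewrite gs gsum; have := congr1 (fun M : 'rV[R]_m => M 0 i) uM.
  by rewrite !mxE => E; rewrite -[RHS]E; apply: eq_bigr => j _; rewrite mxE gs.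
have v0 : v != 0 by apply: contra u0 => /eqP v0; rewrite -[u]vec_mxK -/v v0 linear0.
have gv := gp (F x) v v0.
exists ((Num.sqrt (g (F x) v v))^-1 *: v).
have gZ p a b c : g p (c *: a) b = c * g p a b.
  by have := gl p c a 0 b; rewrite addr0 g0 addr0.
split=> [y|]; last first.
  rewrite gZ gs gZ mulrA -expr2 exprVn sqr_sqrtr ?(ltW gv) // mulVf //.
  by rewrite gt_eqF.
rewrite gs gZ gs.
have -> : mdiff A B F x y = \sum_i y 0 i *: w i.
  rewrite {1}(row_sum_delta y) [mdiff _ _ _ _ _]linear_sum.
  by apply: eq_bigr => i _; rewrite linearZ.
by rewrite gsum big1 ?mulr0 // => i _; rewrite gw mulr0.
Qed.

Lemma normal_cover_focal_radius (x0 : Sigma) :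
  (focal_radius (normal_cover_atlas A B g F) B g (cover_map A B g F)
     (cover_normal A B g F) <= (pi / 4)%:E)%E.
Proof.
apply: focal_radius_le => r r4 imm.
have r0 : 0 < r by apply: lt_trans r4; rewrite divr_gt0 // pi_gt0.
have [n0 un0] := ex_unit_normal x0.
pose q0 : normal_cover A B g F := exist _ (x0, n0) (asboolT un0).
set C := normal_cover_atlas A B g F in imm.
(* If no chart of the cover contained [q0], the preferred chart would be the default one, with
   constant inverse. The flow at time 0 would then be constant in coordinates and could not be an
   immersion. *)
have [[d [Cd dq0]]|no] := pselect (exists d, C d /\ dom d q0); last first.
  have [_ /(_ q0)] := imm 0 (eq_ind_r (fun z => z < r) r0 (normr0 R)).
  have cE : chart_at C q0 = Chart set0 (fun=> 0).
    by rewrite /chart_at; case: xgetP => // d _ Cd; case: no; exists d.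
  have lE : local_map C B (normal_flow B g (cover_map A B g F) (cover_normal A B g F) 0) q0 =
      cst (local_map C B (normal_flow B g (cover_map A B g F) (cover_normal A B g F) 0) q0 0).
    apply/funext => y; rewrite /local_map /cst /= /cinv_at cE /cinv.
    by do 2![case: xgetP => [? _ [] //|_]].
  rewrite /mdiff lE => inj.
  (* [m = 0] would give [n * k = 1], while [k] is 2 or 4; a nonzero vector is needed against
     injectivity. *)
  have m0 : (0 < m)%N.
    rewrite lt0n; apply/eqP => m0; move: codim1; rewrite m0 => /esym/eqP.
    by rewrite muln_eq1 => /andP[_]; case: K.
  have : (delta_mx 0 (Ordinal m0) : 'rV[R]_m) = 0.
    have [_ dcst] := is_diff_cst
      (local_map C B (normal_flow B g (cover_map A B g F) (cover_normal A B g F) 0) q0 0)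
      (coord_at C q0 q0).
    apply: inj; rewrite linear0; exact: (congr1 (@^~ _) dcst).
  by move/rowP => /(_ (Ordinal m0)); rewrite !mxE !eqxx => /eqP; rewrite oner_eq0.
have {Cd dq0} [Cd dq0] : C (chart_at C q0) /\ dom (chart_at C q0) q0.
  by rewrite /chart_at; case: xgetP => [d' _ //|/(_ d)]; case.
have [c [W [nu [Ac Wc cWo nuN dE]]]] := Cd.
have [Wx0 n0E] : W x0 /\ n0 = nu x0 by move: dq0; rewrite dE.
pose y0 := Defs.coord c x0.
(* On the sheet defined by [nu], a point of the cover is determined by its base point, so inverting
   the chart of the cover amounts to inverting [c]. *)
have cinvE : \forall y \near y0,
    (val (cinv_at C q0 y)).1 = cinv c x0 y /\
    (val (cinv_at C q0 y)).2 = nu (cinv c x0 y).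
  apply: filterS (near_W A_smooth Ac Wc cWo Wx0) => y [Wy yE].
  have [un _] := nuN _ Wy.
  pose qy : normal_cover A B g F := exist _ (cinv c x0 y, nu (cinv c x0 y)) (asboolT un).
  rewrite /cinv_at dE /cinv; case: xgetP => [q _ [[Wq ->] /= qyE]|/(_ qy)].
    have -> : (val q).1 = cinv c x0 y by rewrite -qyE (cinvK A_smooth _ Ac (Wc _ Wq)).
    by [].
  by case.
apply: (local_focal_bound g_metric g_hopf codim1 A_smooth F_immersion
  Ac Wc cWo Wx0 nuN r4) => t tr Phi.
have [/(_ q0)[dn sm] /(_ q0) inj] := imm t tr.
have coordE : coord_at C q0 q0 = y0 by rewrite /coord_at dE.
have i0 : cinv c x0 y0 = x0 by exact: cinvK A_smooth _ _ _ Ac (Wc _ Wx0).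
set N := normal_flow _ _ _ _ _ in dn sm inj.
have PE : \forall y \near y0, N (cinv_at C q0 y) = Phi y.
  apply: filterS cinvE => y [e1 e2].
  by rewrite /N /normal_flow /cover_map /cover_normal e1 e2.
have P0 : Phi y0 = N q0.
  by rewrite /Phi i0 /N /normal_flow /cover_map /cover_normal /= n0E.
rewrite /mdiff coordE in dn sm inj.
have LE : \forall y \near y0, local_map C B N q0 y = (coord_at B (N q0) \o Phi) y.
  by apply: filterS PE => y e; rewrite /local_map /= e.
have [Ld LdE] := near_is_diff LE (smooth_at_differentiable sm).
rewrite P0; split; [ |exact: Ld| ].
  by apply: filterS2 PE dn => y <-.
move=> u v e; apply: inj.
exact: (etrans (esym (congr1 (@^~ u) LdE)) (etrans e (congr1 (@^~ v) LdE))).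
Qed.

End FocalRadius.

Theorem theorem5p2 (R : realType) (K : scalars) (n m : nat)
    (codim1 : m.+1 = (n * kdim K)%N)
    (g : proj_space R K n -> 'M[R]_(n, kdim K) -> 'M[R]_(n, kdim K) -> R)
    (g_metric : riemannian_metric (proj_atlas R K n) g)
    (g_hopf : hopf_riemannian_submersion g)
    (Sigma : topologicalType) (A : set (chart Sigma 'rV[R]_m))
    (Sigma_closed : closed_connected_manifold A)
    (F : Sigma -> proj_space R K n)
    (F_immersion : immersion A (proj_atlas R K n) F) :
  let B := proj_atlas R K n in
  (forall nu : Sigma -> 'M[R]_(n, kdim K),
     unit_normal_field A B g F [set: Sigma] nu ->
     (focal_radius A B g F nu <= (pi / 4)%:E)%E) /\
  (~ two_sided A B g F ->
     (focal_radius (normal_cover_atlas A B g F) B g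
        (cover_map A B g F) (cover_normal A B g F) <= (pi / 4)%:E)%E).
Proof.
have [[_ _ A_smooth] [x0 _] _ _] := Sigma_closed.
split=> [nu|_]; first exact: two_sided_focal_radius.
exact: normal_cover_focal_radius.
Qed.
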